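(* Let $p>1$ be fixed, let $\mathbf{y}_1,\mathbf{y}_2,\ldots$ be independent random vectors with common distribution $F$ on $\mathbb{R}^p$, and let $\mathbf{z}_{i,j}=(\mathbf{y}_i+\mathbf{y}_j)/2$ for $i<j$. Assume that (a) the density of $\mathbf{z}_{i,j}$ is continuous and bounded, and (b) the spatial median of $\mathbf{z}_{i,j}$ is unique and equal to $\boldsymbol{\mu}_{\mathrm{HL}}=\mathbf{0}$. Let $\hat{\boldsymbol{\mu}}_{\mathrm{HL}}$ be the sample spatial Hodges-Lehmann estimator based on $\mathbf{y}_1,\ldots,\mathbf{y}_n$. Then, as $n\to\infty$, $$\sqrt{n}\,\hat{\boldsymbol{\mu}}_{\mathrm{HL}}\stackrel{d}{\longrightarrow}N_p(\mathbf{0},\,4\mathbf{A}^{-1}\mathbf{B}\mathbf{A}^{-1}),$$ where $$\mathbf{A}=\mathbb{E}\left\{\|\mathbf{z}_{1,2}\|^{-1}\left(\mathbf{I}_p-\|\mathbf{z}_{1,2}\|^{-2}\mathbf{z}_{1,2}\mathbf{z}_{1,2}^{\top}\right)\right\}\quad\text{and}\quad \mathbf{B}=\mathbb{E}\left\{\left(\|\mathbf{z}_{1,2}\|^{-1}\mathbf{z}_{1,2}\right)\left(\|\mathbf{z}_{2,3}\|^{-1}\mathbf{z}_{2,3}^{\top}\right)\right\}.$$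
   Context: $\|\cdot\|$ is the Euclidean norm and $\mathbf{I}_p$ the $p\times p$ identity matrix. A spatial median of a $p$-variate random vector $\mathbf{z}$ is a minimizer over $\boldsymbol{\mu}\in\mathbb{R}^p$ of $\mathbb{E}\{\|\mathbf{z}-\boldsymbol{\mu}\|-\|\mathbf{z}\|\}$ (this expectation always exists). The vectors $\mathbf{z}_{i,j}$, $1\le i<j\le n$, are called Walsh averages; note that $\mathbf{z}_{1,2}$ and $\mathbf{z}_{2,3}$ are dependent, sharing $\mathbf{y}_2$. The sample spatial Hodges-Lehmann estimator $\hat{\boldsymbol{\mu}}_{\mathrm{HL}}$ is a minimizer over $\boldsymbol{\mu}\in\mathbb{R}^p$ of $$d_{2n}(\boldsymbol{\mu})=\binom{n}{2}^{-1}\sum_{1\le i<j\le n}\left\{\|\mathbf{z}_{i,j}-\boldsymbol{\mu}\|-\|\mathbf{z}_{i,j}\|\right\}.$$ *)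

(* Defs.v *)
(* MathComp-Analysis, over an abstract R : realType; R^p is 'cV[R]_p. *)
From HB Require Import structures.
From mathcomp Require Import all_boot all_order all_algebra.
From mathcomp Require Import all_classical all_reals all_analysis measurable_realfun.
Set Implicit Arguments.
Unset Strict Implicit.
Unset Printing Implicit Defensive.
Import Order.TTheory GRing.Theory Num.Theory.
Import numFieldNormedType.Exports.
Local Open Scope classical_set_scope.
Local Open Scope ring_scope.

(* The Borel sigma-algebra on matrices, hence on R^p = 'cV[R]_p. *)
Definition borel_mx_display : measure_display.
Proof. exact: default_measure_display. Qed.

Section borel_mx.
Context (R : realType) (m n : nat).
Let borel : set (set 'M[R]_(m, n)) := <<s [set A | open A] >>.

Let borel0 : borel set0. Proof. exact: sigma_algebra0. Qed.
Let borelC A : borel A -> borel (~` A). Proof. exact: sigma_algebraC. Qed.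
Let borel_bigcup (F : (set 'M[R]_(m, n))^nat) :
  (forall i, borel (F i)) -> borel (\bigcup_i F i).
Proof. exact: sigma_algebra_bigcup. Qed.

HB.instance Definition _ := @isMeasurable.Build borel_mx_display
  'M[R]_(m, n) borel borel0 borelC borel_bigcup.
End borel_mx.

Lemma continuous_measurable_mx (R : realType) (m n : nat) (f : 'M[R]_(m, n) -> R) :
  continuous f -> measurable_fun setT f.
Proof.
move=> cf; apply: (measurability _ (RGenOpens.measurableE R)) => //.
move=> _ [_ [a [b ->]] <-]; rewrite setTI; apply: sub_sigma_algebra => /=.
by move/continuousP : cf; apply; exact: interval_open.
Qed.

Lemma measurable_fun_mxP d (T : measurableType d) (R : realType) (m n : nat)
    (f : T -> 'M[R]_(m, n)) :
  measurable_fun setT f <-> forall i j, measurable_fun setT (fun x => f x i j).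
Proof.
split=> [mf i j|mf].
  apply: (@measurableT_comp _ _ _ _ _ _ (fun M : 'M[R]_(m,n) => M i j)) => //.
  by apply: continuous_measurable_mx; exact: coord_continuous.
apply: measurability; first by reflexivity.
move=> _ [A /= oA <-]; rewrite setTI.
pose B (q : 'M[rat]_(m, n) * nat) : set 'M[R]_(m, n) :=
  [set M | forall i j, `|ratr (q.1 i j) - M i j| < q.2.+1%:R^-1].
have -> : f @^-1` A = \bigcup_q (if `[< B q `<=` A >] then f @^-1` B q else set0).
  apply/seteqP; split=> x /=; last by move=> [q _]; case: ifPn => // /asboolP; exact.
  move=> Afx; have /nbhs_ballP[e/= e0 beA] : nbhs (f x) A by exact: open_nbhs_nbhs.
  have [k ke] : exists k, k.+1%:R^-1 < e / 2 :> R.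
    have [N _ /(_ N (leqnn N))] := near_infty_natSinv_lt (PosNum (divr_gt0 e0 (ltr0Sn R 1))).
    by exists N.
  have /choice[q qP] (ij : 'I_m * 'I_n) :
      exists q : rat, `|ratr q - f x ij.1 ij.2| < k.+1%:R^-1.
    have k0 : 0 < k.+1%:R^-1 :> R by [].
    have [|q] := @rat_in_itvoo R (f x ij.1 ij.2 - k.+1%:R^-1) (f x ij.1 ij.2 + k.+1%:R^-1).
      by rewrite ltrD2l gtrN.
    by rewrite in_itv/= -ltr_distl => ?; exists q.
  exists (\matrix_(i, j) q (i, j), k) => //=.
  case: ifPn => [_ i j /=|/asboolP[]]; first by rewrite mxE; exact: (qP (i, j)).
  move=> N BN; apply: beA; split=> // i j; have /= := BN i j; rewrite mxE => qN.
  rewrite /ball/= (_ : _ - _ = (f x i j - ratr (q (i, j))) + (ratr (q (i, j)) - N i j)).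
    rewrite (le_lt_trans (ler_normD _ _))// (splitr e) ltrD//.
      by rewrite distrC (lt_trans _ ke)//; exact: (qP (i, j)).
    exact: lt_trans ke.
  by rewrite addrA subrK.
apply: countable_bigcupT_measurable.
  exact: countableP.
move=> q; case: ifP => _ //.
have -> : f @^-1` B q = \bigcap_(ij in [set: 'I_m * 'I_n])
    (fun x => `|ratr (q.1 ij.1 ij.2) - f x ij.1 ij.2|) @^-1` `]-oo, q.2.+1%:R^-1[.
  apply/seteqP; split=> x /=.
    by move=> H [i j] _ /=; rewrite in_itv/=.
  by move=> H i j; have /= := H (i, j) I; rewrite in_itv/=.
apply: fin_bigcap_measurable => // -[i j] _ /=.
rewrite -[X in measurable X]setTI.
have : measurable_fun [set: T] (fun x => `|ratr (q.1 i j) - f x i j|).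
  apply: measurableT_comp => //; apply: measurable_funB => //.
exact.
Qed.

(* Lebesgue measure on R^p: R^(p+1) is identified with R * R^p. *)
Definition cons_cV (R : realType) (p : nat)
    (xv : measurableTypeR R * 'cV[R]_p) : 'cV[R]_p.+1 :=
  col_mx (const_mx xv.1 : 'cV_1) xv.2.

Fixpoint lebesgue_cV (R : realType) (p : nat) : set 'cV[R]_p -> \bar R :=
  match p return set 'cV[R]_p -> \bar R with
  | 0 => \d_(0 : 'cV[R]_0)
  | q.+1 => pushforward (lebesgue_measure \x @lebesgue_cV R q)%E (@cons_cV R q)
  end.

Section lebesgue_cV.
Context (R : realType).

Let sigma_finite_prod d1 d2 (T1 : measurableType d1) (T2 : measurableType d2)
    (m1 : {sigma_finite_measure set T1 -> \bar R})
    (m2 : {sigma_finite_measure set T2 -> \bar R}) :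
  sigma_finite setT (m1 \x m2)%E.
Proof.
have /sigma_finiteP[F [TF ndF Foo]] := sigma_finiteT m1.
have /sigma_finiteP[G [TG ndG Goo]] := sigma_finiteT m2.
exists (fun n => F n `*` G n).
  rewrite -setXTT TF TG predeqE => -[x y]; split; last first.
    by move=> [n _ []/= ? ?]; split; exists n.
  move=> [/= [n _ Fnx] [k _ Gky]]; exists (maxn n k) => //; split.
  - by move: x Fnx; exact/subsetPset/ndF/leq_maxl.
  - by move: y Gky; exact/subsetPset/ndG/leq_maxr.
move=> k; have [? ?] := Foo k; have [? ?] := Goo k.
split; first exact: measurableX.
by rewrite product_measure1E// lte_mul_pinfty// ge0_fin_numE.
Qed.

Lemma measurable_cons_cV p : measurable_fun setT (@cons_cV R p).
Proof.
apply/measurable_fun_mxP => i j.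
rewrite -(@splitK 1 p i); case: (fintype.split (i : 'I_(1 + p))) => k /=.
  under eq_fun do rewrite (col_mxEu (const_mx _.1 : 'cV_1)) mxE.
  exact: measurable_fst.
under eq_fun do rewrite (col_mxEd (const_mx _.1 : 'cV_1)).
have /measurable_fun_mxP := @measurable_snd _ _ (measurableTypeR R) 'cV[R]_p.
exact.
Qed.

Definition lebesgue_cV_step p (mu : {sigma_finite_measure set 'cV[R]_p -> \bar R}) :
    set 'cV[R]_p.+1 -> \bar R :=
  pushforward (lebesgue_measure \x mu)%E (@cons_cV R p).

Section step.
Context (p : nat) (mu : {sigma_finite_measure set 'cV[R]_p -> \bar R}).

Let step_measure : {measure set 'cV[R]_p.+1 -> \bar R}.
Proof.
pose nu : {measure set _ -> \bar R} :=
  pushforward (lebesgue_measure \x mu)%E (@cons_cV R p).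
exact: (nu (@measurable_cons_cV p)).
Defined.

HB.instance Definition _ := Measure.copy (lebesgue_cV_step mu) step_measure.

Let sigma_finite_step : sigma_finite setT (lebesgue_cV_step mu).
Proof.
have [F FT Foo] := sigma_finite_prod lebesgue_measure mu.
pose psi (v : 'cV[R]_p.+1) : measurableTypeR R * 'cV[R]_p :=
  (v 0 0, @dsubmx R 1 p 1 v).
have psiK : psi \o @cons_cV R p = id.
  apply/funext => -[a v]; rewrite /psi/cons_cV /= col_mxKd; congr (_, _).
  have -> : 0 = lshift p 0 :> 'I_(1 + p) by apply/val_inj.
  by rewrite (col_mxEu (const_mx a : 'cV_1)) mxE.
have mpsi : measurable_fun setT psi.
  apply/measurable_fun_pairP; split; first exact: (measurable_fun_mxP id).1.
  apply/measurable_fun_mxP => i j; under eq_fun do rewrite /= mxE.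
  exact: (measurable_fun_mxP id).1.
exists (fun n => psi @^-1` F n).
  by rewrite -preimage_bigcup -FT preimage_setT.
move=> n; split.
  by rewrite -[X in measurable X]setTI; apply: mpsi => //; exact: (Foo n).1.
rewrite /lebesgue_cV_step /pushforward -comp_preimage psiK.
exact: (Foo n).2.
Qed.

HB.instance Definition _ :=
  Measure_isSigmaFinite.Build _ _ _ (lebesgue_cV_step mu) sigma_finite_step.

End step.

Lemma lebesgue_cV_spec p :
  exists mu : {sigma_finite_measure set 'cV[R]_p -> \bar R}, @lebesgue_cV R p = mu.
Proof.
elim: p => [|p [mu IH]]; first by exists \d_(0 : 'cV[R]_0).
by exists (lebesgue_cV_step mu); rewrite /= IH.
Qed.

Section instances.
Context (p : nat).

Let lebesgue_cV0 : @lebesgue_cV R p set0 = 0%E.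
Proof. by have [mu ->] := lebesgue_cV_spec p; exact: measure0. Qed.

Let lebesgue_cV_ge0 A : (0 <= @lebesgue_cV R p A)%E.
Proof. by have [mu ->] := lebesgue_cV_spec p; exact: measure_ge0. Qed.

Let lebesgue_cV_sigma_additive : semi_sigma_additive (@lebesgue_cV R p).
Proof.
by have [mu ->] := lebesgue_cV_spec p; exact: measure_semi_sigma_additive.
Qed.

HB.instance Definition _ := isMeasure.Build _ _ _ (@lebesgue_cV R p)
  lebesgue_cV0 lebesgue_cV_ge0 lebesgue_cV_sigma_additive.

Let lebesgue_cV_sigma_finite : sigma_finite setT (@lebesgue_cV R p).
Proof. by have [mu ->] := lebesgue_cV_spec p; exact: sigma_finiteT. Qed.

HB.instance Definition _ := Measure_isSigmaFinite.Build _ _ _ (@lebesgue_cV R p)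
  lebesgue_cV_sigma_finite.

End instances.

Lemma lebesgue_cV_box p (a b : 'cV[R]_p) : (forall i, a i 0 <= b i 0) ->
  lebesgue_cV [set v | forall i, a i 0 <= v i 0 <= b i 0] =
  (\prod_i (b i 0 - a i 0))%:E.
Proof.
elim: p a b => [|p IH] a b ab.
  by rewrite big_ord0 /= diracE mem_set// => -[].
pose a' := \col_i a (lift 0 i) 0; pose b' := \col_i b (lift 0 i) 0.
pose box : set 'cV[R]_p := [set v | forall i, a' i 0 <= v i 0 <= b' i 0].
have mbox : measurable box.
  have -> : box = \bigcap_(i in [set: 'I_p])
      (fun v : 'cV[R]_p => v i 0) @^-1` `[a' i 0, b' i 0].
    apply/seteqP; split=> v /= H i; first by move=> _; rewrite /= in_itv; exact: H.
    by have := H i I; rewrite /= in_itv.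
  apply: fin_bigcap_measurable => // i _.
  rewrite -[X in measurable X]setTI.
  by apply: (measurable_fun_mxP id).1.
have col0 (x : R) (v : 'cV[R]_p) : cons_cV (x, v) 0 0 = x.
  transitivity (col_mx (const_mx x : 'cV_1) v (lshift p 0) 0).
    by congr (col_mx _ _ _ _); apply/val_inj.
  by rewrite col_mxEu mxE.
have colS (x : R) (v : 'cV[R]_p) i : cons_cV (x, v) (lift 0 i) 0 = v i 0.
  transitivity (col_mx (const_mx x : 'cV_1) v (rshift 1 i) 0).
    by congr (col_mx _ _ _ _); apply/val_inj.
  by rewrite col_mxEd.
have [mu muE] := lebesgue_cV_spec p.
rewrite /= muE /pushforward.
have -> : @cons_cV R p @^-1` [set v | forall i, a i 0 <= v i 0 <= b i 0] =
    `[a 0 0, b 0 0]%classic `*` box.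
  apply/seteqP; split=> -[x v] /=.
    move=> H; split; first by move: (H 0); rewrite col0.
    by move=> i; have := H (lift 0 i); rewrite colS !mxE.
  move=> [Hx Hv] i; case: (unliftP ord0 i) => [j ->|->].
    by rewrite colS; have := Hv j; rewrite !mxE.
  by rewrite col0.
rewrite product_measure1E// -muE IH; last by move=> i; rewrite !mxE; exact: ab.
rewrite big_ord_recl EFinM; congr (_ * _)%E.
  rewrite [LHS](lebesgue_measure_itv `[a 0 0, b 0 0]) /= lte_fin.
  move: (ab 0); rewrite le_eqVlt => /predU1P[->|ab0]; last by rewrite ab0 EFinB.
  by rewrite ltxx subrr.
by congr EFin; apply: eq_bigr => i _; rewrite !mxE.
Qed.

End lebesgue_cV.

Section vectors.
Context (R : realType) (p : nat).
Implicit Types u v : 'cV[R]_p.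

Definition dotv u v : R := \sum_i u i 0 * v i 0.

(* The library's norm on matrices is the sup norm. *)
Definition enorm v : R := Num.sqrt (\sum_i v i 0 ^+ 2).

Definition is_minimizer d (V : porderType d) (f : 'cV[R]_p -> V) u :=
  forall v, (f u <= f v)%O.

End vectors.

Section random_vectors.
Context (R : realType) d (T : measurableType d) (P : probability T R).

Definition mutually_independent d' (U : measurableType d') (X : nat -> T -> U) :=
  forall (s : seq nat) (B : nat -> set U), uniq s -> (forall i, measurable (B i)) ->
    P (\bigcap_(i in [set` s]) (X i @^-1` B i)) =
    (\prod_(i <- s) P (X i @^-1` B i))%E.

Definition has_density p (X : T -> 'cV[R]_p) (f : 'cV[R]_p -> R) :=
  [/\ measurable_fun setT f, forall x, 0 <= f x &
      forall B, measurable B ->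
        P (X @^-1` B) = (\int[@lebesgue_cV R p]_(x in B) (f x)%:E)%E].

(* Entrywise; an entry that is not integrable would be sent to a junk value. *)
Definition expectation_mx m n (M : T -> 'M[R]_(m, n)) : 'M[R]_(m, n) :=
  \matrix_(i, j) fine 'E_P[fun w => M w i j]%E.

Definition is_spatial_median p (X : T -> 'cV[R]_p) (mu : 'cV[R]_p) :=
  is_minimizer (fun nu => 'E_P[fun w => (enorm (X w - nu) - enorm (X w))%R]%E) mu.

Definition cvg_in_law p (X : nat -> T -> 'cV[R]_p) (Q : probability 'cV[R]_p R) :=
  forall f : 'cV[R]_p -> R, continuous f -> bounded_fun (f : _ -> R^o) ->
    'E_P[fun w => f (X n w)]%E @[n --> \oo] --> (\int[Q]_x (f x)%:E)%E.

End random_vectors.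

(* normal_prob m 0 is not a point mass, hence the case distinction. *)
Definition normal_law (R : realType) (m v : R) (B : set R) : \bar R :=
  if v == 0 then \d_m B else normal_prob m (Num.sqrt v) B.

(* N_p(m, S), with S possibly singular: every linear functional is univariate
   normal. *)
Definition is_mvnormal (R : realType) p (m : 'cV[R]_p) (S : 'M[R]_p)
    (Q : probability 'cV[R]_p R) :=
  [/\ S^T = S,
      forall t, 0 <= dotv t (S *m t) &
      forall (t : 'cV[R]_p) (B : set R), measurable B ->
        Q (dotv t @^-1` B) = normal_law (dotv t m) (dotv t (S *m t)) B].

Section walsh.
Context (R : realType) (p : nat) (x : nat -> 'cV[R]_p).

Definition walsh (i j : nat) : 'cV[R]_p := 2^-1 *: (x i + x j).

(* For n < 2 the objective is identically 0 and every point minimizes it. *)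
Definition hl_objective (n : nat) (mu : 'cV[R]_p) : R :=
  'C(n, 2)%:R^-1 * \sum_(i < n) \sum_(j < n | (i < j)%N)
    (enorm (walsh i j - mu) - enorm (walsh i j)).

End walsh.

(* Main.v *)
Require Import Defs.

(* Write [s z = z / |z|] and [h v = E s ((v + y) / 2)]; minimality of the spatial
   median at 0 gives [E s z_(1,2) = 0]. Rescaled by [t = sqrt n * mu], the
   objective [n * d_2n (t / sqrt n)] equals
     t' A t / 2 - t' W_n,   W_n = (2 / sqrt n) * \sum_i h y_i,
   up to a remainder tending to 0 in L^2: the second-order remainder of the norm
   has a U-statistic variance bound involving only E |z|^-1, which is finite
   because the density is bounded and p > 1; the kernel [s z_ij - h y_i - h y_j]
   is degenerate; and the mean is handled by dominated convergence. Since the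
   objective is convex, closeness on a finite set of points (depending only on the
   tolerance) forces its minimizer to be close to [A^-1 W_n]. Here A is
   positive definite because z_(1,2) is not supported by a line. Finally
   [A^-1 W_n] is a normalized sum of bounded i.i.d. vectors, for which Lindeberg's
   replacement argument gives the limit on a class of bounded functions with a
   uniform second-order expansion; this class is closed under products and rich
   enough to determine convergence in law. The Gaussian limit is built as the
   law of [\sum_k g_k m_k], where [\sum_k m_k m_k'] is its covariance. *)

From HB Require Import structures.
From mathcomp Require Import all_boot all_order all_algebra.
From mathcomp Require Import all_classical all_reals all_analysis measurable_realfun.
From mathcomp Require Import ring lra zify.
Set Implicit Arguments.
Unset Strict Implicit.
Unset Printing Implicit Defensive.
Import Order.TTheory GRing.Theory Num.Theory.
Import numFieldNormedType.Exports.
Local Open Scope classical_set_scope.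
Local Open Scope ring_scope.

(** * Euclidean norm *)

(** The norm is not differentiable, so there is no exact estimating equation, and consistency of the
    estimator is not known beforehand. Convexity replaces both: the remainder has to be small in
    mean square only at finitely many fixed points, whatever their number. Hoeffding's decomposition
    splits the objective into two kinds of terms. The Taylor remainder of the norm is not
    degenerate, but at scale n^(-1/2) its variance is O(n^(-3/2)), which makes up for the order n^3
    of the general variance bound for sums over pairs. The sign kernel has variance O(1/n) only;
    once its projection h is removed it is degenerate, and the bound improves to order n^2. Each
    observation lies in n - 1 of the n (n - 1) / 2 pairs: this is the factor 2 of W_n and, squared,
    the 4 of the covariance. The matrix B is the second moment of h because z_(1,2) and z_(2,3) are
    independent given y_2. Kernels and test functions are bounded, so Fubini and linearity need no
    integrability argument; the main exceptions are |z|^-1, the Hessian of the norm and Gaussian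
    moments. *)

Section euclidean.
Context (R : realType) (p : nat).
Implicit Types (u v w : 'cV[R]_p) (a : R).

Lemma dotvC u v : dotv u v = dotv v u.
Proof. by apply: eq_bigr => i _; rewrite mulrC. Qed.

Lemma dotvDl u v w : dotv (u + v) w = dotv u w + dotv v w.
Proof. by rewrite -big_split; apply: eq_bigr => i _; rewrite mxE mulrDl. Qed.

Lemma dotvDr u v w : dotv u (v + w) = dotv u v + dotv u w.
Proof. by rewrite dotvC dotvDl !(dotvC u). Qed.

Lemma dotvZl a u v : dotv (a *: u) v = a * dotv u v.
Proof. by rewrite mulr_sumr; apply: eq_bigr => i _; rewrite mxE mulrA. Qed.

Lemma dotvZr a u v : dotv u (a *: v) = a * dotv u v.
Proof. by rewrite dotvC dotvZl dotvC. Qed.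

Lemma dotvNl u v : dotv (- u) v = - dotv u v.
Proof. by rewrite -scaleN1r dotvZl mulN1r. Qed.

Lemma dotvNr u v : dotv u (- v) = - dotv u v.
Proof. by rewrite dotvC dotvNl dotvC. Qed.

Lemma dotvBl u v w : dotv (u - v) w = dotv u w - dotv v w.
Proof. by rewrite dotvDl dotvNl. Qed.

Lemma dotvBr u v w : dotv u (v - w) = dotv u v - dotv u w.
Proof. by rewrite dotvDr dotvNr. Qed.

Lemma dotv0l u : dotv 0 u = 0.
Proof. by rewrite -(scale0r 0) dotvZl mul0r. Qed.

Lemma dotv0r u : dotv u 0 = 0.
Proof. by rewrite dotvC dotv0l. Qed.

Lemma dotv_suml (I : Type) (r : seq I) (P : pred I) (f : I -> 'cV[R]_p) v :
  dotv (\sum_(i <- r | P i) f i) v = \sum_(i <- r | P i) dotv (f i) v.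
Proof.
by apply: (big_morph (fun u => dotv u v)) => [x y|]; rewrite ?dotvDl ?dotv0l.
Qed.

Lemma dotv_sumr (I : Type) (r : seq I) (P : pred I) (f : I -> 'cV[R]_p) v :
  dotv v (\sum_(i <- r | P i) f i) = \sum_(i <- r | P i) dotv v (f i).
Proof. by rewrite dotvC dotv_suml; apply: eq_bigr => i _; rewrite dotvC. Qed.

Lemma dotv_delta i v : dotv (delta_mx i 0) v = v i 0.
Proof.
rewrite /dotv (bigD1 i)//= big1 ?addr0 => [|j ji]; rewrite mxE !eqxx ?mul1r//.
by rewrite (negbTE ji) mul0r.
Qed.

Lemma dotvvE v : dotv v v = \sum_i v i 0 ^+ 2.
Proof. by apply: eq_bigr => i _; rewrite expr2. Qed.

Lemma dotvv_ge0 v : 0 <= dotv v v.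
Proof. by rewrite dotvvE sumr_ge0// => i _; exact: sqr_ge0. Qed.

Lemma enorm_ge0 v : 0 <= enorm v.
Proof. exact: sqrtr_ge0. Qed.

Lemma sqr_enorm v : enorm v ^+ 2 = dotv v v.
Proof. by rewrite sqr_sqrtr -dotvvE ?dotvv_ge0. Qed.

Lemma enormE v : enorm v = Num.sqrt (dotv v v).
Proof. by rewrite dotvvE. Qed.

Lemma enorm0 : enorm (0 : 'cV[R]_p) = 0.
Proof. by rewrite enormE dotv0l sqrtr0. Qed.

Lemma enorm_eq0 v : (enorm v == 0) = (v == 0).
Proof.
apply/idP/eqP => [|->]; last by rewrite enorm0.
rewrite enormE sqrtr_eq0 => v0.
have : dotv v v == 0 by rewrite eq_le v0 dotvv_ge0.
rewrite dotvvE psumr_eq0 => [/allP z|i _]; last exact: sqr_ge0.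
apply/colP => i; rewrite mxE; apply/eqP; rewrite -sqrf_eq0.
exact: z (mem_index_enum i).
Qed.

Lemma enorm_gt0 v : (0 < enorm v) = (v != 0).
Proof. by rewrite lt_neqAle enorm_ge0 andbT eq_sym enorm_eq0. Qed.

Lemma enormZ a v : enorm (a *: v) = `|a| * enorm v.
Proof.
by rewrite !enormE dotvZl dotvZr mulrA -expr2 sqrtrM ?sqr_ge0// sqrtr_sqr.
Qed.

Lemma enormN v : enorm (- v) = enorm v.
Proof. by rewrite -scaleN1r enormZ normrN1 mul1r. Qed.

Lemma enorm_distC u v : enorm (u - v) = enorm (v - u).
Proof. by rewrite -enormN opprB. Qed.

(** Expanding the nonnegative square of [dotv v v *: u - dotv u v *: v] gives [dotv v v] times the
    difference of the two squared sides. *)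
Lemma dotv_le_enorm u v : `|dotv u v| <= enorm u * enorm v.
Proof.
have [->|v0] := eqVneq v 0; first by rewrite dotv0r enorm0 mulr0 normr0.
rewrite -ler_sqr ?nnegrE ?mulr_ge0 ?enorm_ge0// exprMn !sqr_enorm real_normK ?num_real//.
have v1 : 0 < dotv v v by rewrite -sqr_enorm exprn_gt0// enorm_gt0.
rewrite -subr_ge0 -(pmulr_rge0 _ v1).
have := dotvv_ge0 (dotv v v *: u - dotv u v *: v).
rewrite !(dotvBl, dotvBr, dotvZl, dotvZr) (dotvC v u) => H.
apply: le_trans H _; rewrite le_eqVlt; apply/orP; left; apply/eqP; ring.
Qed.

Lemma enormD u v : enorm (u + v) <= enorm u + enorm v.
Proof.
rewrite -ler_sqr ?nnegrE ?addr_ge0 ?enorm_ge0// sqr_enorm sqrrD !sqr_enorm.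
rewrite dotvDl !dotvDr (dotvC v u).
have := dotv_le_enorm u v; rewrite ler_norml => /andP[_]; lra.
Qed.

Lemma enorm_sum (I : Type) (r : seq I) (P : pred I) (f : I -> 'cV[R]_p) :
  enorm (\sum_(i <- r | P i) f i) <= \sum_(i <- r | P i) enorm (f i).
Proof.
elim/big_rec2 : _ => [|i y x _ H]; first by rewrite enorm0.
by apply: le_trans (enormD _ _) _; rewrite lerD2l.
Qed.

Lemma enorm_dist u v : `|enorm u - enorm v| <= enorm (u - v).
Proof.
rewrite ler_norml; apply/andP; split.
  rewrite lerNl opprB lerBlDr enorm_distC -{1}(subrK u v); exact: enormD.
by rewrite lerBlDr -{1}(subrK v u); exact: enormD.
Qed.

Lemma coord_le_enorm v i : `|v i 0| <= enorm v.
Proof.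
rewrite -dotv_delta; apply: le_trans (dotv_le_enorm _ _) _.
rewrite enormE dotv_delta mxE !eqxx sqrtr1 mul1r; exact: lexx.
Qed.

Lemma enorm_le_sum v : enorm v <= \sum_i `|v i 0|.
Proof.
rewrite [v in enorm v](_ : v = \sum_i v i 0 *: delta_mx i 0).
  apply: le_trans (enorm_sum _ _ _) _; apply: ler_sum => i _.
  by rewrite enormZ enormE dotv_delta mxE !eqxx sqrtr1 mulr1.
apply/colP => i; rewrite summxE (bigD1 i)//= big1 => [|j ji]; rewrite !mxE !eqxx.
  by rewrite mulr1 addr0.
by rewrite eq_sym (negbTE ji) mulr0.
Qed.

Lemma dotv_tr u v : (u^T *m v) 0 0 = dotv u v.
Proof. by rewrite mxE; apply: eq_bigr => i _; rewrite mxE. Qed.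

Lemma dotv_mulmx (M : 'M[R]_p) u v : dotv (M *m u) v = dotv u (M^T *m v).
Proof. by rewrite -!dotv_tr trmx_mul mulmxA. Qed.

Lemma dotv_mulmxE (M : 'M[R]_p) u v :
  dotv u (M *m v) = \sum_i \sum_j M i j * (u i 0 * v j 0).
Proof.
apply: eq_bigr => i _; rewrite mxE mulr_sumr.
by apply: eq_bigr => j _; rewrite mulrCA.
Qed.

Lemma measurable_coord i : measurable_fun setT (fun v : 'cV[R]_p => v i 0).
Proof. exact: (measurable_fun_mxP id).1. Qed.

Lemma continuous_dotv u : continuous (dotv u).
Proof.
rewrite /dotv; apply: continuous_big => [|i _ v]; first exact: add_continuous.
apply: (@continuousM _ _ (cst (u i 0)) (fun v : 'cV[R]_p => v i 0)).
  exact: cst_continuous.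
exact: coord_continuous.
Qed.

Lemma continuous_enorm : continuous (@enorm R p).
Proof.
move=> v; apply: (continuous_comp (f := fun v => \sum_i v i 0 ^+ 2)); last exact: sqrt_continuous.
move: v; apply: continuous_big => [|i _ v]; first exact: add_continuous.
by apply: (@continuousM _ _ (fun v : 'cV[R]_p => v i 0) (fun v => v i 0));
  exact: coord_continuous.
Qed.

Lemma measurable_dotv u : measurable_fun setT (dotv u).
Proof. by apply: continuous_measurable_mx; exact: continuous_dotv. Qed.

Lemma measurable_enorm : measurable_fun setT (@enorm R p).
Proof. by apply: continuous_measurable_mx; exact: continuous_enorm. Qed.

End euclidean.

(** * Measurability of vector-valued maps *)

Section measurable_vectors.
Context d (T : measurableType d) (R : realType) (p : nat).
Implicit Types f g : T -> 'cV[R]_p.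

Lemma measurable_cvP f :
  (forall i, measurable_fun setT (fun x => f x i 0)) <-> measurable_fun setT f.
Proof.
split=> [mf|/measurable_fun_mxP mf i]; last exact: mf.
by apply/measurable_fun_mxP => i j; rewrite ord1; exact: mf.
Qed.

Lemma measurable_funD_cv f g : measurable_fun setT f -> measurable_fun setT g ->
  measurable_fun setT (fun x => f x + g x).
Proof.
move=> /measurable_cvP mf /measurable_cvP mg; apply/measurable_cvP => i.
under eq_fun do rewrite mxE; exact: measurable_funD.
Qed.

Lemma measurable_funZ_cv (a : T -> R) f : measurable_fun setT a ->
  measurable_fun setT f -> measurable_fun setT (fun x => a x *: f x).
Proof.
move=> ma /measurable_cvP mf; apply/measurable_cvP => i.
under eq_fun do rewrite mxE; exact: measurable_funM.
Qed.

Lemma measurable_funB_cv f g : measurable_fun setT f -> measurable_fun setT g ->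
  measurable_fun setT (fun x => f x - g x).
Proof.
move=> /measurable_cvP mf /measurable_cvP mg; apply/measurable_cvP => i.
under eq_fun do rewrite !mxE; exact: measurable_funB.
Qed.

Lemma measurable_sum_cv (I : Type) (s : seq I) (F : I -> T -> 'cV[R]_p) :
  (forall i, measurable_fun setT (F i)) ->
  measurable_fun setT (fun x => \sum_(i <- s) F i x).
Proof.
move=> mF; apply/measurable_cvP => i.
under eq_fun do rewrite summxE; apply: measurable_sum => j.
by move/measurable_cvP : (mF j).
Qed.

Lemma measurable_fun_dotv f g : measurable_fun setT f -> measurable_fun setT g ->
  measurable_fun setT (fun x => dotv (f x) (g x)).
Proof.
move=> /measurable_cvP mf /measurable_cvP mg; rewrite /dotv.
by apply: measurable_sum => i; exact: measurable_funM.
Qed.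

End measurable_vectors.

(** * Bounded random variables and independence *)

(** Under a probability measure such functions are integrable, and the class is closed under the
    operations used below, so linearity and Fubini come without integrability conditions. *)
Definition bounded_measurable d (T : measurableType d) (R : realType)
  (f : T -> R) := measurable_fun setT f /\ exists M, forall x, `|f x| <= M.

(** [distribution] takes a bundled measurable map; this bundles a function with its measurability
    proof. *)
Definition mfun_of d d' (T : measurableType d) (U : measurableType d')
    (f : T -> U) (mf : measurable_fun setT f) : {mfun T >-> U} :=
  MeasurableFun.Pack (MeasurableFun.Class (isMeasurableFun.Build _ _ _ _ _ mf)).

Section bounded_measurable.
Context d (T : measurableType d) (R : realType).
Implicit Types f g : T -> R.

Lemma bounded_measurable_cst c : bounded_measurable (fun _ : T => c : R).
Proof. by split => //; exists `|c|. Qed.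

Lemma bounded_measurableD f g : bounded_measurable f -> bounded_measurable g ->
  bounded_measurable (fun x => f x + g x).
Proof.
move=> [mf [M fM]] [mg [N gN]]; split; first exact: measurable_funD.
by exists (M + N) => x; rewrite (le_trans (ler_normD _ _))// lerD.
Qed.

Lemma bounded_measurableM f g : bounded_measurable f -> bounded_measurable g ->
  bounded_measurable (fun x => f x * g x).
Proof.
move=> [mf [M fM]] [mg [N gN]]; split; first exact: measurable_funM.
by exists (M * N) => x; rewrite normrM ler_pM.
Qed.

Lemma bounded_measurableB f g : bounded_measurable f -> bounded_measurable g ->
  bounded_measurable (fun x => f x - g x).
Proof.
move=> [mf [M fM]] [mg [N gN]]; split; first exact: measurable_funB.
by exists (M + N) => x; rewrite (le_trans (ler_normB _ _))// lerD.
Qed.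

Lemma bounded_measurable_sum I (s : seq I) (Q : pred I) (F : I -> T -> R) :
  (forall i, bounded_measurable (F i)) ->
  bounded_measurable (fun x => \sum_(i <- s | Q i) F i x).
Proof.
move=> bF; elim: s => [|i s IH].
  by under eq_fun do rewrite big_nil; exact: bounded_measurable_cst.
under eq_fun do rewrite big_cons; case: (Q i) => //.
exact: bounded_measurableD.
Qed.

Lemma bounded_measurable_sqr f : bounded_measurable f ->
  bounded_measurable (fun x => f x ^+ 2).
Proof. by move=> bf; apply: bounded_measurableM. Qed.

Lemma bounded_measurable_comp d' (U : measurableType d') (g : T -> U) (f : U -> R) :
  measurable_fun setT g -> bounded_measurable f -> bounded_measurable (f \o g).
Proof.
move=> mg [mf [M fM]]; split; last by exists M => x; exact: fM.
exact: measurableT_comp mf mg.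
Qed.

Context (P : probability T R).

Lemma bounded_measurable_integrable f : bounded_measurable f ->
  P.-integrable setT (EFin \o f).
Proof.
move=> [mf [M fM]]; apply: measurable_bounded_integrable => //.
  by rewrite (le_lt_trans (probability_le1 P _))// ltry.
exists M; split; first exact: num_real.
by move=> N MN x _; exact: le_trans (fM x) (ltW MN).
Qed.

Lemma integrable_Rsum I (s : seq I) (Q : pred I) (F : I -> T -> R) :
  (forall i, P.-integrable setT (EFin \o F i)) ->
  P.-integrable setT (EFin \o (fun x => \sum_(i <- s | Q i) F i x)).
Proof.
move=> iF; rewrite (_ : _ \o _ = fun x => (\sum_(i <- s | Q i) (F i x)%:E)%E).
  by apply: integrable_sum => // i _; exact: iF.
by apply/funext => x /=; rewrite sumEFin.
Qed.

Lemma Rintegral_cst1 (c : R) : \int[P]_x c = c.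
Proof. by rewrite (Rintegral_cst P measurableT) [X in fine X]probability_setT mulr1. Qed.

Lemma Rintegral_sum I (s : seq I) (Q : pred I) (F : I -> T -> R) :
  (forall i, P.-integrable setT (EFin \o F i)) ->
  \int[P]_x (\sum_(i <- s | Q i) F i x) = \sum_(i <- s | Q i) \int[P]_x F i x.
Proof.
move=> iF; elim: s => [|i s IH].
  by rewrite big_nil; under eq_Rintegral do rewrite big_nil; rewrite Rintegral_cst1.
under eq_Rintegral do rewrite big_cons.
rewrite big_cons; case: (Q i) => //.
by rewrite RintegralD// ?IH//; exact: integrable_Rsum.
Qed.

Lemma Rintegral_norm_le f M : measurable_fun setT f -> (forall x, `|f x| <= M) ->
  `|\int[P]_x f x| <= M.
Proof.
move=> mf fM.
have bf : bounded_measurable f by split => //; exists M.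
have bf' : bounded_measurable (fun x => `|f x|).
  split; first exact: measurableT_comp.
  by exists M => x; rewrite normr_id.
apply: le_trans (le_normr_Rintegral _ _) _ => //.
  exact: bounded_measurable_integrable.
rewrite -[leRHS]Rintegral_cst1; apply: le_Rintegral => //.
- exact: bounded_measurable_integrable.
- exact: (bounded_measurable_integrable (bounded_measurable_cst M)).
Qed.

Lemma EFin_Rintegral f : P.-integrable setT (EFin \o f) ->
  (\int[P]_x f x)%:E = (\int[P]_x (f x)%:E)%E.
Proof. by move=> fi; rewrite fineK//; exact: integrable_fin_num. Qed.

Lemma Rintegral_pushforward d' (U : measurableType d') (X : {mfun T >-> U})
    (f : U -> R) : bounded_measurable f ->
  \int[distribution P X]_x f x = \int[P]_x f (X x).
Proof.
move=> bf; have [mf _] := bf; congr fine; rewrite integral_distribution//.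
  exact/measurable_EFinP.
apply: (@bounded_measurable_integrable (f \o X)).
by apply: bounded_measurable_comp => //; exact: measurable_funP.
Qed.

End bounded_measurable.

(** * Fubini for bounded functions *)

Section bounded_fubini.
Context d1 d2 (T1 : measurableType d1) (T2 : measurableType d2) (R : realType).
Context (mu : probability T1 R) (nu : probability T2 R).
Context (f : T1 * T2 -> R) (bf : bounded_measurable f).

Let intf : ((mu \x nu)%E : probability _ R).-integrable setT (EFin \o f).
Proof. exact: bounded_measurable_integrable. Qed.

Lemma bounded_measurable_fst (y : T2) : bounded_measurable (fun x => f (x, y)).
Proof. by apply: bounded_measurable_comp bf; exact: measurable_pair2. Qed.

Lemma bounded_measurable_snd (x : T1) : bounded_measurable (fun y => f (x, y)).
Proof. by apply: bounded_measurable_comp bf; exact: measurable_pair1. Qed.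

Lemma bounded_measurable_fubini_F :
  bounded_measurable (fun x => \int[nu]_y f (x, y)).
Proof.
split.
  exact: (measurableT_comp (fine_measurable measurableT) (measurable_fubini_F intf)).
have [mf [M fM]] := bf; exists M => x; apply: Rintegral_norm_le => //.
by have [] := bounded_measurable_snd x.
Qed.

Lemma Rfubini1 :
  \int[(mu \x nu)%E]_z f z = \int[mu]_x \int[nu]_y f (x, y).
Proof.
congr fine; rewrite -(integral12_prod_meas1 intf); apply: eq_integral => x _.
rewrite EFin_Rintegral//; apply: bounded_measurable_integrable.
exact: bounded_measurable_snd.
Qed.

Lemma Rfubini2 :
  \int[(mu \x nu)%E]_z f z = \int[nu]_y \int[mu]_x f (x, y).
Proof.
congr fine; rewrite -(integral21_prod_meas1 intf); apply: eq_integral => x _.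
rewrite EFin_Rintegral//; apply: bounded_measurable_integrable.
exact: bounded_measurable_fst.
Qed.

Lemma Rfubini :
  \int[mu]_x \int[nu]_y f (x, y) = \int[nu]_y \int[mu]_x f (x, y).
Proof. by rewrite -Rfubini1 Rfubini2. Qed.

End bounded_fubini.

(** * Integrating out one observation *)

Section independence.
Context (R : realType) d (T : measurableType d) (P : probability T R).
Context d' (U : measurableType d') (F : probability U R).
Context (y : nat -> {RV P >-> U}).
Context (y_indep : mutually_independent P y).
Context (y_law : forall i B, measurable B -> distribution P (y i) B = F B).

(* A pi-system generating the sigma-algebra of the [y i] with [i != a]. *)
Definition others (a : nat) : set (set T) :=
  [set C | exists (s : seq nat) (B : nat -> set U),
    [/\ uniq s, a \notin s, forall i, measurable (B i) &
        C = \bigcap_(i in [set` s]) (y i @^-1` B i)]].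

Let my i B : measurable B -> measurable (y i @^-1` B).
Proof.
exact: measurable_funPTI.
Qed.

Lemma others_measurable a : others a `<=` measurable.
Proof.
move=> _ [s [B [us as_ mB ->]]].
by apply: fin_bigcap_measurable => // i _; exact: my.
Qed.

Lemma others_setI a : setI_closed (others a).
Proof.
move=> _ _ [s [B [us as_ mB ->]]] [s' [B' [us' as'_ mB' ->]]].
exists (undup (s ++ s')), (fun i => (if i \in s then B i else setT) `&`
  (if i \in s' then B' i else setT)); split.
- exact: undup_uniq.
- by rewrite mem_undup mem_cat negb_or as_.
- by move=> i; apply: measurableI; case: ifP.
- apply/seteqP; split => [w [H H'] i /=|w H].
    rewrite mem_undup => _; split; first by case: ifP => // /H.
    by case: ifP => // /H'.
  split=> i /= si; have /= := H i; rewrite mem_undup mem_cat si ?orbT => /(_ isT)[].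
    by [].
  by [].
Qed.

(** As functions of [C], both sides are finite measures, and mutual independence equates them on the
    pi-system [others a]; uniqueness extends this to the generated sigma-algebra. *)
Lemma others_indep a C B : <<s others a >> C -> measurable B ->
  P (C `&` y a @^-1` B) = (P C * F B)%E.
Proof.
move=> sC mB; have mYB := my a mB.
have FBfin : F B \is a fin_num by rewrite fin_num_measure.
have FB0 : (0 <= fine (F B))%R by rewrite fine_ge0.
rewrite -[LHS]/(mrestr P mYB C).
transitivity (mscale (NngNum FB0) P C); last first.
  by rewrite /mscale/= fineK// muleC.
apply: (g_sigma_algebra_measure_unique (others a) _ (fun _ => setT)) => //.
- exact: others_measurable.
- move=> _; exists [::], (fun=> setT); split => //.
  by apply/seteqP; split => // w _ i.
- by rewrite bigcup_const.
- exact: others_setI.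
- move=> _ [s [B' [us as_ mB' ->]]].
  rewrite /mrestr/= /mscale/= fineK//.
  (* Overriding the entry at [a] makes the intersection with the event of [y a] another finite
     intersection, indexed by [a :: s]. *)
  pose B2 i := if i == a then B else B' i.
  have mB2 i : measurable (B2 i) by rewrite /B2; case: ifP.
  have B2s i : i \in s -> B2 i = B' i.
    by move=> si; rewrite /B2; case: eqP => // ia; rewrite -ia si in as_.
  have E1 : (\bigcap_(i in [set` s]) (y i @^-1` B' i)) `&` y a @^-1` B =
      \bigcap_(i in [set` a :: s]) (y i @^-1` B2 i).
    apply/seteqP; split => [w [H Ha] i /=|w H].
      by rewrite inE /B2; case: eqP => [->//|_ /= si]; exact: H.
    split=> [i si|].
      by have := H i; rewrite /= inE si orbT B2s// => /(_ isT).
    by have := H a; rewrite /= inE eqxx /B2 eqxx => /(_ isT).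
  have E2 : \bigcap_(i in [set` s]) (y i @^-1` B' i) =
      \bigcap_(i in [set` s]) (y i @^-1` B2 i).
    by apply: eq_bigcapr => i si; rewrite B2s.
  transitivity (P (\bigcap_(i in [set` a :: s]) (y i @^-1` B2 i))).
    by congr (P _).
  transitivity (F B * P (\bigcap_(i in [set` s]) (y i @^-1` B2 i)))%E; last first.
    by congr (_ * P _)%E.
  rewrite !y_indep//=; last by rewrite as_ us.
  by rewrite big_cons {1}/B2 eqxx -(y_law a).
- by move=> _; apply: le_lt_trans (probability_le1 P _) (ltry 1);
    exact: measurableI.
Qed.

Lemma others_coord a i : i != a -> forall B, measurable B ->
  <<s others a >> (y i @^-1` B).
Proof.
move=> ia B mB; apply: sub_sigma_algebra; exists [:: i], (fun=> B); split => //.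
  by rewrite inE eq_sym.
apply/seteqP; split => [w H j /=|w /(_ i)]; first by rewrite inE => /eqP ->.
by apply; rewrite /= inE.
Qed.

Lemma others_measurable_fun a i : i != a ->
  measurable_fun setT (y i : g_sigma_algebraType (others a) -> U).
Proof. by move=> ia _ B mB; rewrite setTI; exact: others_coord. Qed.

(** The pair of [Y] and [y a] has a product law, by uniqueness on rectangles. Asking that [Y] be
    measurable for the sigma-algebra of the other observations covers pairs, triples and partial
    sums alike. *)
Lemma independent_Rintegral a d2 (V : measurableType d2) (Y : T -> V)
    (g : V * U -> R) :
  measurable_fun setT (Y : g_sigma_algebraType (others a) -> V) ->
  bounded_measurable g ->
  \int[P]_w g (Y w, y a w) = \int[P]_w \int[F]_u g (Y w, u).
Proof.
move=> mY bg.
have sub A : <<s others a >> A -> measurable A.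
  apply: smallest_sub => //; first exact: sigma_algebra_measurable.
  exact: others_measurable.
have mY' : measurable_fun setT Y.
  by move=> _ B mB; rewrite setTI; apply: sub; rewrite -[X in _ X]setTI; exact: mY.
have mya : measurable_fun setT (y a) by exact: measurable_funP.
pose X := mfun_of mY'.
pose Z := mfun_of (measurable_fun_pair mY' mya).
transitivity (\int[distribution P Z]_z g z); first by rewrite Rintegral_pushforward.
transitivity (\int[(distribution P X \x F)%E]_z g z).
  congr fine; apply: eq_measure_integral => A mA _; apply/esym.
  apply: product_measure_unique => // B C mB mC.
  rewrite /= /distribution /pushforward.
  rewrite -(@others_indep a)//.
  by rewrite -[X in <<s _ >> X]setTI; exact: mY.
rewrite Rfubini1// Rintegral_pushforward//.
exact: (bounded_measurable_fubini_F (distribution P X) F bg).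
Qed.

Lemma Rintegral_law i (g : U -> R) : bounded_measurable g ->
  \int[P]_w g (y i w) = \int[F]_u g u.
Proof.
move=> bg; rewrite -Rintegral_pushforward//; congr fine.
by apply: eq_measure_integral => A mA _; exact: y_law.
Qed.

Lemma Rintegral_law2 i j (g : U * U -> R) : i != j -> bounded_measurable g ->
  \int[P]_w g (y i w, y j w) = \int[F]_v \int[F]_u g (v, u).
Proof.
move=> ij bg; rewrite (@independent_Rintegral j _ _ (y i))//; last first.
  exact: others_measurable_fun.
by rewrite (@Rintegral_law i (fun v => \int[F]_u g (v, u)))//;
  exact: (bounded_measurable_fubini_F F F bg).
Qed.

End independence.

(** * Variance of U-statistics *)

Section u_statistics.
Context (R : realType) d (T : measurableType d) (P : probability T R).
Context d' (U : measurableType d') (F : probability U R).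
Context (y : nat -> {RV P >-> U}).
Context (y_indep : mutually_independent P y).
Context (y_law : forall i B, measurable B -> distribution P (y i) B = F B).
Context (k : U * U -> R) (bk : bounded_measurable k).

Local Notation kern i j := (fun w => k (y i w, y j w)).

Let my i : measurable_fun setT (y i).
Proof. exact: measurable_funP. Qed.

Lemma bounded_kernel i j : bounded_measurable (kern i j).
Proof.
by apply: (bounded_measurable_comp (g := fun w => (y i w, y j w))) bk;
  apply: measurable_fun_pair; exact: my.
Qed.

Lemma kernel_second_moment i j : i != j ->
  \int[P]_w (kern i j w) ^+ 2 = \int[F]_v \int[F]_u (k (v, u)) ^+ 2.
Proof.
move=> ij.
rewrite -(Rintegral_law2 y_indep y_law ij (g := fun z => k z ^+ 2))//.
exact: bounded_measurable_sqr.
Qed.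

(** From 2ab <= a^2 + b^2, since the kernel has the same second moment at every pair of distinct
    indices. *)
Lemma kernel_cross_le i j l m : i != j -> l != m ->
  \int[P]_w (kern i j w * kern l m w) <= \int[F]_v \int[F]_u (k (v, u)) ^+ 2.
Proof.
move=> ij lm; set V := leRHS.
have bi := bounded_kernel i j; have bl := bounded_kernel l m.
have -> : V = \int[P]_w (2^-1 * (kern i j w ^+ 2 + kern l m w ^+ 2)).
  rewrite RintegralZl//; last first.
    apply: bounded_measurable_integrable; apply: bounded_measurableD;
      exact: bounded_measurable_sqr.
  rewrite RintegralD//; [|by apply: bounded_measurable_integrable; exact: bounded_measurable_sqr..].
  by rewrite !kernel_second_moment// -/V; lra.
apply: le_Rintegral => //.
- by apply: bounded_measurable_integrable; exact: bounded_measurableM.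
- apply: bounded_measurable_integrable; apply: bounded_measurableM.
    exact: bounded_measurable_cst.
  by apply: bounded_measurableD; exact: bounded_measurable_sqr.
- move=> w _; have := sqr_ge0 (kern i j w - kern l m w); nra.
Qed.

Let measurable_others a i (ia : i != a) := @others_measurable_fun _ _ _ _ _ _ y a i ia.

Let measurable_pair_fun dX (X : measurableType dX) (f : X -> U) (g : X -> U)
   (h : X -> U) : measurable_fun setT f -> measurable_fun setT g ->
  measurable_fun setT h -> measurable_fun setT (fun x => (f x, (g x, h x))).
Proof.
by move=> mf mg mh; apply: measurable_fun_pair => //; exact: measurable_fun_pair.
Qed.

Let bounded_snd_kernel dX (X : measurableType dX) (f g : X -> U) :
  measurable_fun setT f -> measurable_fun setT g ->
  bounded_measurable (fun x => k (f x, g x)).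
Proof.
move=> mf mg; apply: (bounded_measurable_comp (g := fun x => (f x, g x))) bk.
exact: measurable_fun_pair.
Qed.

(** The observation [y j] occurs in the first factor only, so that factor can be replaced by its
    average over [y j]. *)
Lemma kernel_cross_integrate_snd i j l m : j != i -> j != l -> j != m ->
  \int[P]_w (kern i j w * kern l m w) =
  \int[P]_w ((\int[F]_u k (y i w, u)) * kern l m w).
Proof.
move=> ji jl jm.
pose g (x : (U * (U * U)) * U) := k (x.1.1, x.2) * k (x.1.2.1, x.1.2.2).
have bg : bounded_measurable g.
  apply: bounded_measurableM; apply: bounded_snd_kernel => //.
  - exact: (measurableT_comp measurable_fst measurable_fst).
  - exact: (measurableT_comp measurable_fst (measurableT_comp measurable_snd measurable_fst)).
  - exact: (measurableT_comp measurable_snd (measurableT_comp measurable_snd measurable_fst)).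
have := independent_Rintegral y_indep y_law
  (Y := fun w => (y i w, (y l w, y m w))) (a := j) _ bg.
rewrite /g/= => ->; last first.
  by apply: measurable_pair_fun; apply: measurable_others; rewrite eq_sym.
apply: eq_Rintegral => w _; rewrite RintegralZr//.
apply: bounded_measurable_integrable.
exact: (bounded_measurable_snd bk).
Qed.

Lemma kernel_cross_integrate_fst i j l m : i != j -> i != l -> i != m ->
  \int[P]_w (kern i j w * kern l m w) =
  \int[P]_w ((\int[F]_u k (u, y j w)) * kern l m w).
Proof.
move=> ij il im.
pose g (x : (U * (U * U)) * U) := k (x.2, x.1.1) * k (x.1.2.1, x.1.2.2).
have bg : bounded_measurable g.
  apply: bounded_measurableM; apply: bounded_snd_kernel => //.
  - exact: (measurableT_comp measurable_fst measurable_fst).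
  - exact: (measurableT_comp measurable_fst (measurableT_comp measurable_snd measurable_fst)).
  - exact: (measurableT_comp measurable_snd (measurableT_comp measurable_snd measurable_fst)).
have := independent_Rintegral y_indep y_law
  (Y := fun w => (y j w, (y l w, y m w))) (a := i) _ bg.
rewrite /g/= => ->; last first.
  by apply: measurable_pair_fun; apply: measurable_others; rewrite eq_sym.
apply: eq_Rintegral => w _; rewrite RintegralZr//.
apply: bounded_measurable_integrable.
exact: (bounded_measurable_fst bk).
Qed.

(** Averaging over [y j] leaves a function of [y i] times the second factor; averaging over [y i]
    then produces the mean of [k], which is 0. *)
Lemma kernel_cross_disjoint i j l m : \int[F]_v \int[F]_u k (v, u) = 0 ->
  i != j -> i != l -> i != m -> j != l -> j != m ->
  \int[P]_w (kern i j w * kern l m w) = 0.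
Proof.
move=> k0 ij il im jl jm; rewrite kernel_cross_integrate_snd// 1?eq_sym//.
have bk1 := bounded_measurable_fubini_F F F bk.
pose g (x : (U * U) * U) := (\int[F]_u k (x.2, u)) * k x.1.
have bg : bounded_measurable g.
  apply: bounded_measurableM; last exact: bounded_measurable_comp measurable_fst bk.
  exact: (bounded_measurable_comp measurable_snd bk1).
have := independent_Rintegral y_indep y_law
  (Y := fun w => (y l w, y m w)) (a := i) _ bg.
rewrite /g/= => ->; last first.
  by apply: measurable_fun_pair; apply: measurable_others; rewrite eq_sym.
under eq_Rintegral => w _.
  rewrite RintegralZr//; last exact: bounded_measurable_integrable.
  rewrite k0 mul0r.
  over.
exact: Rintegral_cst1.
Qed.

Let sum2 n (G : nat -> nat -> R) :
  \sum_(i < n) \sum_(j < n | (i < j)%N) G i j =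
  \sum_(q : 'I_n * 'I_n | (q.1 < q.2)%N) G q.1 q.2.
Proof. by rewrite pair_big_dep. Qed.

Let sqr_sum2 n :
  \int[P]_w (\sum_(i < n) \sum_(j < n | (i < j)%N) kern i j w) ^+ 2 =
  \sum_(q : 'I_n * 'I_n | (q.1 < q.2)%N) \sum_(r : 'I_n * 'I_n | (r.1 < r.2)%N)
   \int[P]_w (kern q.1 q.2 w * kern r.1 r.2 w).
Proof.
under eq_Rintegral => w _.
  rewrite (sum2 n (fun i j => kern i j w)) expr2 mulr_suml.
  under eq_bigr do rewrite mulr_sumr.
  over.
rewrite Rintegral_sum => [|q]; last first.
  apply: bounded_measurable_integrable; apply: bounded_measurable_sum => r.
  by apply: bounded_measurableM; exact: bounded_kernel.
apply: eq_bigr => q _; rewrite Rintegral_sum// => r.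
apply: bounded_measurable_integrable.
by apply: bounded_measurableM; exact: bounded_kernel.
Qed.

Let V := \int[F]_v \int[F]_u (k (v, u)) ^+ 2.

Let V0 : 0 <= V.
Proof. by apply: Rintegral_ge0 => v _; apply: Rintegral_ge0 => u _; exact: sqr_ge0. Qed.

(** Only pairs of pairs with a common index contribute, each at most [V]. There are at most 4 n^3 of
    them: one of four coincidences is imposed, and three indices stay free. *)
Lemma ustat_variance_le n : \int[F]_v \int[F]_u k (v, u) = 0 ->
  \int[P]_w (\sum_(i < n) \sum_(j < n | (i < j)%N) kern i j w) ^+ 2 <=
  4 * n%:R ^+ 3 * V.
Proof.
move=> k0; rewrite sqr_sum2.
(* The number of coincidences is 0 for disjoint pairs and at least 1 otherwise; summing it instead
   of an indicator avoids inclusion-exclusion. *)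
pose c (q r : 'I_n * 'I_n) : R := (q.1 == r.1)%:R + (q.1 == r.2)%:R
  + (q.2 == r.1)%:R + (q.2 == r.2)%:R.
have c0 q r : 0 <= c q r by rewrite /c !addr_ge0.
apply: (@le_trans _ _ (\sum_(q : 'I_n * 'I_n) \sum_(r : 'I_n * 'I_n) c q r * V)).
  rewrite [leLHS]big_mkcond; apply: ler_sum => q _.
  case: ifP => q12; last by apply: sumr_ge0 => r _; exact: mulr_ge0.
  rewrite [leLHS]big_mkcond; apply: ler_sum => r _.
  case: ifP => r12; last exact: mulr_ge0.
  have qne : (q.1 != q.2 :> nat)%N by rewrite neq_ltn q12.
  have rne : (r.1 != r.2 :> nat)%N by rewrite neq_ltn r12.
  have [cz|cnz] := eqVneq (c q r) 0.
    rewrite cz mul0r kernel_cross_disjoint//;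
    move/eqP : cz; rewrite /c !paddr_eq0 ?addr_ge0// => /andP[/andP[/andP[]]];
    by rewrite !pnatr_eq0 !eqb0 // -!(inj_eq val_inj).
  apply: le_trans (kernel_cross_le qne rne) _.
  rewrite -[leLHS]mul1r ler_wpM2r//.
  move: cnz; rewrite /c -!natrD pnatr_eq0 => cnz.
  by rewrite ler1n lt0n.
under eq_bigr do rewrite -mulr_suml.
rewrite -mulr_suml ler_wpM2r//.
rewrite /c; under eq_bigr do rewrite !big_split/=.
rewrite !big_split/=.
have E (f g : 'I_n * 'I_n -> 'I_n) :
    (forall i, \sum_(q | f q == i) 1 = n%:R :> R) ->
    \sum_(q : 'I_n * 'I_n) \sum_(r : 'I_n * 'I_n) (f r == g q)%:R = n%:R ^+ 3 :> R.
  move=> fE; under eq_bigr => q _.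
    under eq_bigr do rewrite mulrb.
    rewrite -big_mkcond/= fE.
    over.
  rewrite sumr_const card_prod card_ord -(mulr_natr n%:R (n * n)) natrM; ring.
have E1 i : \sum_(q : 'I_n * 'I_n | q.1 == i) 1 = n%:R :> R.
  rewrite (eq_bigl (fun q : 'I_n * 'I_n => (q.1 == i) && true)); last by move=> q; rewrite andbT.
  rewrite -(pair_big (fun j : 'I_n => j == i) (fun _ : 'I_n => true) (fun _ _ => 1))/=.
  by rewrite big_pred1_eq sumr_const card_ord.
have E2 i : \sum_(q : 'I_n * 'I_n | q.2 == i) 1 = n%:R :> R.
  rewrite -(pair_big (fun _ : 'I_n => true) (fun j : 'I_n => j == i) (fun _ _ => 1))/=.
  under eq_bigr do rewrite big_pred1_eq.
  by rewrite sumr_const card_ord.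
have F1 := E fst; have F2 := E snd.
under eq_bigr do under eq_bigr do rewrite eq_sym.
rewrite (F1 fst E1).
under eq_bigr do under eq_bigr do rewrite eq_sym.
rewrite (F2 fst E2).
under eq_bigr do under eq_bigr do rewrite eq_sym.
rewrite (F1 snd E1).
under eq_bigr do under eq_bigr do rewrite eq_sym.
rewrite (F2 snd E2).
by rewrite le_eqVlt; apply/orP; left; apply/eqP; ring.
Qed.

(** Two distinct increasing pairs always have an index that lies in only one of them, and averaging
    over that observation gives 0. Only the diagonal terms remain, at most n^2 in number. *)
Lemma ustat_degenerate_variance_le n :
  (forall v, \int[F]_u k (v, u) = 0) -> (forall u, \int[F]_v k (v, u) = 0) ->
  \int[P]_w (\sum_(i < n) \sum_(j < n | (i < j)%N) kern i j w) ^+ 2 <=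
  n%:R ^+ 2 * V.
Proof.
move=> k1 k2; rewrite sqr_sum2.
apply: (@le_trans _ _ (\sum_(q : 'I_n * 'I_n) V)); last first.
  by rewrite sumr_const card_prod card_ord -(mulr_natr V (n * n)) natrM expr2 mulrC.
rewrite [leLHS]big_mkcond; apply: ler_sum => q _.
case: ifP => // q12.
have qne : (q.1 != q.2 :> nat)%N by rewrite neq_ltn q12.
rewrite (bigD1 q)//= big1 ?addr0 => [|r /andP[r12 rq]]; first exact: kernel_cross_le.
have rne : (r.1 != r.2 :> nat)%N by rewrite neq_ltn r12.
(* If [q.1] occurs in [r], then [q.2] does not, because both pairs are increasing and they differ;
   otherwise [q.1] itself can be integrated out. *)
have [/orP q1|] := boolP ((q.1 == r.1 :> nat) || (q.1 == r.2 :> nat)).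
  have q2 : (q.2 != r.1 :> nat) && (q.2 != r.2 :> nat).
    move: rq r12 q12; case: q q1 {qne} => [a b] /=; case: r {rne} => [a' b'] /=.
    rewrite xpair_eqE -!(inj_eq val_inj)/=.
    by move=> [/eqP ->|/eqP ->]; lia.
  case/andP: q2 => q21 q22; rewrite kernel_cross_integrate_snd//; last by rewrite eq_sym.
  under eq_Rintegral do rewrite k1 mul0r.
  exact: Rintegral_cst1.
rewrite negb_or => /andP[q11 q12'].
rewrite kernel_cross_integrate_fst//.
under eq_Rintegral do rewrite k2 mul0r.
exact: Rintegral_cst1.
Qed.

End u_statistics.

(** * Gaussian laws *)

Section density.
Context d (T : measurableType d) (R : realType).
Context (mu nu : {measure set T -> \bar R}) (g : T -> R).
Context (mg : measurable_fun setT g) (g0 : forall x, 0 <= g x).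
Context (nuE : forall A, measurable A -> nu A = (\int[mu]_(x in A) (g x)%:E)%E).

Import HBNNSimple.

Let gE0 x : (0 <= (g x)%:E)%E. Proof. by rewrite lee_fin. Qed.

Let mgE : measurable_fun setT (EFin \o g). Proof. exact/measurable_EFinP. Qed.

Let density_indic E : measurable E ->
  (\int[nu]_x (\1_E x)%:E = \int[mu]_x ((\1_E x)%:E * (g x)%:E))%E.
Proof.
move=> mE; rewrite integral_indic// setIT nuE// integral_mkcond.
by apply: eq_integral => x _; rewrite patchE indicE; case: ifP => _; rewrite ?mul1e ?mul0e.
Qed.

Let density_nnsfun (f : {nnsfun T >-> R}) :
  (\int[nu]_x (f x)%:E = \int[mu]_x ((f x)%:E * (g x)%:E))%E.
Proof.
under [LHS]eq_integral do rewrite fimfunE -fsumEFin//.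
rewrite [LHS]ge0_integral_fsum//; last 2 first.
  - by move=> r; exact/measurable_EFinP/measurableT_comp.
  - by move=> n x _; rewrite EFinM nnfun_muleindic_ge0.
under [RHS]eq_integral.
  move=> x xD; rewrite fimfunE -fsumEFin// muleC ge0_mule_fsumr; last first.
    by move=> r; rewrite EFinM nnfun_muleindic_ge0.
  over.
rewrite [RHS]ge0_integral_fsum//; last 2 first.
  - by move=> r; apply: emeasurable_funM => //; exact/measurable_EFinP/measurableT_comp.
  - by move=> n x _; rewrite EFinM mule_ge0//; rewrite nnfun_muleindic_ge0.
apply: eq_fsbigr => r _.
under [RHS]eq_integral do rewrite EFinM muleCA.
under [LHS]eq_integral do rewrite EFinM.
(* A scalar leaves the integral only when it is nonnegative; a negative value is never taken by [f],
   so its preimage is empty. *)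
have [r0|r0] := ltP r 0.
  have -> : f @^-1` [set r] = set0.
    by apply/seteqP; split=> // x /= fxr; move: r0; rewrite -fxr ltNge fun_ge0.
  under eq_integral do rewrite indic0 mule0.
  under [RHS]eq_integral do rewrite indic0 mule0 mule0.
  by rewrite !integral0.
rewrite !ge0_integralZl//.
- rewrite density_indic//; congr (_ * _)%E.
  by apply: eq_integral => x _; rewrite muleC.
- by apply: emeasurable_funM => //; exact/measurable_EFinP.
- by move=> x _; rewrite mule_ge0// lee_fin.
- exact/measurable_EFinP.
Qed.

(** The hypothesis [nuE] speaks of sets; simple functions and monotone convergence carry it to all
    nonnegative functions. *)
Lemma ge0_integral_density (f : T -> \bar R) :
  measurable_fun setT f -> (forall x, 0 <= f x)%E ->
  (\int[nu]_x f x = \int[mu]_x (f x * (g x)%:E))%E.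
Proof.
move=> mf f0.
pose f_ := nnsfun_approx measurableT mf.
transitivity (lim (\int[nu]_x (f_ n x)%:E @[n --> \oo])%E).
  rewrite -monotone_convergence//=.
  - apply: eq_integral => ? /[!inE] xD; apply/esym/cvg_lim => //=.
    exact: cvg_nnsfun_approx.
  - by move=> n; exact/measurable_EFinP/measurable_funTS.
  - by move=> n ? _; rewrite lee_fin.
  - by move=> ? _ ? ? mn; rewrite lee_fin; exact/lefP/nd_nnsfun_approx.
transitivity (lim (\int[mu]_x ((f_ n x)%:E * (g x)%:E) @[n --> \oo])%E).
  by apply: congr_lim; apply/funext => n /=; exact: density_nnsfun.
rewrite -monotone_convergence//=.
- apply: eq_integral => x _; apply/cvg_lim => //=.
  by apply: cvgeZr => //; exact: cvg_nnsfun_approx.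
- by move=> n; apply: emeasurable_funM => //; exact/measurable_EFinP/measurable_funTS.
- by move=> n x _; rewrite mule_ge0// lee_fin.
- move=> x _ m n mn; rewrite lee_wpmul2r// lee_fin; exact/lefP/nd_nnsfun_approx.
Qed.

End density.

(** * Affine changes of variable *)

Section affine_substitution.
Context (R : realType).
Notation mu := (@lebesgue_measure R).

Let affine (c d : R) : measurableTypeR R -> measurableTypeR R := fun x => c * x + d.

Let measurable_affine c d : measurable_fun setT (affine c d).
Proof. by apply: measurable_funD => //; exact: measurable_funM. Qed.

(** The scaled image measure gives every half-open interval its length, so it is Lebesgue measure by
    uniqueness. *)
Lemma lebesgue_measure_affine (c d : R) (c0 : 0 < c) A : measurable A ->
  (c%:E * mu (affine c d @^-1` A) = mu A)%E.
Proof.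
move=> mA; have c0' := ltW c0.
pose pm : {measure set (measurableTypeR R) -> \bar R} := pushforward mu (affine c d).
pose m : {measure set (measurableTypeR R) -> \bar R} :=
  mscale (NngNum c0') (pm (measurable_affine c d)).
rewrite (_ : (_ * _)%E = m A)//.
apply/esym/lebesgue_measure_unique => //= _ [[a b]] _ <-.
rewrite /m /mscale/= /pushforward.
have -> : affine c d @^-1` `]a, b]%classic = `](a - d) / c, (b - d) / c]%classic.
  apply/seteqP; split => x /=; rewrite !in_itv/= /affine;
  by rewrite ltr_pdivrMr// ler_pdivlMr// ltrBlDr lerBrDr mulrC.
rewrite !lebesgue_measure_itv/= !lte_fin ltr_pM2r ?invr_gt0// ltrD2r.
case: ifP => _; last by rewrite mule0.
by rewrite -!EFinB -EFinM; congr EFin; field; rewrite gt_eqF.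
Qed.

Lemma ge0_integral_affine (c d : R) (f : R -> \bar R) : 0 < c ->
  measurable_fun setT f -> (forall x, 0 <= f x)%E ->
  (\int[mu]_x f (c * x + d)%R = c^-1%:E * \int[mu]_x f x)%E.
Proof.
move=> c0 mf f0; have c0' : 0 <= c^-1 by rewrite invr_ge0 ltW.
transitivity (\int[pushforward mu (affine c d)]_x f x)%E.
  by rewrite ge0_integral_pushforward.
rewrite -(ge0_integral_mscale _ measurableT (NngNum c0'))//.
apply: eq_measure_integral => A mA _.
transitivity (c^-1%:E * (c%:E * mu (affine c d @^-1` A)))%E.
  by rewrite muleA -EFinM mulVf ?gt_eqF// mul1e.
by rewrite lebesgue_measure_affine.
Qed.

End affine_substitution.

(** Locked so that conversion does not unfold it; the density is reached through [gaussE]. *)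
HB.lock Definition gauss (R : realType) : probability (measurableTypeR R) R :=
  normal_prob (0 : R) (1 : R).

(** * Rotation invariance of the standard normal law *)

Section standard_gaussian.
Context (R : realType).
Notation mu := (@lebesgue_measure R).
Local Notation phi := (normal_pdf (0 : R) 1).

Local Notation gauss := (gauss R).

Lemma gaussE (A : set R) : gauss A = (\int[mu]_(x in A) (phi x)%:E)%E.
Proof. by rewrite gauss.unlock. Qed.

Let phi0 x : 0 <= phi x. Proof. exact: normal_pdf_ge0. Qed.

Let mphi : measurable_fun setT phi. Proof. exact: measurable_normal_pdf. Qed.

Lemma ge0_integral_gauss (f : R -> \bar R) :
  measurable_fun setT f -> (forall x, 0 <= f x)%E ->
  (\int[gauss]_x f x = \int[mu]_x (f x * (phi x)%:E))%E.
Proof. by move=> mf f0; apply: ge0_integral_density => // A _; exact: gaussE. Qed.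

Lemma standard_normal_pdfE x : phi x = normal_peak 1 * expR (- x ^+ 2 / 2).
Proof. by rewrite normal_pdfE ?oner_eq0// /normal_fun subr0 expr1n. Qed.

Lemma normal_pdf_scale (s x : R) : 0 < s -> normal_pdf 0 s x = s^-1 * phi (s^-1 * x).
Proof.
move=> s0; rewrite !normal_pdfE ?gt_eqF// /normal_fun /normal_peak !subr0 expr1n.
rewrite mul1r -mulrnAr sqrtrM ?sqr_ge0// sqrtr_sqr gtr0_norm// invfM mulrA.
congr (_ * expR _); rewrite exprMn exprVn -mulr_natr -[1 *+ 2]mulr_natr mul1r.
by field; rewrite gt_eqF.
Qed.

Lemma gaussN (A : set R) : measurable A -> gauss ((fun x : R => - x) @^-1` A) = gauss A.
Proof.
move=> mA.
pose N : measurableTypeR R -> measurableTypeR R := -%R.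
have mN : measurable_fun setT N by exact: oppr_measurable.
rewrite !gaussE; transitivity (\int[mu]_(x in N @^-1` A) (phi (N x))%:E)%E.
  by apply: eq_integral => x _; rewrite !standard_normal_pdfE sqrrN.
rewrite -(@ge0_integral_pushforward _ _ _ _ _ N mN mu A (EFin \o phi))//.
- by apply: eq_measure_integral => B mB _; exact: lebesgue_measureN.
- by apply/measurable_EFinP; exact: measurable_funTS.
- by move=> x _; rewrite lee_fin.
Qed.

Lemma integral_standard_normal_pdf_affine (c d : R) : 0 < c ->
  (\int[mu]_x (phi (c * x + d)%R)%:E = (c^-1)%:E)%E.
Proof.
move=> c0; rewrite (ge0_integral_affine d (f := EFin \o phi))//.
  by rewrite integral_normal_pdf mule1.
exact/measurable_EFinP.
Qed.

(* The two sides are the exponents of the joint density of (X, aX + bY) and of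
   its factorization through the marginal law N(0, a^2 + b^2) of aX + bY. *)
Let phi_split (a b c x u : R) : 0 < a -> 0 < b -> 0 < c -> c ^+ 2 = a ^+ 2 + b ^+ 2 ->
  phi x * phi (b^-1 * u + - (a / b * x)) =
  phi (c^-1 * u) * phi (c / b * x + - (a / (b * c) * u)).
Proof.
move=> a0 b0 c0 cE; rewrite !standard_normal_pdfE.
have K (v w : R) : normal_peak 1 * expR v * (normal_peak 1 * expR w) =
    normal_peak 1 ^+ 2 * expR (v + w) by rewrite expRD; ring.
rewrite !K; congr (_ * expR _).
have -> : - x ^+ 2 / 2 + - (b^-1 * u + - (a / b * x)) ^+ 2 / 2 =
   - ((a ^+ 2 + b ^+ 2) * x ^+ 2 - 2 * a * u * x + u ^+ 2) / (2 * b ^+ 2).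
  by field; rewrite gt_eqF.
rewrite -cE.
have -> : - (c^-1 * u) ^+ 2 / 2 + - (c / b * x + - (a / (b * c) * u)) ^+ 2 / 2 =
  - (c ^+ 2 * x ^+ 2 - 2 * a * u * x + (a ^+ 2 + b ^+ 2) * (u / c) ^+ 2) / (2 * b ^+ 2).
  by field; rewrite !gt_eqF.
by rewrite -cE; field; rewrite !gt_eqF.
Qed.

(** Substitute u = ax + by in the inner integral and exchange the integrals. By [phi_split] what
    remains in x is an affine normal density with integral b / c; together with the factor 1 / b
    this is the Jacobian of x = u / c. *)
Lemma ge0_gauss_rotation_pos (a b : R) (f : R -> \bar R) : 0 < a -> 0 < b ->
  measurable_fun setT f -> (forall x, 0 <= f x)%E ->
  (\int[gauss]_x \int[gauss]_y f (a * x + b * y)%R =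
   \int[gauss]_x f (Num.sqrt (a ^+ 2 + b ^+ 2) * x)%R)%E.
Proof.
move=> a0 b0 mf f0; set c := Num.sqrt _.
have c0 : 0 < c by rewrite sqrtr_gt0 addr_gt0// exprn_gt0.
have cE : c ^+ 2 = a ^+ 2 + b ^+ 2 by rewrite sqr_sqrtr// addr_ge0// sqr_ge0.
have ml (k : R) : measurable_fun setT (fun x : R => k * x) by exact: measurable_funM.
have maff (k l : R) : measurable_fun setT (fun x : R => k * x + l).
  by apply: measurable_funD => //; exact: ml.
have mphi2 T2 (T2' : measurableType T2) (g : T2' -> R) : measurable_fun setT g ->
    measurable_fun setT (fun x => (phi (g x))%:E).
  by move=> mg; apply/measurable_EFinP; exact: measurableT_comp mg.
(* At (x, u) this is [f u] times the joint density of (X, aX + bY). *)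
pose G (z : measurableTypeR R * measurableTypeR R) : \bar R :=
  ((phi z.1)%:E * (b^-1%:E * (f z.2 * (phi (b^-1 * z.2 + - (a / b * z.1))%R)%:E)))%E.
have G0 z : (0 <= G z)%E by rewrite !mule_ge0// ?lee_fin// invr_ge0 ltW.
have mG : measurable_fun setT G.
  apply: emeasurable_funM; first by apply: mphi2; exact: measurable_fst.
  apply: emeasurable_funM => //.
  apply: emeasurable_funM; first exact: measurableT_comp mf measurable_snd.
  apply: mphi2; apply: measurable_funD.
    exact: measurableT_comp (ml _) measurable_snd.
  apply: measurableT_comp => //.
  exact: measurableT_comp (ml _) measurable_fst.
transitivity (\int[mu]_x \int[mu]_u G (x, u))%E.
  rewrite ge0_integral_gauss; last 2 first.
  - apply: (measurable_fun_fubini_tonelli_F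
      (m2 := gauss) (fun z : measurableTypeR R * measurableTypeR R => f (a * z.1 + b * z.2)%R)) => //.
    apply: measurableT_comp mf _; apply: measurable_funD.
      exact: measurableT_comp (ml _) measurable_fst.
    exact: measurableT_comp (ml _) measurable_snd.
  - by move=> x; exact: integral_ge0.
  apply: eq_integral => x _; rewrite muleC /G/=.
  have mH : measurable_fun setT (fun u : R => (f u * (phi (b^-1 * u + - (a / b * x))%R)%:E)%E).
    by apply: emeasurable_funM => //; apply: mphi2; exact: maff.
  have H0 u : (0 <= (f u * (phi (b^-1 * u + - (a / b * x))%R)%:E))%E.
    by rewrite mule_ge0// lee_fin.
  rewrite ge0_integralZl//; last 3 first.
  - by apply: emeasurable_funM.
  - by move=> u _; rewrite mule_ge0// lee_fin invr_ge0 ltW.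
  - by rewrite lee_fin.
  congr (_ * _)%E.
  rewrite ge0_integralZl//; last by rewrite lee_fin invr_ge0 ltW.
  apply: etrans _ (ge0_integral_affine (a * x) b0 mH H0).
  rewrite ge0_integral_gauss; last 2 first.
  - by apply: measurableT_comp mf _; apply: measurable_funD => //; exact: ml.
  - by [].
  apply: eq_integral => y _; rewrite addrC; congr (_ * (phi _)%:E)%E.
  by field; rewrite gt_eqF.
rewrite (@fubini_tonelli _ _ _ _ _ mu mu G mG G0).
have -> : (\int[mu]_u \int[mu]_x G (x, u) =
    \int[mu]_u (c^-1%:E * (f u * (phi (c^-1 * u)%R)%:E)))%E.
  apply: eq_integral => u _.
  transitivity (\int[mu]_x (b^-1%:E * f u * (phi (c^-1 * u)%R)%:E * (phi (c / b * x + - (a / (b * c) * u))%R)%:E))%E.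
    apply: eq_integral => x _; rewrite /G/= muleCA (muleCA (phi x)%:E (f u)).
    by rewrite -EFinM (phi_split _ _ a0 b0 c0 cE) EFinM !muleA.
  rewrite ge0_integralZl//; last 3 first.
  - by apply: mphi2; exact: maff.
  - by move=> x _; rewrite lee_fin.
  - by rewrite !mule_ge0// ?lee_fin// invr_ge0 ltW.
  rewrite integral_standard_normal_pdf_affine ?divr_gt0//.
  rewrite -(muleA b^-1%:E) muleC [LHS]muleA -EFinM; congr (_%:E * _)%E.
  by field; rewrite !gt_eqF.
have mK : measurable_fun setT (fun u : R => (f u * (phi (c^-1 * u)%R)%:E)%E).
  by apply: emeasurable_funM => //; apply: mphi2; exact: ml.
have K0 u : (0 <= (f u * (phi (c^-1 * u)%R)%:E))%E by rewrite mule_ge0// lee_fin.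
rewrite ge0_integralZl//; last by rewrite lee_fin invr_ge0 ltW.
apply: etrans (esym (ge0_integral_affine 0 c0 mK K0)) _.
rewrite ge0_integral_gauss; last 2 first.
- exact: measurableT_comp mf (ml _).
- by [].
by apply: eq_integral => x _; rewrite addr0 mulKf// gt_eqF.
Qed.

End standard_gaussian.

Section gaussian_rotation.
Context (R : realType).
Local Notation gauss := (gauss R).
Local Notation RR := (measurableTypeR R).

Let ml (k : R) : measurable_fun setT (fun x : RR => k * x : RR).
Proof. exact: measurable_funM. Qed.

Let mshift (k l : R) : measurable_fun setT (fun x : RR => l + k * x : RR).
Proof. by apply: measurable_funD => //; exact: ml. Qed.

Lemma ge0_integral_gauss_norm (a : R) (f : R -> \bar R) :
  measurable_fun setT f -> (forall x, 0 <= f x)%E ->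
  (\int[gauss]_x f (a * x)%R = \int[gauss]_x f (`|a| * x)%R)%E.
Proof.
move=> mf f0; have [a0|a0] := leP 0 a; first by rewrite ger0_norm.
rewrite ltr0_norm//.
pose N : RR -> RR := fun x => - x.
have mN : measurable_fun setT N by exact: oppr_measurable.
transitivity (\int[gauss]_(x in N @^-1` setT) f (- a * N x)%R)%E.
  by rewrite preimage_setT; apply: eq_integral => x _; rewrite mulrNN.
rewrite -(@ge0_integral_pushforward _ _ _ _ _ N mN gauss setT
  (fun x => f (- a * x)%R))//.
- by apply: eq_measure_integral => B mB _; exact: gaussN.
- exact: measurableT_comp mf (ml _).
Qed.

(** [ge0_gauss_rotation_pos] needs a density for both summands; zero coefficients are treated
    directly, and signs are removed by symmetry. *)
Lemma ge0_gauss_rotation (a b : R) (f : R -> \bar R) :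
  measurable_fun setT f -> (forall x, 0 <= f x)%E ->
  (\int[gauss]_x \int[gauss]_y f (a * x + b * y)%R =
   \int[gauss]_x f (Num.sqrt (a ^+ 2 + b ^+ 2) * x)%R)%E.
Proof.
move=> mf f0.
have cst (c : \bar R) : (0 <= c)%E -> (\int[gauss]_x c = c)%E.
  by move=> c0; rewrite integral_cst// [X in (_ * X)%E]probability_setT mule1.
have [->|a0] := eqVneq a 0.
  rewrite expr0n/= add0r sqrtr_sqr -ge0_integral_gauss_norm//.
  under eq_integral do under eq_integral do rewrite mul0r add0r.
  by rewrite cst//; exact: integral_ge0.
have [->|b0] := eqVneq b 0.
  rewrite expr0n/= addr0 sqrtr_sqr -ge0_integral_gauss_norm//.
  apply: eq_integral => x _.
  under eq_integral do rewrite mul0r addr0.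
  by rewrite cst.
rewrite -(real_normK (num_real a)) -(real_normK (num_real b)).
have a0' : 0 < `|a| by rewrite normr_gt0.
have b0' : 0 < `|b| by rewrite normr_gt0.
pose h x : \bar R := (\int[gauss]_y f (x + b * y)%R)%E.
have mh : measurable_fun setT h.
  apply: (measurable_fun_fubini_tonelli_F
      (m2 := gauss) (fun z : RR * RR => f (z.1 + b * z.2)%R)) => //.
  apply: measurableT_comp mf _; apply: measurable_funD => //.
  exact: measurableT_comp (ml _) measurable_snd.
have h0 x : (0 <= h x)%E by exact: integral_ge0.
apply: etrans (ge0_integral_gauss_norm a mh h0) _.
apply: etrans _ (ge0_gauss_rotation_pos a0' b0' mf f0).
apply: eq_integral => x _.
have mg : measurable_fun setT (fun y : RR => f (`|a| * x + y)%R).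
  by apply: measurableT_comp mf _; exact: measurable_funD.
exact: (ge0_integral_gauss_norm b mg (fun y => f0 _)).
Qed.

Lemma gauss_rotation (a b : R) (A : set R) : measurable A ->
  (gauss \x gauss)%E ((fun z => a * z.1 + b * z.2) @^-1` A) =
  gauss ((fun x => Num.sqrt (a ^+ 2 + b ^+ 2) * x) @^-1` A).
Proof.
move=> mA; set c := Num.sqrt _.
have mpre (k l : R) : measurable ((fun x : RR => l + k * x : RR) @^-1` A).
  by rewrite -[X in measurable X]setTI; exact: mshift.
have mI : measurable_fun setT (fun x => (\1_A x)%:E : \bar R).
  by apply/measurable_EFinP; exact: measurable_indic.
have := ge0_gauss_rotation a b mI (fun x => _); rewrite -/c => H.
transitivity (\int[gauss]_x (\1_A (c * x))%:E)%E; last first.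
  have mc : measurable ((fun x : RR => c * x : RR) @^-1` A).
    by rewrite -[X in measurable X]setTI; exact: ml.
  rewrite -[in RHS](setIT (_ @^-1` A)) -integral_indic//.
rewrite -H; last by move=> x; rewrite lee_fin.
apply: eq_integral => x _ /=.
have -> : xsection ((fun z : RR * RR => a * z.1 + b * z.2) @^-1` A) x =
    (fun y => a * x + b * y) @^-1` A.
  by apply/seteqP; split => y; rewrite /xsection/= inE.
by rewrite -[in LHS](setIT (_ @^-1` A)) -integral_indic.
Qed.

Lemma Rintegral_gauss_rotation (a b : R) (f : RR -> R) : bounded_measurable f ->
  \int[gauss]_x \int[gauss]_y f (a * x + b * y) =
  \int[gauss]_x f (Num.sqrt (a ^+ 2 + b ^+ 2) * x).
Proof.
move=> bf.
have mlin : measurable_fun setT (fun z : RR * RR => a * z.1 + b * z.2 : RR).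
  apply: measurable_funD; first exact: measurableT_comp (ml _) measurable_fst.
  exact: measurableT_comp (ml _) measurable_snd.
have blin : bounded_measurable (fun z : RR * RR => f (a * z.1 + b * z.2)).
  exact: (bounded_measurable_comp mlin bf).
rewrite -(Rfubini1 gauss gauss blin).
rewrite -(Rintegral_pushforward (gauss \x gauss)%E (mfun_of mlin) bf).
rewrite -(Rintegral_pushforward gauss (mfun_of (ml _)) bf).
congr fine; apply: eq_measure_integral => A mA _; exact: gauss_rotation.
Qed.

(** Both cases of [normal_law] become the law of sqrt v times a standard normal variable; for v = 0
    this variable is constant, which is the point mass. *)
Lemma normal_law_gauss (v : R) (A : set R) : 0 <= v -> measurable A ->
  normal_law 0 v A = gauss ((fun x => Num.sqrt v * x) @^-1` A).
Proof.
move=> v0 mA; rewrite /normal_law; have [->|vn0] := eqVneq v 0.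
  rewrite sqrtr0 diracE.
  have [A0|A0] := boolP (0 \in A).
    rewrite (_ : _ @^-1` A = setT) ?probability_setT//.
    by apply/seteqP; split=> // x _ /=; rewrite mul0r; exact: set_mem.
  rewrite (_ : _ @^-1` A = set0) ?measure0//.
  by apply/seteqP; split=> // x /=; rewrite mul0r => /mem_set; rewrite (negbTE A0).
set s := Num.sqrt v.
have s0 : 0 < s by rewrite sqrtr_gt0 lt_neqAle eq_sym vn0.
have mI : measurable_fun setT (fun x : R => (\1_A x)%:E : \bar R).
  by apply/measurable_EFinP; exact: measurable_indic.
have mphi : measurable_fun setT (normal_pdf (0 : R) 1) by exact: measurable_normal_pdf.
have mK : measurable_fun setT (fun x : R => ((\1_A x)%:E * (normal_pdf 0 1 (s^-1 * x)%R)%:E)%E).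
  apply: emeasurable_funM => //; apply/measurable_EFinP.
  exact: measurableT_comp mphi (ml _).
have K0 x : (0 <= (\1_A x)%:E * (normal_pdf 0 1 (s^-1 * x)%R)%:E)%E.
  by rewrite mule_ge0// lee_fin// normal_pdf_ge0.
have mc : measurable ((fun x : RR => s * x : RR) @^-1` A).
  by rewrite -[X in measurable X]setTI; exact: ml.
transitivity (\int[gauss]_x (\1_A (s * x))%:E)%E; last first.
  by rewrite -[in RHS](setIT (_ @^-1` A)) -integral_indic.
rewrite ge0_integral_gauss; last 2 first.
- exact: measurableT_comp mI (ml _).
- by move=> x; rewrite lee_fin.
rewrite /normal_prob integral_mkcond.
transitivity (s^-1%:E * \int[lebesgue_measure]_x ((\1_A x)%:E * (normal_pdf 0 1 (s^-1 * x)%R)%:E))%E.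
  rewrite -ge0_integralZl//; last by rewrite lee_fin invr_ge0 ltW.
  apply: eq_integral => x _; rewrite patchE indicE normal_pdf_scale//.
  by case: ifP => _; rewrite ?mul1e ?mul0e ?mule0// EFinM.
apply: etrans (esym (ge0_integral_affine 0 s0 mK K0)) _.
by apply: eq_integral => x _; rewrite addr0 mulKf// gt_eqF.
Qed.

End gaussian_rotation.

(** * Moments of the standard normal law *)

Section gaussian_moments.
Context (R : realType).
Local Notation gauss := (gauss R).
Local Notation RR := (measurableTypeR R).

Let ml (k : R) : measurable_fun setT (fun x : RR => k * x : RR).
Proof. exact: measurable_funM. Qed.

Let mexp (h : R) : measurable_fun setT (fun x : RR => expR (h * x ^+ 2 / 2) : RR).
Proof.
apply: measurableT_comp => //; apply: measurable_funM => //.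
by apply: measurable_funM => //; exact: measurable_funX.
Qed.

(** The integrand times the standard density is that density at sqrt (1 - h) x. At h = 1/2 this
    makes exp (x^2 / 4) integrable, which dominates the moments up to order 3; varying h yields the
    variance. *)
Lemma integral_gauss_expR_sqr (h : R) : h < 1 ->
  (\int[gauss]_x (expR (h * x ^+ 2 / 2))%:E = ((Num.sqrt (1 - h))^-1)%:E)%E.
Proof.
move=> h1; have q0 : 0 < Num.sqrt (1 - h) by rewrite sqrtr_gt0 subr_gt0.
rewrite ge0_integral_gauss; last 2 first.
- by apply/measurable_EFinP; exact: mexp.
- by move=> x; rewrite lee_fin expR_ge0.
rewrite -(integral_standard_normal_pdf_affine 0 q0).
apply: eq_integral => x _; rewrite addr0 -EFinM !standard_normal_pdfE mulrCA -expRD.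
congr (_ * expR _)%:E; rewrite exprMn sqr_sqrtr; last by rewrite subr_ge0 ltW.
by field.
Qed.

Let integrable_expR : gauss.-integrable setT (EFin \o (fun x : RR => expR (x ^+ 2 / 4))).
Proof.
have E (x : R) : x ^+ 2 / 4 = 2^-1 * x ^+ 2 / 2 by field.
apply/integrableP; split.
  by apply/measurable_EFinP; under eq_fun do rewrite E; exact: mexp.
under eq_integral => x _.
  rewrite /= ger0_norm ?expR_ge0// E.
  over.
by rewrite integral_gauss_expR_sqr ?ltry//; lra.
Qed.

Let integrable_le (f : RR -> R) c : measurable_fun setT f ->
  (forall x, `|f x| <= c * expR (x ^+ 2 / 4)) -> gauss.-integrable setT (EFin \o f).
Proof.
move=> mf fE.
apply: (le_integrable measurableT _ _ (integrableZl measurableT c integrable_expR)).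
  exact/measurable_EFinP.
move=> x _; rewrite /= lee_fin; apply: le_trans (fE x) _; exact: ler_norm.
Qed.

Let expR_quarter_ge1 (x : R) : 1 <= expR (x ^+ 2 / 4).
Proof. by rewrite -expR0 ler_expR divr_ge0// sqr_ge0. Qed.

Let sqr_le_expR (x : R) : x ^+ 2 <= 4 * expR (x ^+ 2 / 4).
Proof. have := expR_ge1Dx (x ^+ 2 / 4); lra. Qed.

Let quartic_le_expR (x : R) : (x ^+ 2) ^+ 2 <= 64 * expR (x ^+ 2 / 4).
Proof.
(* With u = x^2, halving the exponent makes the exponential a square, and 1 + u / 8 <= exp (u / 8)
   bounds u^2 by 64 exp (u / 4). *)
have -> : x ^+ 2 / 4 = x ^+ 2 / 8 + x ^+ 2 / 8 by field.
rewrite expRD; have := expR_ge1Dx (x ^+ 2 / 8); have := sqr_ge0 x.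
move: (x ^+ 2) (expR _) => u e u0 ue; nra.
Qed.

Lemma integrable_gauss_id : gauss.-integrable setT (EFin \o (fun x : RR => x)).
Proof.
apply: (@integrable_le _ 5) => // x.
have [/ltW x1|x1] := ltP `|x| 1; first by have := expR_quarter_ge1 x; lra.
have : `|x| <= `|x| ^+ 2 by rewrite expr2 ler_peMl.
rewrite real_normK ?num_real//; have := sqr_le_expR x; have := expR_quarter_ge1 x; lra.
Qed.

Lemma integrable_gauss_sqr : gauss.-integrable setT (EFin \o (fun x : RR => x ^+ 2)).
Proof.
apply: (@integrable_le _ 4) => [|x]; first exact: measurable_funX.
by rewrite ger0_norm ?sqr_ge0//; exact: sqr_le_expR.
Qed.

Lemma integrable_gauss_cube :
  gauss.-integrable setT (EFin \o (fun x : RR => `|x| ^+ 3)).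
Proof.
apply: (@integrable_le _ 65) => [|x].
  by apply: measurable_funX; exact: normr_measurable.
rewrite ger0_norm ?exprn_ge0//.
have [/ltW x1|x1] := ltP `|x| 1.
  have : `|x| ^+ 3 <= 1 by apply: exprn_ile1.
  by have := expR_quarter_ge1 x; lra.
have : `|x| ^+ 3 <= (`|x| ^+ 2) ^+ 2 by rewrite -exprM; apply: ler_weXn2l => //; exact: ltW.
rewrite real_normK ?num_real//; have := quartic_le_expR x.
have := expR_quarter_ge1 x; lra.
Qed.

Lemma Rintegral_gauss_id : \int[gauss]_x (x : RR) = 0.
Proof.
pose N : RR -> RR := fun x => - x.
have mN : measurable_fun setT N by exact: oppr_measurable.
have H : \int[gauss]_x (x : RR) = \int[gauss]_x (- x : RR).
  congr fine; transitivity (\int[distribution gauss (mfun_of mN)]_x (x : RR)%:E)%E.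
    by apply: eq_measure_integral => A mA _; apply/esym; exact: gaussN.
  rewrite integral_distribution//.
  have := integrableN integrable_gauss_id.
  by apply: eq_integrable => // x _.
have H2 : \int[gauss]_x (- x : RR) = - \int[gauss]_x (x : RR).
  under eq_Rintegral do rewrite -mulN1r.
  by rewrite RintegralZl ?mulN1r//; exact: integrable_gauss_id.
by move: H; rewrite H2; lra.
Qed.

(* Since [1 + h x^2 / 2 <= exp (h x^2 / 2)], [1 + h m / 2 <= (1 - h)^(-1/2)] for
   every [h < 1], with equality at [h = 0]; this pins down [m]. *)
Lemma Rintegral_gauss_sqr : \int[gauss]_x (x ^+ 2 : R) = 1.
Proof.
set m := LHS.
(* Here q = sqrt (1 - h); multiplying by q makes the inequality polynomial. *)
have key (q : R) : 0 < q -> (1 - q) * (1 + q) * q * m <= 2 * (1 - q).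
  move=> q0; pose h := 1 - q ^+ 2.
  have h1 : h < 1 by rewrite /h; have := exprn_gt0 2 q0; lra.
  have E := integral_gauss_expR_sqr h1.
  have qE : Num.sqrt (1 - h) = q by rewrite /h opprB addrC subrK sqrtr_sqr gtr0_norm.
  have iE : gauss.-integrable setT (EFin \o (fun x : RR => expR (h * x ^+ 2 / 2))).
    apply/integrableP; split; first by apply/measurable_EFinP; exact: mexp.
    under eq_integral do rewrite /= ger0_norm ?expR_ge0//.
    by rewrite E ltry.
  have i2 : gauss.-integrable setT (EFin \o (fun x : RR => h / 2 * x ^+ 2)).
    exact: (integrableZl measurableT (h / 2) integrable_gauss_sqr).
  have i1 : gauss.-integrable setT (EFin \o (fun x : RR => 1 : R)).
    exact: (bounded_measurable_integrable gauss (bounded_measurable_cst _ 1)).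
  have H : \int[gauss]_x (1 + h / 2 * x ^+ 2 : R) <= \int[gauss]_x (expR (h * x ^+ 2 / 2) : R).
    apply: le_Rintegral => //.
      exact: (integrableD measurableT i1 i2).
    move=> x _; apply: le_trans (expR_ge1Dx _); rewrite lerD2l.
    by rewrite le_eqVlt; apply/orP; left; apply/eqP; field.
  rewrite RintegralD// Rintegral_cst1 RintegralZl// in H; last exact: integrable_gauss_sqr.
  rewrite -/m [leRHS]/Rintegral E/= qE in H.
  have : q * (1 + h / 2 * m) <= 1 by move: H; rewrite -(ler_pM2l q0) mulfV ?gt_eqF.
  rewrite /h => {}H.
  have -> : (1 - q) * (1 + q) * q * m = 2 * (q * (1 + (1 - q ^+ 2) / 2 * m) - q) by field.
  by lra.
(* At q = 2 the inequality reads -6 m <= -2. *)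
have m0 : 0 < m by have := key 2 ltac:(lra); lra.
pose s := Num.sqrt m; have s0 : 0 < s by rewrite sqrtr_gt0.
have sE : s ^+ 2 = m by rewrite sqr_sqrtr// ltW.
(* At q = 1 / s the inequality becomes (s - 1)^2 <= 0. *)
have := key s^-1; rewrite invr_gt0 => /(_ s0) H.
have : (s - 1) ^+ 2 <= 0.
  have -> : (s - 1) ^+ 2 = (1 - s^-1) * (1 + s^-1) * s^-1 * m * s - 2 * (1 - s^-1) * s.
    by rewrite -sE; field; rewrite gt_eqF.
  by rewrite subr_le0 ler_pM2r.
rewrite real_exprn_even_le0 ?num_real//= subr_eq0 => /eqP s1.
by rewrite -sE s1 expr1n.
Qed.

End gaussian_moments.

(** Cholesky elimination from the last index: if its diagonal entry s is positive and c is its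
    column, subtracting c c^T / s leaves the Schur complement, again positive semidefinite. The
    decomposition serves twice: to build the Gaussian limit and to prove coercivity. *)
Lemma psd_gram (R : realType) (p : nat) (S : 'M[R]_p) : S^T = S ->
  (forall t, 0 <= dotv t (S *m t)) ->
  exists ms : seq 'cV[R]_p, S = \sum_(m <- ms) m *m m^T.
Proof.
(* The induction is on the number [k] of leading rows that may be nonzero. *)
suff H k : forall S : 'M[R]_p, S^T = S -> (forall t, 0 <= dotv t (S *m t)) ->
    (forall i j : 'I_p, (k <= i)%N -> S i j = 0) ->
    exists ms : seq 'cV[R]_p, S = \sum_(m <- ms) m *m m^T.
  move=> symS psdS; apply: (H p) => // i j; by rewrite leqNgt ltn_ord.
elim: k => [|k IH] {}S symS psdS S0.
  by exists [::]; rewrite big_nil; apply/matrixP => i j; rewrite mxE S0.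
have [pk|kp] := leqP p k.
  apply: IH => // i j ki; have := ltn_ord i; lia.
pose i0 := Ordinal kp; pose e : 'cV[R]_p := delta_mx i0 0; pose s := S i0 i0.
have symE i j : S i j = S j i by rewrite -{1}symS mxE.
have Se i : (S *m e) i 0 = S i i0.
  by rewrite mxE (bigD1 i0)//= big1 ?addr0 => [|j ji]; rewrite !mxE eqxx ?mulr1// (negbTE ji) mulr0.
have eS t : dotv e (S *m t) = dotv t (S *m e).
  by rewrite -[in LHS]symS -dotv_mulmx dotvC.
have eSe : dotv e (S *m e) = s by rewrite dotv_delta Se.
have psd2 (x : R) t : 0 <= dotv t (S *m t) + 2 * x * dotv t (S *m e) + x ^+ 2 * s.
  have := psdS (t + x *: e); rewrite mulmxDr -scalemxAr !(dotvDl, dotvDr, dotvZl, dotvZr).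
  rewrite eS eSe => H; apply: le_trans H _; rewrite le_eqVlt; apply/orP; left.
  by apply/eqP; ring.
have s0 : 0 <= s by rewrite -eSe.
have [sz|snz] := eqVneq s 0.
  apply: IH => // i j; rewrite leq_eqVlt => /predU1P[ki|]; last exact: S0.
  have -> : i = i0 by apply: val_inj.
  rewrite symE -Se.
  set u := (S *m e) j 0; pose t : 'cV[R]_p := delta_mx j 0.
  have uE : dotv t (S *m e) = u by rewrite dotv_delta.
  set q := dotv t (S *m t).
  have [//|u0] := eqVneq u 0.
  (* If the diagonal entry is 0 but [u] is not, this multiple of [e] brings the quadratic form down
     to -1. *)
  have := psd2 (- (q + 1) / (2 * u)) t; rewrite uE sz -/q mulr0 addr0.
  have -> : q + 2 * (- (q + 1) / (2 * u)) * u = -1 by field.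
  by rewrite ler0N1.
have s1 : 0 < s by rewrite lt_neqAle eq_sym snz.
pose c := S *m e; pose S' := S - s^-1 *: (c *m c^T).
have dS' t : dotv t (S' *m t) = dotv t (S *m t) - s^-1 * dotv t c ^+ 2.
  rewrite mulmxBl dotvBr -scalemxAl dotvZr -mulmxA; congr (_ - _ * _).
  rewrite [c^T *m t]mx11_scalar mul_mx_scalar dotvZr dotv_tr dotvC; ring.
have [|t|i j ki|ms msE] := IH S'.
- by rewrite linearB linearZ/= trmx_mul trmxK symS.
(* Minimizing over the multiple of [e] gives the quadratic form of the Schur complement. *)
- rewrite dS'; have := psd2 (- s^-1 * dotv t c) t; rewrite -/c.
  move=> H; apply: le_trans H _; rewrite le_eqVlt; apply/orP; left; apply/eqP.
  by field.
- have cc : (c *m c^T) i j = S i i0 * S j i0.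
    rewrite mxE big_ord_recl big_ord0 addr0 [c^T _ _]mxE; congr (_ * _); exact: Se.
  have -> : S' i j = S i j - s^-1 * (c *m c^T) i j by rewrite !mxE.
  rewrite cc; move: ki; rewrite leq_eqVlt => /predU1P[ki|ki]; last first.
    by rewrite (S0 i j ki) (S0 i i0 ki) mul0r mulr0 subr0.
  have -> : i = i0 by apply: val_inj.
  by rewrite -/s mulKf// symE subrr.
- exists ((Num.sqrt s)^-1 *: c :: ms); rewrite big_cons -msE /S'.
  rewrite linearZ/= -scalemxAl -scalemxAr scalerA -invfM -expr2 sqr_sqrtr ?ltW//.
  by rewrite addrC subrK.
Qed.

(** * Gaussian vectors built direction by direction *)

Section gaussian_vectors.
Context (R : realType) (p : nat).
Local Notation gauss := (gauss R).
Local Notation RR := (measurableTypeR R).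
Local Notation V := 'cV[R]_p.

Let add_dir (m : V) (z : RR * V) : V := z.2 + z.1 *: m.

Let measurable_add_dir m : measurable_fun setT (add_dir m).
Proof.
apply: measurable_funD_cv; first exact: measurable_snd.
by apply: measurable_funZ_cv => //; exact: measurable_fst.
Qed.

(* The law of [\sum_k g_k *: m_k] for independent standard normal [g_k]. *)
Fixpoint gauss_law (ms : seq V) : probability V R :=
  if ms is m :: ms' then
    distribution (gauss \x gauss_law ms')%E (mfun_of (measurable_add_dir m))
  else \d_(0 : V).

Lemma Rintegral_gauss_law_cons m ms (f : V -> R) : bounded_measurable f ->
  \int[gauss_law (m :: ms)]_x f x =
  \int[gauss]_s \int[gauss_law ms]_x f (x + s *: m).
Proof.
move=> bf; rewrite [gauss_law _]/=.
rewrite (Rintegral_pushforward _ (mfun_of (measurable_add_dir m)) bf).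
have bg : bounded_measurable (f \o add_dir m) by exact: bounded_measurable_comp.
exact: (Rfubini1 gauss (gauss_law ms) bg).
Qed.

Lemma Rintegral_dirac0 (f : V -> R) : bounded_measurable f ->
  \int[gauss_law [::]]_x f x = f 0.
Proof.
move=> [mf _]; rewrite /Rintegral/= integral_dirac//.
  by rewrite diracE mem_set// mul1e.
exact/measurable_EFinP.
Qed.

(** Each direction adds an independent normal summand to [dotv t]; rotation invariance merges it
    with the previous ones and adds the variances. *)
Lemma Rintegral_gauss_law_dotv ms t (f : RR -> R) : bounded_measurable f ->
  \int[gauss_law ms]_x f (dotv t x) = \int[gauss]_s f (Num.sqrt (\sum_(m <- ms) dotv t m ^+ 2) * s).
Proof.
elim: ms f => [|m ms IH] f bf.
  rewrite (@Rintegral_dirac0 (fun x => f (dotv t x))); last first.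
    exact: (bounded_measurable_comp (@measurable_dotv _ _ t) bf).
  rewrite dotv0r big_nil sqrtr0; under eq_Rintegral do rewrite mul0r.
  by rewrite Rintegral_cst1.
rewrite (@Rintegral_gauss_law_cons _ _ (fun x => f (dotv t x))); last first.
  exact: (bounded_measurable_comp (@measurable_dotv _ _ t) bf).
pose v := \sum_(m <- ms) dotv t m ^+ 2.
have v0 : 0 <= v by apply: sumr_ge0 => i _; exact: sqr_ge0.
transitivity (\int[gauss]_s \int[gauss]_r f (dotv t m * s + Num.sqrt v * r)).
  apply: eq_Rintegral => s _.
  under eq_Rintegral do rewrite dotvDr dotvZr.
  rewrite (IH (fun u => f (u + s * dotv t m))); last first.
    by apply: (bounded_measurable_comp (g := fun u : RR => u + _ : RR)) bf; exact: measurable_funD.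
  by apply: eq_Rintegral => r _; rewrite addrC mulrC.
by rewrite Rintegral_gauss_rotation// sqr_sqrtr// big_cons.
Qed.

Lemma gauss_law_dotv ms t (B : set RR) : measurable B ->
  gauss_law ms (dotv t @^-1` B) =
  gauss ((fun s => Num.sqrt (\sum_(m <- ms) dotv t m ^+ 2) * s) @^-1` B).
Proof.
move=> mB; set v := Num.sqrt _.
have bI : bounded_measurable (\1_B : RR -> R).
  split; first exact: measurable_indic.
  by exists 1 => x; rewrite indicE; case: (_ \in _); rewrite ?normr0 ?normr1.
have mpre d (T : measurableType d) (g : T -> RR) : measurable_fun setT g ->
    measurable (g @^-1` B).
  by move=> mg; rewrite -[X in measurable X]setTI; exact: mg.
have ind d (T : measurableType d) (Q : probability T R) (g : T -> RR) : measurable_fun setT g ->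
    Q (g @^-1` B) = (\int[Q]_x \1_B (g x))%:E.
  move=> mg; rewrite EFin_Rintegral; last first.
    exact: (bounded_measurable_integrable Q (bounded_measurable_comp mg bI)).
  by rewrite -[in LHS](setIT (_ @^-1` B)) -integral_indic//; exact: mpre.
rewrite !ind.
- by rewrite (Rintegral_gauss_law_dotv ms t bI).
- exact: measurable_funM.
- exact: measurable_dotv.
Qed.

(** One direction at a time: induction handles the vector part, and rotation invariance the two
    scalar coefficients of [m]. The replacement argument uses this to split a Gaussian vector into a
    small step and a rest. *)
Lemma gauss_law_stable ms (a b : R) (f : V -> R) : bounded_measurable f ->
  \int[gauss_law ms]_x \int[gauss_law ms]_x' f (a *: x + b *: x') =
  \int[gauss_law ms]_x f (Num.sqrt (a ^+ 2 + b ^+ 2) *: x).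
Proof.
set c := Num.sqrt _.
have mZ (k : R) : measurable_fun setT (fun x : V => k *: x).
  by apply: measurable_funZ_cv.
have mZfst (k : R) d (T : measurableType d) (g : T -> V) : measurable_fun setT g ->
   measurable_fun setT (fun x => k *: g x) by move=> mg; apply: measurable_funZ_cv.
elim: ms f => [|m ms IH] f bf.
  have b0 x : bounded_measurable (fun x' : V => f (a *: x + b *: x')).
    apply: (bounded_measurable_comp (g := fun x' : V => a *: x + b *: x')) bf.
    by apply: measurable_funD_cv.
  rewrite (Rintegral_dirac0 (f := fun x : V => f (c *: x))); last exact: (bounded_measurable_comp (mZ c) bf).
  under eq_Rintegral do rewrite (Rintegral_dirac0 (b0 _)) scaler0 addr0.
  rewrite (Rintegral_dirac0 (f := fun x : V => f (a *: x))); last exact: (bounded_measurable_comp (mZ a) bf).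
  by rewrite !scaler0.
have mid (T := ((V * V) * (RR * RR))%type) : measurable_fun setT (fun z : T =>
    a *: z.1.1 + b *: z.1.2 + (a * z.2.1 + b * z.2.2) *: m).
  apply: measurable_funD_cv; first apply: measurable_funD_cv; try apply: mZfst.
  - exact: measurableT_comp measurable_fst measurable_fst.
  - exact: measurableT_comp measurable_snd measurable_fst.
  - apply: measurable_funZ_cv => //; apply: measurable_funD; apply: measurable_funM => //.
      exact: measurableT_comp measurable_fst measurable_snd.
    exact: measurableT_comp measurable_snd measurable_snd.
have bF d (T : measurableType d) (x x' : T -> V) (s s' : T -> RR) :
    measurable_fun setT x -> measurable_fun setT x' ->
    measurable_fun setT s -> measurable_fun setT s' ->
    bounded_measurable (fun z => f (a *: x z + b *: x' z + (a * s z + b * s' z) *: m)).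
  move=> mx mx' ms' ms1.
  have mz : measurable_fun setT (fun z => ((x z, x' z), (s z, s' z))).
    by apply: measurable_fun_pair; exact: measurable_fun_pair.
  exact: (bounded_measurable_comp (measurableT_comp mid mz) bf).
have mcst d (T : measurableType d) d' (T' : measurableType d') (y : T') :
    measurable_fun setT (fun _ : T => y) by exact: measurable_cst.
have bdir (w : V) : bounded_measurable (fun x' : V => f (a *: w + b *: x')).
  apply: (bounded_measurable_comp (g := fun x' : V => a *: w + b *: x')) bf.
  by apply: measurable_funD_cv.
have bdir2 : bounded_measurable (fun x : V => \int[gauss_law (m :: ms)]_x' f (a *: x + b *: x')).
  apply: (bounded_measurable_fubini_F (gauss_law ms) (gauss_law (m :: ms))
    (f := fun z : V * V => f (a *: z.1 + b *: z.2))).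
  apply: (bounded_measurable_comp (g := fun z : V * V => a *: z.1 + b *: z.2)) bf.
  by apply: measurable_funD_cv; apply: mZfst; [exact: measurable_fst|exact: measurable_snd].
have rearr (x x' : V) (s s' : R) : a *: (x + s *: m) + b *: (x' + s' *: m) =
    a *: x + b *: x' + (a * s + b * s') *: m.
  by rewrite !scalerDr scalerDl !scalerA addrACA.
rewrite (Rintegral_gauss_law_cons m ms bdir2).
transitivity (\int[gauss]_s \int[gauss_law ms]_x \int[gauss]_s' \int[gauss_law ms]_x'
    f (a *: x + b *: x' + (a * s + b * s') *: m)).
  apply: eq_Rintegral => s _; apply: eq_Rintegral => x _.
  rewrite (Rintegral_gauss_law_cons m ms (bdir _)).
  by apply: eq_Rintegral => s' _; apply: eq_Rintegral => x' _; rewrite rearr.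
(* With the scalar integrals outside, the induction hypothesis applies to the vector integrals while
   the coefficient of [m] is frozen. *)
transitivity (\int[gauss]_s \int[gauss]_s' \int[gauss_law ms]_x \int[gauss_law ms]_x'
    f (a *: x + b *: x' + (a * s + b * s') *: m)).
  apply: eq_Rintegral => s _.
  have b3 : bounded_measurable (fun z : V * RR => \int[gauss_law ms]_x'
      f (a *: z.1 + b *: x' + (a * s + b * z.2) *: m)).
    apply: (bounded_measurable_fubini_F (gauss_law ms \x gauss)%E (gauss_law ms)
      (f := fun z : (V * RR) * V => f (a *: z.1.1 + b *: z.2 + (a * s + b * z.1.2) *: m))).
    apply: (bF _ _ (fun z : (V * RR) * V => z.1.1) snd (fun=> s) (fun z => z.1.2)) => //.
    - exact: measurableT_comp measurable_fst measurable_fst.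
    - exact: measurableT_comp measurable_snd measurable_fst.
  exact: (Rfubini (gauss_law ms) gauss b3).
transitivity (\int[gauss]_s \int[gauss]_s' (\int[gauss_law ms]_x
    f (c *: x + (a * s + b * s') *: m))).
  apply: eq_Rintegral => s _; apply: eq_Rintegral => s' _.
  apply: (IH (fun w : V => f (w + (a * s + b * s') *: m))).
  apply: (bounded_measurable_comp (g := fun w : V => w + (a * s + b * s') *: m)) bf.
  by apply: measurable_funD_cv.
have mcx : measurable_fun setT (fun z : RR * V => c *: z.2 + z.1 *: m).
  apply: measurable_funD_cv; first by apply: mZfst; exact: measurable_snd.
  by apply: measurable_funZ_cv => //; exact: measurable_fst.
pose g (u : RR) := \int[gauss_law ms]_x f (c *: x + u *: m).
have bg : bounded_measurable g.
  exact: (bounded_measurable_fubini_F gauss (gauss_law ms) (bounded_measurable_comp mcx bf)).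
rewrite (Rintegral_gauss_rotation a b bg) -/c.
rewrite (Rintegral_gauss_law_cons m ms (f := fun x : V => f (c *: x))); last first.
  exact: (bounded_measurable_comp (mZ c) bf).
by apply: eq_Rintegral => s _; apply: eq_Rintegral => x _; rewrite scalerDr scalerA.
Qed.

End gaussian_vectors.

(** * Moments of Gaussian vectors *)

Section gaussian_vector_moments.
Context (R : realType) (p : nat).
Local Notation gauss := (gauss R).
Local Notation RR := (measurableTypeR R).
Local Notation V := 'cV[R]_p.
Context (ms : seq V).
Local Notation Q := (gauss_law ms).

(** The covariance matrix of [gauss_law ms]. *)
Definition gram : 'M[R]_p := \sum_(m <- ms) m *m m^T.

Lemma gramE t : dotv t (gram *m t) = \sum_(m <- ms) dotv t m ^+ 2.
Proof.
rewrite /gram mulmx_suml dotv_sumr; apply: eq_bigr => m _.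
rewrite -mulmxA [m^T *m t]mx11_scalar mul_mx_scalar dotvZr dotv_tr (dotvC m).
by rewrite expr2.
Qed.

Let v t := dotv t (gram *m t).

Let v0 t : 0 <= v t.
Proof. by rewrite /v gramE; apply: sumr_ge0 => i _; exact: sqr_ge0. Qed.

Lemma gauss_law_mvnormal : is_mvnormal 0 gram Q.
Proof.
split=> [|t|t B mB]; last 2 first.
- exact: v0.
- by rewrite gauss_law_dotv// -gramE dotv0r normal_law_gauss// gramE; apply: sumr_ge0 => i _; exact: sqr_ge0.
rewrite /gram linear_sum; apply: eq_bigr => m _.
by rewrite /= trmx_mul trmxK.
Qed.

Let mscale_sqrt t : measurable_fun setT (fun s : RR => Num.sqrt (v t) * s : RR).
Proof. exact: measurable_funM. Qed.

Let mdotv t : measurable_fun setT (dotv t : V -> RR).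
Proof. exact: measurable_dotv. Qed.

Let same_law t (A : set RR) : measurable A ->
  distribution Q (mfun_of (mdotv t)) A = distribution gauss (mfun_of (mscale_sqrt t)) A.
Proof. by move=> mA; rewrite /distribution /pushforward/= gauss_law_dotv// -gramE. Qed.

Lemma ge0_integral_gauss_law_dotv t (f : RR -> \bar R) :
  measurable_fun setT f -> (forall x, 0 <= f x)%E ->
  (\int[Q]_x f (dotv t x) = \int[gauss]_s f (Num.sqrt (v t) * s)%R)%E.
Proof.
move=> mf f0.
have H1 := ge0_integral_distribution (P := Q) (mfun_of (mdotv t)) mf f0.
have H2 := ge0_integral_distribution (P := gauss) (mfun_of (mscale_sqrt t)) mf f0.
rewrite -[LHS]H1 -[RHS]H2.
by apply: eq_measure_integral => A mA _; exact: same_law.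
Qed.

(** The laws of [dotv t] under [Q] and of the scaled normal variable agree on sets; this transfers
    to unbounded integrands such as powers. *)
Lemma integrable_gauss_law_dotv t (f : RR -> R) : measurable_fun setT f ->
  gauss.-integrable setT (EFin \o (fun s => f (Num.sqrt (v t) * s))) ->
  Q.-integrable setT (EFin \o (fun x => f (dotv t x))) /\
  \int[Q]_x f (dotv t x) = \int[gauss]_s f (Num.sqrt (v t) * s).
Proof.
move=> mf fi.
have iQ : Q.-integrable setT (EFin \o (fun x => f (dotv t x))).
  apply/integrableP; split.
    by apply/measurable_EFinP; exact: measurableT_comp mf (mdotv t).
  have [_ H] := integrableP _ _ _ fi.
  apply: le_lt_trans H.
  rewrite (@ge0_integral_gauss_law_dotv t (fun x => `|(f x)%:E|)%E)//.
  by apply: measurableT_comp => //; exact/measurable_EFinP.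
split => //.
have mfE : measurable_fun setT (EFin \o f) by exact/measurable_EFinP.
congr fine.
have H1 := @integral_distribution _ _ _ _ _ Q (mfun_of (mdotv t)) _ mfE iQ.
have H2 := @integral_distribution _ _ _ _ _ gauss (mfun_of (mscale_sqrt t)) _ mfE fi.
rewrite -[LHS]H1 -[RHS]H2.
by apply: eq_measure_integral => A mA _; exact: same_law.
Qed.

Lemma gauss_law_dotv_mean t :
  Q.-integrable setT (EFin \o dotv t) /\ \int[Q]_x dotv t x = 0.
Proof.
have i1 : gauss.-integrable setT (EFin \o (fun s => Num.sqrt (v t) * s)).
  exact: (integrableZl measurableT _ (integrable_gauss_id R)).
have [i2 E] := integrable_gauss_law_dotv (f := fun x => x) (@measurable_id _ _ setT) i1.
split => //; rewrite E RintegralZl ?Rintegral_gauss_id ?mulr0//.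
exact: integrable_gauss_id.
Qed.

Lemma gauss_law_dotv_variance t :
  Q.-integrable setT (EFin \o (fun x => dotv t x ^+ 2)) /\
  \int[Q]_x (dotv t x ^+ 2) = v t.
Proof.
have sE (s : RR) : (Num.sqrt (v t) * s) ^+ 2 = v t * s ^+ 2.
  by rewrite exprMn sqr_sqrtr.
have i1 : gauss.-integrable setT (EFin \o (fun s => (Num.sqrt (v t) * s) ^+ 2)).
  under eq_fun do rewrite /= sE.
  exact: (integrableZl measurableT _ (integrable_gauss_sqr R)).
have [|i2 E] := integrable_gauss_law_dotv (f := fun x => x ^+ 2) _ i1.
  exact: measurable_funX.
split => //; rewrite E; under eq_Rintegral do rewrite sE.
rewrite RintegralZl ?Rintegral_gauss_sqr ?mulr1//.
exact: integrable_gauss_sqr.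
Qed.

Lemma gauss_law_dotv_cube t :
  Q.-integrable setT (EFin \o (fun x => `|dotv t x| ^+ 3)).
Proof.
have sE (s : RR) : `|Num.sqrt (v t) * s| ^+ 3 = Num.sqrt (v t) ^+ 3 * `|s| ^+ 3.
  by rewrite normrM exprMn ger0_norm ?sqrtr_ge0.
have i1 : gauss.-integrable setT (EFin \o (fun s => `|Num.sqrt (v t) * s| ^+ 3)).
  under eq_fun do rewrite /= sE.
  exact: (integrableZl measurableT _ (integrable_gauss_cube R)).
have [|//] := integrable_gauss_law_dotv (f := fun x => `|x| ^+ 3) _ i1.
by apply: measurable_funX; exact: normr_measurable.
Qed.

End gaussian_vector_moments.

Section third_moments.
Context (R : realType) (p : nat).
Local Notation V := 'cV[R]_p.

(** All that the replacement argument asks of a step: mean 0, covariance [S] and a finite third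
    moment. *)
Definition centered_moments d (T : measurableType d) (mu : probability T R)
    (X : T -> V) (S : 'M[R]_p) := [/\
  measurable_fun setT X,
  forall i, mu.-integrable setT (EFin \o (fun w => X w i 0)) /\
    \int[mu]_w X w i 0 = 0,
  forall i j, mu.-integrable setT (EFin \o (fun w => X w i 0 * X w j 0)) /\
    \int[mu]_w (X w i 0 * X w j 0) = S i j &
  mu.-integrable setT (EFin \o (fun w => enorm (X w) ^+ 3))].

Lemma gauss_law_moments (ms : seq V) :
  centered_moments (gauss_law ms) (fun x => x) (gram ms).
Proof.
split; first exact: measurable_id.
- move=> i; have [i1 E] := gauss_law_dotv_mean ms (delta_mx i 0).
  by split; [apply: eq_integrable i1 => // x _ /=; rewrite dotv_delta
            |rewrite -[RHS]E; apply: eq_Rintegral => x _; rewrite dotv_delta].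
- move=> i j.
  pose e k : V := delta_mx k 0.
  have eE k x : dotv (e k) x = x k 0 by rewrite dotv_delta.
  have [i1 E1] := gauss_law_dotv_variance ms (e i + e j).
  have [i2 E2] := gauss_law_dotv_variance ms (e i - e j).
  (* Polarization: mixed moments follow from variances of linear functionals. *)
  have XE (x : V) : x i 0 * x j 0 =
      4^-1 * (dotv (e i + e j) x ^+ 2 - dotv (e i - e j) x ^+ 2).
    by rewrite dotvDl dotvBl !eE; field.
  have i3 := integrableB measurableT i1 i2.
  have i4 := integrableZl measurableT 4^-1 i3.
  split.
    by apply: eq_integrable i4 => // x _ /=; rewrite XE.
  under eq_Rintegral do rewrite XE.
  rewrite RintegralZl// RintegralB// E1 E2.
  rewrite !(mulmxDr, mulmxN, dotvDl, dotvDr, dotvNl, dotvNr) !eE.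
  have sE k l : (gram ms *m e l) k 0 = gram ms k l.
    rewrite mxE (bigD1 l)//= big1 ?addr0 => [|m ml]; rewrite !mxE eqxx ?mulr1//.
    by rewrite (negbTE ml) mulr0.
  have symS : gram ms j i = gram ms i j.
    have [+ _ _] := gauss_law_mvnormal ms; move=> /matrixP/(_ i j); by rewrite mxE.
  by rewrite !sE symS; field.
- have ci i : (gauss_law ms).-integrable setT (EFin \o (fun x : V => `|x i 0| ^+ 3)).
    apply: eq_integrable (gauss_law_dotv_cube ms (delta_mx i 0)) => // x _ /=.
    by rewrite dotv_delta.
  have cs := integrableZl measurableT (p%:R ^+ 3 : R)
    (integrable_Rsum (index_enum 'I_p) xpredT ci).
  apply: (le_integrable measurableT _ _ cs).
    apply/measurable_EFinP; apply: measurable_funX; exact: measurable_enorm.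
  move=> x _; rewrite /= lee_fin ger0_norm ?exprn_ge0 ?enorm_ge0//.
  apply: le_trans (ler_norm _).
  (* The norm is at most p times the largest absolute coordinate, so its cube is at most p^3 times
     the sum of the cubes; the case without a coordinate is p = 0. *)
  have [i0 mi0|none] := pickP 'I_p; last first.
    have -> : x = 0 by apply/colP => i; have := none i.
    rewrite enorm0 expr0n/= mulr_ge0// ?exprn_ge0//.
    by apply: sumr_ge0 => i _; exact: exprn_ge0.
  pose k := [arg max_(i > i0) `|x i 0|]%O.
  have kM i : `|x i 0| <= `|x k 0|.
    by rewrite /k; case: (arg_maxP (P := xpredT) (fun i => `|x i 0|)) => // j _; apply.
  apply: (@le_trans _ _ ((p%:R * `|x k 0|) ^+ 3)).
    apply: lerXn2r; rewrite ?nnegrE ?enorm_ge0 ?mulr_ge0//.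
    apply: le_trans (enorm_le_sum x) _.
    apply: (@le_trans _ _ (\sum_(i < p) `|x k 0|)); first by apply: ler_sum => i _.
    by rewrite sumr_const card_ord mulr_natl.
  rewrite exprMn ler_wpM2l ?exprn_ge0//.
  rewrite (bigD1 k)//= lerDl; apply: sumr_ge0 => i _; exact: exprn_ge0.
Qed.

End third_moments.

(** * Lindeberg's replacement argument *)

Section smooth_functions.
Context (R : realType) (p : nat).
Local Notation V := 'cV[R]_p.

(* [g] and [H] play the roles of the gradient and of half the Hessian at [x];
   the intermediate bounds make the class stable under products. *)
Definition taylor2_at (C : R) (phi : V -> R) (x g : V) (H : 'M[R]_p) (h : V) :=
  [/\ `|dotv g h| <= C * enorm h,
      `|dotv h (H *m h)| <= C * enorm h ^+ 2,
      `|phi (x + h) - phi x| <= C * enorm h,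
      `|phi (x + h) - phi x - dotv g h| <= C * enorm h ^+ 2 &
      `|phi (x + h) - phi x - dotv g h - dotv h (H *m h)| <= C * enorm h ^+ 3].

(** Expansions with one constant for all points replace differentiability, so that closure under
    sums and products is plain algebra. *)
Definition smooth3 (phi : V -> R) := measurable_fun setT phi /\
  exists C, forall x, `|phi x| <= C /\ exists g H, forall h, taylor2_at C phi x g H h.

Lemma smooth3_bounded_measurable phi : smooth3 phi -> bounded_measurable phi.
Proof. by move=> [mphi [C HC]]; split => //; exists C => x; case: (HC x). Qed.

Lemma smooth3_cst c : smooth3 (fun _ => c).
Proof.
split => //; exists `|c| => x; split => //; exists 0, 0 => h.
by rewrite /taylor2_at dotv0l mul0mx dotv0r !subrr normr0;
  split; rewrite mulr_ge0// ?exprn_ge0// enorm_ge0.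
Qed.

Lemma smooth3D phi psi : smooth3 phi -> smooth3 psi ->
  smooth3 (fun x => phi x + psi x).
Proof.
move=> [m1 [C HC]] [m2 [D HD]]; split; first exact: measurable_funD.
exists (C + D) => x; have [b1 [g1 [H1 t1]]] := HC x; have [b2 [g2 [H2 t2]]] := HD x.
split; first by rewrite (le_trans (ler_normD _ _))// lerD.
exists (g1 + g2), (H1 + H2) => h; have [a1 a2 a3 a4 a5] := t1 h.
have [c1 c2 c3 c4 c5] := t2 h.
have tri (u v w A B : R) : `|u| <= A -> `|v| <= B -> w = u + v -> `|w| <= A + B.
  by move=> uA vB ->; rewrite (le_trans (ler_normD _ _))// lerD.
rewrite /taylor2_at mulmxDl dotvDr !dotvDl; split; rewrite mulrDl;
  [apply: tri a1 c1 _|apply: tri a2 c2 _|apply: tri a3 c3 _|apply: tri a4 c4 _|apply: tri a5 c5 _];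
  ring.
Qed.

Lemma smooth3M phi psi : smooth3 phi -> smooth3 psi ->
  smooth3 (fun x => phi x * psi x).
Proof.
move=> [m1 [C HC]] [m2 [D HD]]; split; first exact: measurable_funM.
have C0 : 0 <= C by have [+ _] := HC 0; exact: le_trans.
have D0 : 0 <= D by have [+ _] := HD 0; exact: le_trans.
(* The third-order remainder of a product is a sum of four products, each bounded by C D |h|^3. *)
exists (4 * (C * D)) => x; have [b1 [g1 [H1 t1]]] := HC x; have [b2 [g2 [H2 t2]]] := HD x.
have CD0 : 0 <= C * D by rewrite mulr_ge0.
split; first by rewrite normrM; apply: le_trans (ler_pM _ _ b1 b2) _ => //; lra.
(* Leibniz rule. The rank-one matrix is not symmetric, but only its quadratic form, the product of
   the two gradient terms, enters. *)
exists (phi x *: g2 + psi x *: g1), (phi x *: H2 + psi x *: H1 + g1 *m g2^T) => h.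
have [a1 a2 a3 a4 a5] := t1 h; have [c1 c2 c3 c4 c5] := t2 h.
have [b1h _] := HC (x + h).
rewrite /taylor2_at.
have -> : dotv (phi x *: g2 + psi x *: g1) h = phi x * dotv g2 h + psi x * dotv g1 h.
  by rewrite dotvDl !dotvZl.
have -> : dotv h ((phi x *: H2 + psi x *: H1 + g1 *m g2^T) *m h) =
    phi x * dotv h (H2 *m h) + psi x * dotv h (H1 *m h) + dotv g1 h * dotv g2 h.
  rewrite !mulmxDl !dotvDr -!scalemxAl !dotvZr; congr (_ + _).
  rewrite -mulmxA [g2^T *m h]mx11_scalar mul_mx_scalar dotvZr dotv_tr (dotvC h).
  by rewrite mulrC.
move: (dotv g1 h) (dotv g2 h) (dotv h (H1 *m h)) (dotv h (H2 *m h)) a1 a2 a3 a4 a5 c1 c2 c3 c4 c5.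
move: b1 b2 b1h; move: (phi x) (phi (x + h)) (psi x) (psi (x + h)).
move=> f f' k k' b1 b2 b1h l1 l2 q1 q2 a1 a2 a3 a4 a5 c1 c2 c3 c4 c5.
have n0 := enorm_ge0 h; move: (enorm h) n0 a1 a2 a3 a4 a5 c1 c2 c3 c4 c5 => n n0.
move=> a1 a2 a3 a4 a5 c1 c2 c3 c4 c5.
have n2 : 0 <= n ^+ 2 by exact: exprn_ge0.
have M (a b A B X : R) : `|a| <= A -> `|b| <= B -> A * B = X -> `|a * b| <= X.
  by move=> aA bB <-; rewrite normrM ler_pM.
have tri (u v : R) A B : `|u| <= A -> `|v| <= B -> `|u + v| <= A + B.
  by move=> uA vB; rewrite (le_trans (ler_normD _ _))// lerD.
have fin (u A B : R) : `|u| <= A -> A <= B -> `|u| <= B by exact: le_trans.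
split.
- apply: fin (tri _ _ _ _ (M _ _ _ _ _ b1 c1 erefl) (M _ _ _ _ _ b2 a1 erefl)) _.
  have := mulr_ge0 CD0 n0; nra.
- apply: fin (tri _ _ _ _ (tri _ _ _ _ (M _ _ _ _ _ b1 c2 erefl) (M _ _ _ _ _ b2 a2 erefl))
    (M _ _ _ _ _ a1 c1 erefl)) _.
  have := mulr_ge0 CD0 n2; nra.
- have -> : f' * k' - f * k = f' * (k' - k) + k * (f' - f) by ring.
  apply: fin (tri _ _ _ _ (M _ _ _ _ _ b1h c3 erefl) (M _ _ _ _ _ b2 a3 erefl)) _.
  have := mulr_ge0 CD0 n0; nra.
- have -> : f' * k' - f * k - (f * l2 + k * l1) =
    f' * (k' - k - l2) + k * (f' - f - l1) + (f' - f) * l2 by ring.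
  apply: fin (tri _ _ _ _ (tri _ _ _ _ (M _ _ _ _ _ b1h c4 erefl) (M _ _ _ _ _ b2 a4 erefl))
    (M _ _ _ _ _ a3 c1 erefl)) _.
  have := mulr_ge0 CD0 n2; nra.
- have -> : f' * k' - f * k - (f * l2 + k * l1) - (f * q2 + k * q1 + l1 * l2) =
    f' * (k' - k - l2 - q2) + k * (f' - f - l1 - q1) + (f' - f - l1) * l2
      + (f' - f) * q2 by ring.
  apply: fin (tri _ _ _ _ (tri _ _ _ _ (tri _ _ _ _ (M _ _ _ _ _ b1h c5 erefl)
    (M _ _ _ _ _ b2 a5 erefl)) (M _ _ _ _ _ a4 c1 erefl)) (M _ _ _ _ _ a3 c2 erefl)) _.
  rewrite le_eqVlt; apply/orP; left; apply/eqP; ring.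
Qed.

Lemma smooth3Z c phi : smooth3 phi -> smooth3 (fun x => c * phi x).
Proof. by move=> sphi; apply: smooth3M => //; exact: smooth3_cst. Qed.

Lemma smooth3_sum I (s : seq I) (F : I -> V -> R) : (forall i, smooth3 (F i)) ->
  smooth3 (fun x => \sum_(i <- s) F i x).
Proof.
move=> sF; elim: s => [|i s IH].
  by under eq_fun do rewrite big_nil; exact: smooth3_cst.
by under eq_fun do rewrite big_cons; exact: smooth3D.
Qed.

Lemma smooth3_prod I (s : seq I) (F : I -> V -> R) : (forall i, smooth3 (F i)) ->
  smooth3 (fun x => \prod_(i <- s) F i x).
Proof.
move=> sF; elim: s => [|i s IH].
  by under eq_fun do rewrite big_nil; exact: smooth3_cst.
by under eq_fun do rewrite big_cons; exact: smooth3M.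
Qed.

Lemma smooth3_lipschitz phi : smooth3 phi ->
  exists C, forall x y, `|phi x - phi y| <= C * enorm (x - y).
Proof.
move=> [_ [C HC]]; exists C => x y; have [_ [g [H t]]] := HC y.
by have [_ _ + _ _] := t (x - y); rewrite subrKC.
Qed.

End smooth_functions.

(** * Replacement of one step and the central limit theorem *)

Section lindeberg.
Context (R : realType) (p : nat).
Local Notation V := 'cV[R]_p.
Context (phi : V -> R) (sphi : smooth3 phi).

Let bphi : bounded_measurable phi := smooth3_bounded_measurable sphi.

Let bounded_phi d (T : measurableType d) (f : T -> V) : measurable_fun setT f ->
  bounded_measurable (fun w => phi (f w)).
Proof. by move=> mf; exact: (bounded_measurable_comp mf bphi). Qed.

(* Replacing a small centered step by another one with the same covariance costs
   only a third-order term. *)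
Lemma smooth3_step_swap (S : 'M[R]_p)
    d1 (T1 : measurableType d1) (mu : probability T1 R) (X : T1 -> V)
    d2 (T2 : measurableType d2) (nu : probability T2 R) (Y : T2 -> V) :
  centered_moments mu X S -> centered_moments nu Y S ->
  exists2 K : R, 0 <= K & forall x eta, 0 <= eta ->
    `|\int[mu]_w phi (x + eta *: X w) - \int[nu]_w phi (x + eta *: Y w)| <= K * eta ^+ 3.
Proof.
have [_ [C HC]] := sphi.
have C0 : 0 <= C by have [+ _] := HC 0; exact: le_trans.
(* The expected second-order polynomial depends on the law of the step only through [S], so it
   cancels between the two laws. *)
have key d (T : measurableType d) (m : probability T R) (Z : T -> V) x g (H : 'M[R]_p) eta :
    centered_moments m Z S -> 0 <= eta -> (forall h, taylor2_at C phi x g H h) ->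
    `|\int[m]_w phi (x + eta *: Z w) - (phi x + eta ^+ 2 * \sum_i \sum_j H i j * S i j)|
      <= C * eta ^+ 3 * \int[m]_w (enorm (Z w) ^+ 3).
  move=> [mZ m1 m2 m3] eta0 tay.
  pose P w := phi x + (eta * dotv g (Z w) + eta ^+ 2 * dotv (Z w) (H *m Z w)).
  have ig : m.-integrable setT (EFin \o (fun w => dotv g (Z w))).
    apply: integrable_Rsum => i; exact: (integrableZl measurableT (g i 0) (m1 i).1).
  have iH : m.-integrable setT (EFin \o (fun w => \sum_i \sum_j H i j * (Z w i 0 * Z w j 0))).
    apply: integrable_Rsum => i; apply: integrable_Rsum => j.
    exact: (integrableZl measurableT (H i j) (m2 i j).1).
  have iH' : m.-integrable setT (EFin \o (fun w => dotv (Z w) (H *m Z w))).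
    by apply: eq_integrable iH => // w _ /=; rewrite dotv_mulmxE.
  have iZg := integrableZl measurableT eta ig.
  have iZH := integrableZl measurableT (eta ^+ 2) iH'.
  have iS := integrableD measurableT iZg iZH.
  have iC : m.-integrable setT (EFin \o (fun _ => phi x)).
    exact: (bounded_measurable_integrable m (bounded_measurable_cst _ (phi x))).
  have iP : m.-integrable setT (EFin \o P) by exact: (integrableD measurableT iC iS).
  have EP : \int[m]_w P w = phi x + eta ^+ 2 * \sum_i \sum_j H i j * S i j.
    rewrite /P RintegralD// Rintegral_cst1; congr (_ + _).
    rewrite RintegralD// !RintegralZl//.
    have -> : \int[m]_w dotv g (Z w) = 0.
      rewrite Rintegral_sum => [|i]; last exact: (integrableZl measurableT (g i 0) (m1 i).1).
      by apply: big1 => i _; rewrite RintegralZl ?(m1 i).2 ?mulr0//; exact: (m1 i).1.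
    rewrite mulr0 add0r; congr (_ * _).
    under eq_Rintegral do rewrite dotv_mulmxE.
    rewrite Rintegral_sum => [|i]; last first.
      apply: integrable_Rsum => j; exact: (integrableZl measurableT (H i j) (m2 i j).1).
    apply: eq_bigr => i _; rewrite Rintegral_sum => [|j]; last first.
      exact: (integrableZl measurableT (H i j) (m2 i j).1).
    by apply: eq_bigr => j _; rewrite RintegralZl ?(m2 i j).2//; exact: (m2 i j).1.
  have bX : bounded_measurable (fun w => phi (x + eta *: Z w)).
    apply: bounded_phi; apply: measurable_funD_cv => //.
    exact: measurable_funZ_cv.
  have iX := bounded_measurable_integrable m bX.
  rewrite -EP -RintegralB//.
  have iD : m.-integrable setT (EFin \o (fun w => phi (x + eta *: Z w) - P w)).
    exact: (integrableB measurableT iX iP).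
  have i3 : m.-integrable setT (EFin \o (fun w => C * eta ^+ 3 * enorm (Z w) ^+ 3)).
    exact: (integrableZl measurableT _ m3).
  apply: le_trans (le_normr_Rintegral measurableT iD) _.
  rewrite -RintegralZl//; apply: le_Rintegral => //.
    exact: (integrable_norm iD).
  move=> w _; have [_ _ _ _] := tay (eta *: Z w).
  rewrite enormZ (ger0_norm eta0) exprMn mulrA; apply: le_trans.
  rewrite le_eqVlt; apply/orP; left; apply/eqP; congr (`| _ |).
  by rewrite /P -scalemxAr !(dotvZl, dotvZr); ring.
move=> mX mY.
exists (C * (\int[mu]_w (enorm (X w) ^+ 3) + \int[nu]_w (enorm (Y w) ^+ 3))).
  by rewrite mulr_ge0// addr_ge0//; apply: Rintegral_ge0 => w _; rewrite exprn_ge0 ?enorm_ge0.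
move=> x eta eta0; have [_ [g [H tay]]] := HC x.
have k1 := key _ _ _ _ _ _ _ _ mX eta0 tay; have k2 := key _ _ _ _ _ _ _ _ mY eta0 tay.
move: k1 k2; set c := phi x + _ => k1; rewrite distrC => k2.
apply: le_trans (ler_distD c _ _) _.
apply: le_trans (lerD k1 k2) _.
rewrite le_eqVlt; apply/orP; left; apply/eqP; ring.
Qed.

Context d (T : measurableType d) (P : probability T R).
Context d' (U : measurableType d') (F : probability U R).
Context (y : nat -> {RV P >-> U}).
Context (y_indep : mutually_independent P y).
Context (y_law : forall i B, measurable B -> distribution P (y i) B = F B).
Context (ms : seq V) (G : U -> V) (mG : centered_moments F G (gram ms)).
Local Notation Q := (gauss_law ms).

(** Telescoping in k: [a k] combines the first k summands with a Gaussian vector carrying the share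
    1 - k / n of the covariance. Consecutive terms differ by at most K n^(-3/2), and there are n
    differences. *)
Lemma clt_smooth3 : exists2 K : R, 0 <= K & forall n, (0 < n)%N ->
  `|\int[P]_w phi ((Num.sqrt n%:R)^-1 *: \sum_(i < n) G (y i w)) - \int[Q]_x phi x|
    <= K / Num.sqrt n%:R.
Proof.
have [K K0 swap] := smooth3_step_swap (gauss_law_moments ms) mG.
exists K => // n n0.
have sn0 : 0 < Num.sqrt n%:R :> R by rewrite sqrtr_gt0 ltr0n.
pose eta : R := (Num.sqrt n%:R)^-1.
have eta0 : 0 <= eta by rewrite invr_ge0 ltW.
have eta2 : eta ^+ 2 = n%:R^-1 by rewrite exprVn sqr_sqrtr.
(* A single Gaussian vector, scaled by [r k], stands for all n - k Gaussian steps still present. *)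
pose r k : R := Num.sqrt (1 - k%:R * eta ^+ 2).
pose S k w : V := \sum_(i < k) G (y i w).
have [mGG _ _ _] := mG.
have mGy i : measurable_fun setT (fun w => G (y i w)).
  by apply: measurableT_comp mGG _; exact: measurable_funP.
have mS k : measurable_fun setT (S k) by exact: measurable_sum_cv.
pose a k := \int[P]_w \int[Q]_g phi (eta *: S k w + r k *: g).
have step k : (k < n)%N -> `|a k - a k.+1| <= K * eta ^+ 3.
  move=> kn.
  have rk0 : 0 <= 1 - k.+1%:R * eta ^+ 2.
    by rewrite eta2 subr_ge0 ler_pdivrMr ?ltr0n// mul1r ler_nat.
  (* Stability splits the Gaussian vector into one step of size [eta] and a rest of size
     [r k.+1]. *)
  have rE : r k = Num.sqrt (r k.+1 ^+ 2 + eta ^+ 2).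
    by rewrite /r sqr_sqrtr// -natr1; congr Num.sqrt; ring.
  pose f1 (z : V * V) := \int[Q]_g phi (z.1 + r k.+1 *: z.2 + eta *: g).
  pose f2 (z : V * V) := \int[F]_u phi (z.1 + r k.+1 *: z.2 + eta *: G u).
  have m12 d3 (W : measurableType d3) (h : W -> V) : measurable_fun setT h ->
      measurable_fun setT (fun z : (V * V) * W => z.1.1 + r k.+1 *: z.1.2 + eta *: h z.2).
    move=> mh; apply: measurable_funD_cv; first apply: measurable_funD_cv.
    - exact: measurableT_comp measurable_fst measurable_fst.
    - apply: measurable_funZ_cv => //; exact: measurableT_comp measurable_snd measurable_fst.
    - apply: measurable_funZ_cv => //; exact: measurableT_comp mh measurable_snd.
  have bf1 : bounded_measurable f1.
    apply: (bounded_measurable_fubini_F (Q \x Q)%E Q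
      (f := fun z : (V * V) * V => phi (z.1.1 + r k.+1 *: z.1.2 + eta *: z.2))).
    exact: bounded_phi (m12 _ _ _ (@measurable_id _ _ setT)).
  have bf2 : bounded_measurable f2.
    apply: (bounded_measurable_fubini_F (Q \x Q)%E F
      (f := fun z : (V * V) * U => phi (z.1.1 + r k.+1 *: z.1.2 + eta *: G z.2))).
    exact: bounded_phi (m12 _ _ _ mGG).
  have mpair : measurable_fun setT (fun z : T * V => (eta *: S k z.1, z.2)).
    apply: measurable_fun_pair; last exact: measurable_snd.
    by apply: measurable_funZ_cv => //; exact: measurableT_comp (mS k) measurable_fst.
  have b1 : bounded_measurable (fun z : T * V => f1 (eta *: S k z.1, z.2)).
    exact: (bounded_measurable_comp mpair bf1).
  have b2 : bounded_measurable (fun z : T * V => f2 (eta *: S k z.1, z.2)).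
    exact: (bounded_measurable_comp mpair bf2).
  have aE : a k = \int[P]_w \int[Q]_g f1 (eta *: S k w, g).
    apply: eq_Rintegral => w _; rewrite rE.
    rewrite -(gauss_law_stable ms (r k.+1) eta (f := fun v => phi (eta *: S k w + v))).
      by apply: eq_Rintegral => g _; apply: eq_Rintegral => g' _; rewrite addrA.
    by apply: bounded_phi; exact: measurable_funD_cv.
  have aSE : a k.+1 = \int[P]_w \int[Q]_g f2 (eta *: S k w, g).
    pose f3 (z : V * U) := \int[Q]_g phi (z.1 + eta *: G z.2 + r k.+1 *: g).
    have m3 : measurable_fun setT (fun z : (V * U) * V => z.1.1 + eta *: G z.1.2 + r k.+1 *: z.2).
      apply: measurable_funD_cv; first apply: measurable_funD_cv.
      - exact: measurableT_comp measurable_fst measurable_fst.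
      - apply: measurable_funZ_cv => //; apply: measurableT_comp mGG _.
        exact: measurableT_comp measurable_snd measurable_fst.
      - by apply: measurable_funZ_cv => //; exact: measurable_snd.
    have bf3 : bounded_measurable f3.
      apply: (bounded_measurable_fubini_F (Q \x F)%E Q
        (f := fun z : (V * U) * V => phi (z.1.1 + eta *: G z.1.2 + r k.+1 *: z.2))).
      exact: bounded_phi.
    have -> : a k.+1 = \int[P]_w f3 (eta *: S k w, y k w).
      apply: eq_Rintegral => w _; apply: eq_Rintegral => g _.
      by rewrite /S big_ord_recr/= scalerDr.
    (* Only observations before k enter the partial sum, so [y k] can be integrated out. *)
    have mSk : measurable_fun setT
        ((fun w => eta *: S k w) : g_sigma_algebraType (others y k) -> V).
      apply: measurable_funZ_cv => //; apply: measurable_sum_cv => i.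
      apply: measurableT_comp mGG _; apply: others_measurable_fun.
      by rewrite neq_ltn ltn_ord.
    rewrite (independent_Rintegral y_indep y_law mSk bf3).
    apply: eq_Rintegral => w _.
    have b4 : bounded_measurable (fun z : U * V => phi (eta *: S k w + eta *: G z.1 + r k.+1 *: z.2)).
      apply: bounded_phi; apply: measurable_funD_cv; first apply: measurable_funD_cv => //.
        by apply: measurable_funZ_cv => //; exact: measurableT_comp mGG measurable_fst.
      by apply: measurable_funZ_cv => //; exact: measurable_snd.
    rewrite /f3 (Rfubini F Q b4); apply: eq_Rintegral => g _; apply: eq_Rintegral => u _.
    by rewrite addrAC.
  rewrite aE aSE.
  have i1 := bounded_measurable_fubini_F P Q b1; have i2 := bounded_measurable_fubini_F P Q b2.
  rewrite -(RintegralB measurableT (bounded_measurable_integrable P i1)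
    (bounded_measurable_integrable P i2)).
  apply: Rintegral_norm_le; first by have [] := bounded_measurableB i1 i2.
  move=> w; have j1 := bounded_measurable_snd b1 w; have j2 := bounded_measurable_snd b2 w.
  rewrite -(RintegralB measurableT (bounded_measurable_integrable Q j1)
    (bounded_measurable_integrable Q j2)).
  apply: Rintegral_norm_le; first by have [] := bounded_measurableB j1 j2.
  by move=> g; exact: swap.
have a0E : a 0%N = \int[Q]_x phi x.
  rewrite /a; under eq_Rintegral => w _.
    rewrite /S big_ord0 scaler0 /r mul0r subr0 sqrtr1.
    under eq_Rintegral do rewrite add0r scale1r.
    over.
  exact: Rintegral_cst1.
have anE : a n = \int[P]_w phi (eta *: S n w).
  apply: eq_Rintegral => w _; rewrite /r eta2 divff ?pnatr_eq0 ?lt0n_neq0// subrr sqrtr0.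
  under eq_Rintegral do rewrite scale0r addr0.
  exact: Rintegral_cst1.
have tele k : (k <= n)%N -> `|a k - a 0%N| <= k%:R * (K * eta ^+ 3).
  elim: k => [|k IH] kn; first by rewrite subrr normr0 mul0r.
  apply: le_trans (ler_distD (a k) _ _) _.
  rewrite -natr1 mulrDl mul1r addrC lerD//; last by rewrite distrC; exact: step.
  by apply: IH; exact: ltnW.
have := tele n (leqnn n); rewrite a0E anE; move/le_trans; apply.
rewrite le_eqVlt; apply/orP; left; apply/eqP.
rewrite -/eta mulrCA; congr (_ * _).
by rewrite exprS eta2 mulrCA divff ?mulr1 ?pnatr_eq0 ?lt0n_neq0.
Qed.

End lindeberg.

(** * Smooth test functions and convergence in law *)

Section smooth_step.
Context (R : realType).
Implicit Types a h t k : R.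

Let clamp t : R := if t <= 0 then 0 else if 1 <= t then 1 else t.

(** The quintic 10 t^3 - 15 t^4 + 6 t^5: its first two derivatives vanish at 0 and 1, so the clamped
    function keeps a third-order remainder across the joins. *)
Definition smooth_step t : R :=
  clamp t ^+ 3 * (10 - 15 * clamp t + 6 * clamp t ^+ 2).

Lemma smooth_step_le0 t : t <= 0 -> smooth_step t = 0.
Proof. by rewrite /smooth_step /clamp => ->; rewrite expr0n mul0r. Qed.

Lemma smooth_step_ge1 t : 1 <= t -> smooth_step t = 1.
Proof.
rewrite /smooth_step /clamp => t1; have -> : (t <= 0) = false by apply/negbTE; lra.
by rewrite t1; ring.
Qed.

Lemma smooth_step_itv t : 0 <= smooth_step t <= 1.
Proof.
rewrite /smooth_step /clamp; have [_|t0] := leP t 0; first by rewrite expr0n mul0r; lra.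
have [_|t1] := leP 1 t; first by lra.
(* The symmetry f(t) = 1 - f(1 - t) of the quintic, written out. *)
have -> : t ^+ 3 * (10 - 15 * t + 6 * t ^+ 2) =
  1 - (1 - t) ^+ 3 * (1 + 3 * t + 6 * t ^+ 2) by ring.
have u3 : 0 <= (1 - t) ^+ 3 by rewrite exprn_ge0// subr_ge0 ltW.
have : 0 <= (1 - t) ^+ 3 * (1 + 3 * t + 6 * t ^+ 2) by rewrite mulr_ge0//; nra.
have : 0 <= t ^+ 3 * (10 - 15 * t + 6 * t ^+ 2) by rewrite mulr_ge0//; nra.
lra.
Qed.

Lemma measurable_smooth_step : measurable_fun setT smooth_step.
Proof.
have mc : measurable_fun setT clamp.
  rewrite (_ : clamp = fun t => Num.min (Num.max t 0) 1).
    apply: measurable_minr => //; exact: measurable_maxr.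
  apply/funext => t; rewrite /clamp; have [t0|t0] := leP t 0.
    by rewrite (min_idPl _)// ler01.
  by have [t1|t1] := leP 1 t; rewrite ?(min_idPr _) ?(min_idPl _)// ltW.
apply: measurable_funM; first exact: measurable_funX.
apply: measurable_funD; last by apply: measurable_funM => //; exact: measurable_funX.
by apply: measurable_funB => //; exact: measurable_funM.
Qed.

(* Where clamping interferes ([k <> h]), both derivatives at [a] are [O(h)]
   because they vanish at [0] and [1]. *)
Lemma smooth_step_taylor a : exists d1 d2, forall h,
  [/\ `|d1 * h| <= 200 * `|h|, `|d2 * h ^+ 2| <= 200 * `|h| ^+ 2,
    `|smooth_step (a + h) - smooth_step a| <= 200 * `|h|,
    `|smooth_step (a + h) - smooth_step a - d1 * h| <= 200 * `|h| ^+ 2 &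
    `|smooth_step (a + h) - smooth_step a - d1 * h - d2 * h ^+ 2| <= 200 * `|h| ^+ 3].
Proof.
pose t := clamp a.
have t01 : 0 <= t <= 1.
  rewrite /t /clamp; have [_|t0] := leP a 0; first by lra.
  by have [_|t1] := leP 1 a; lra.
(* The derivative and half the second derivative of the quintic at the clamped point. *)
pose d1 := 30 * (t * (1 - t)) ^+ 2; pose d2 := 30 * (t * (1 - t)) * (1 - 2 * t).
(* In the clamped increment [k] the expansion is exact; what remains is to absorb [h - k]. *)
exists d1, d2 => h; pose k := clamp (a + h) - t.
have tk : 0 <= t + k <= 1.
  rewrite /k subrKC /clamp; have [_|t0] := leP (a + h) 0; first by lra.
  by have [_|t1] := leP 1 (a + h); lra.
have [kh hk kw] : [/\ `|k| <= `|h|, `|h - k| <= `|h| &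
    k = h \/ t * (1 - t) <= `|h|].
  rewrite /k /t /clamp.
  have [a0|a0] := leP a 0; have [b0|b0] := leP (a + h) 0;
  have [a1|a1] := leP 1 a; have [b1|b1] := leP 1 (a + h);
  have [h0|h0] := leP 0 h; try lra;
  rewrite ?(ger0_norm h0) ?(ltr0_norm h0); split;
  try (rewrite ler_norml; lra); (try by right; nra); (try by left; lra).
have sE : smooth_step (a + h) - smooth_step a =
    d1 * k + d2 * k ^+ 2 + k ^+ 3 * (10 - 60 * (t * (1 - t)) + (30 * t - 15) * k + 6 * k ^+ 2).
  have -> : smooth_step (a + h) = (t + k) ^+ 3 * (10 - 15 * (t + k) + 6 * (t + k) ^+ 2).
    by rewrite /k subrKC.
  have -> : smooth_step a = t ^+ 3 * (10 - 15 * t + 6 * t ^+ 2) by [].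
  by rewrite /d1 /d2; ring.
set w := t * (1 - t) in d1 d2 kw sE *.
have w0 : 0 <= w by rewrite /w mulr_ge0; lra.
have w1 : w <= 1 / 4 by rewrite /w; have := sqr_ge0 (1 - 2 * t); nra.
have k1 : `|k| <= 1 by rewrite ler_norml; lra.
set e := 10 - 60 * w + (30 * t - 15) * k + 6 * k ^+ 2 in sE.
have M (x y X Y : R) : `|x| <= X -> `|y| <= Y -> `|x * y| <= X * Y.
  by move=> xX yY; rewrite normrM ler_pM.
have e1 : `|e| <= 31.
  have h1 : `|10 - 60 * w| <= 10 by rewrite ler_norml; lra.
  have h2 : `|(30 * t - 15) * k| <= 15 * 1 by apply: M k1; rewrite ler_norml; lra.
  have h3 : `|k ^+ 2| <= 1 * 1 by apply: (M k k).
  move: h1 h2 h3; rewrite /e !ler_norml; move: ((30 * t - 15) * k) (k ^+ 2) => u v.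
  by lra.
have n0 : 0 <= `|h| by [].
have d1E : `|d1| = 30 * w ^+ 2 by apply: ger0_norm; rewrite mulr_ge0// sqr_ge0.
have D1 : `|d1| <= 30 * w by rewrite d1E ler_wpM2l// expr2 ler_piMl//; lra.
have D2 : `|d2| <= 30 * w.
  have w30 : `|30 * w| <= 30 * w by rewrite ger0_norm// mulr_ge0.
  have t2 : `|1 - 2 * t| <= 1 by rewrite ler_norml; lra.
  by have := M _ _ _ _ w30 t2; rewrite mulr1.
have kk : `|k ^+ 2| <= `|h| ^+ 2 by rewrite normrX lerXn2r ?nnegrE.
have kkk : `|k ^+ 3| <= `|h| ^+ 3 by rewrite normrX lerXn2r ?nnegrE.
have d1h : `|d1 * (h - k)| <= 30 * `|h| ^+ 2.
  case: kw => [->|wh]; first by rewrite subrr mulr0 normr0 mulr_ge0 ?exprn_ge0.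
  apply: le_trans (M _ _ _ _ D1 hk) _; rewrite expr2 mulrA ler_wpM2r//; lra.
have d1h' : `|d1 * (h - k)| <= 30 * `|h| ^+ 3.
  case: kw => [->|wh]; first by rewrite subrr mulr0 normr0 mulr_ge0 ?exprn_ge0.
  have D1' : `|d1| <= 30 * `|h| ^+ 2.
    by rewrite d1E ler_wpM2l// lerXn2r ?nnegrE.
  apply: le_trans (M _ _ _ _ D1' hk) _; by rewrite -mulrA -exprSr.
have d2h : `|d2 * (h ^+ 2 - k ^+ 2)| <= 60 * `|h| ^+ 3.
  case: kw => [->|wh]; first by rewrite subrr mulr0 normr0 mulr_ge0 ?exprn_ge0.
  have D2' : `|d2| <= 30 * `|h| by lra.
  have sq : `|h ^+ 2 - k ^+ 2| <= 2 * `|h| ^+ 2.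
    apply: le_trans (ler_normB _ _) _; rewrite normrX; lra.
  apply: le_trans (M _ _ _ _ D2' sq) _; rewrite le_eqVlt; apply/orP; left.
  by apply/eqP; ring.
have n2 : 0 <= `|h| ^+ 2 by rewrite exprn_ge0.
have n3 : 0 <= `|h| ^+ 3 by rewrite exprn_ge0.
have T2 (u v A B : R) : `|u| <= A -> `|v| <= B -> `|u + v| <= A + B.
  by move=> uA vB; rewrite (le_trans (ler_normD _ _))// lerD.
have D1c : `|d1| <= 30 by lra.
have D2c : `|d2| <= 30 by lra.
have k3c : `|k ^+ 3| <= `|h| ^+ 2.
  rewrite exprS; apply: le_trans (M _ _ _ _ k1 kk) _; by rewrite mul1r.
have k2c : `|k ^+ 2| <= `|h|.
  rewrite expr2; apply: le_trans (M _ _ _ _ k1 kh) _; by rewrite mul1r.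
have k3d : `|k ^+ 3| <= `|h|.
  rewrite exprS; apply: le_trans (M _ _ _ _ k1 k2c) _; by rewrite mul1r.
rewrite sE; split.
- apply: le_trans (M _ _ _ _ D1c (lexx _)) _; lra.
- apply: le_trans (M _ _ _ _ D2c (lexx _)) _; rewrite normrX; lra.
- apply: le_trans (T2 _ _ _ _ (T2 _ _ _ _ (M _ _ _ _ D1c kh) (M _ _ _ _ D2c k2c)) (M _ _ _ _ k3d e1)) _.
  lra.
- have -> : d1 * k + d2 * k ^+ 2 + k ^+ 3 * e - d1 * h =
    - (d1 * (h - k)) + d2 * k ^+ 2 + k ^+ 3 * e by ring.
  rewrite -normrN in d1h.
  apply: le_trans (T2 _ _ _ _ (T2 _ _ _ _ d1h (M _ _ _ _ D2c kk)) (M _ _ _ _ k3c e1)) _.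
  lra.
- have -> : d1 * k + d2 * k ^+ 2 + k ^+ 3 * e - d1 * h - d2 * h ^+ 2 =
    - (d1 * (h - k)) + - (d2 * (h ^+ 2 - k ^+ 2)) + k ^+ 3 * e by ring.
  rewrite -normrN in d1h'; rewrite -normrN in d2h.
  apply: le_trans (T2 _ _ _ _ (T2 _ _ _ _ d1h' d2h) (M _ _ _ _ kkk e1)) _.
  lra.
Qed.

End smooth_step.

(** * Smooth partitions of unity and interpolation *)

Section smooth_partition.
Context (R : realType) (p : nat).
Local Notation V := 'cV[R]_p.

Lemma smooth3_step_coord (i : 'I_p) (k b : R) :
  smooth3 (fun x : V => smooth_step (k * x i 0 + b)).
Proof.
split.
  apply: measurableT_comp (@measurable_smooth_step R) _; apply: measurable_funD => //.
  by apply: measurable_funM => //; exact: measurable_coord.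
pose C := 200 * (`|k| + `|k| ^+ 2 + `|k| ^+ 3) + 1.
have k1 : 0 <= `|k| by [].
have k2 : 0 <= `|k| ^+ 2 by rewrite exprn_ge0.
have k3 : 0 <= `|k| ^+ 3 by rewrite exprn_ge0.
exists C => x; split.
  have /andP[s0 s1] := smooth_step_itv (k * x i 0 + b).
  by rewrite ger0_norm// /C; lra.
have [d1 [d2 H]] := smooth_step_taylor (k * x i 0 + b).
exists ((d1 * k) *: delta_mx i 0), ((d2 * k ^+ 2) *: delta_mx i i) => h.
have := H (k * h i 0).
have -> : k * x i 0 + b + k * h i 0 = k * (x + h) i 0 + b by rewrite mxE; ring.
have hE : (delta_mx i i : 'M[R]_p) *m h = h i 0 *: delta_mx i 0.
  apply/colP => j; rewrite !mxE (bigD1 i)//= big1 ?addr0 => [|l li]; rewrite !mxE ?eqxx ?andbT.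
    by rewrite mulrC.
  by rewrite (negbTE li) andbF mul0r.
rewrite /taylor2_at dotvZl dotv_delta -scalemxAl dotvZr hE dotvZr (dotvC h) dotv_delta.
have -> : d1 * (k * h i 0) = d1 * k * h i 0 by ring.
have -> : d2 * (k * h i 0) ^+ 2 = d2 * k ^+ 2 * (h i 0 * h i 0) by ring.
have hi := coord_le_enorm h i.
have n0 := enorm_ge0 h.
have B (m : nat) (e : R) : 200 * `|k| ^+ m <= C -> e <= 200 * `|k * h i 0| ^+ m ->
    e <= C * enorm h ^+ m.
  move=> kC /le_trans; apply; rewrite normrM exprMn mulrA; apply: ler_pM.
  - by apply: mulr_ge0; [exact: ler0n|exact: exprn_ge0].
  - exact: exprn_ge0.
  - exact: kC.
  - by rewrite lerXn2r ?nnegrE.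
have B1 (e : R) : e <= 200 * `|k * h i 0| -> e <= C * enorm h.
  by move=> eE; have := B 1%N e; rewrite !expr1; apply => //; rewrite /C; lra.
by move=> [h1 h2 h3 h4 h5]; split; [exact: B1| |exact: B1| |];
  apply: B => //; rewrite /C; lra.
Qed.

Context (N : nat) (delta : R) (delta0 : 0 < delta).

(** A bump between (j - N) delta and (j + 2 - N) delta. Consecutive bumps telescope, so they sum to
    1 away from both ends of the grid. *)
Definition weight (j : nat) (u : R) : R :=
  smooth_step (delta^-1 * u + (N%:R - j%:R)) - smooth_step (delta^-1 * u + (N%:R - j.+1%:R)).

Let node (j : nat) : R := (j%:R - N%:R) * delta.

Lemma weight_ge0 j u : 0 <= weight j u.
Proof.
rewrite /weight -natr1.
set t := _ + (_ - (_ + 1)).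
have -> : delta^-1 * u + (N%:R - j%:R) = t + 1 by rewrite /t; ring.
have [t0|t0] := leP t 0.
  by rewrite (smooth_step_le0 t0) subr0; have /andP[] := smooth_step_itv (t + 1).
rewrite [smooth_step (t + 1)]smooth_step_ge1; last by lra.
by have /andP[] := smooth_step_itv t; lra.
Qed.

Lemma weight_support j u : weight j u != 0 -> `|u - node j| <= 2 * delta.
Proof.
move=> w0; set t := delta^-1 * u + (N%:R - j.+1%:R).
have tE : u - node j = (t + 1) * delta.
  rewrite /t /node -natr1; field; by rewrite gt_eqF.
have t1E : delta^-1 * u + (N%:R - j%:R) = t + 1 by rewrite /t -natr1; ring.
move: w0; rewrite /weight t1E -/t => w0.
have tm1 : -1 < t.
  rewrite ltNge; apply: contra w0 => t1; rewrite !smooth_step_le0 ?subrr//; lra.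
have t1 : t < 1.
  rewrite ltNge; apply: contra w0 => t1; rewrite !smooth_step_ge1 ?subrr//; lra.
rewrite tE normrM (gtr0_norm delta0) ler_pM2r// ler_norml; lra.
Qed.

Lemma sum_weight u : \sum_(j < (2 * N)%N) weight j u =
  smooth_step (delta^-1 * u + N%:R) - smooth_step (delta^-1 * u - N%:R).
Proof.
pose f (j : nat) := - smooth_step (delta^-1 * u + (N%:R - j%:R)).
transitivity (\sum_(0 <= j < 2 * N) (f j.+1 - f j)).
  by rewrite big_mkord; apply: eq_bigr => j _; rewrite /f opprK addrC.
rewrite telescope_sumr// /f opprK subr0 addrC; congr (_ - smooth_step (_ + _)).
by rewrite natrM; ring.
Qed.

Lemma sum_weight_itv u : 0 <= \sum_(j < (2 * N)%N) weight j u <= 1.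
Proof.
rewrite sumr_ge0 => [|j _]; last exact: weight_ge0.
rewrite sum_weight; have /andP[_ s1] := smooth_step_itv (delta^-1 * u + N%:R).
by have /andP[s0 _] := smooth_step_itv (delta^-1 * u - N%:R); lra.
Qed.

Lemma sum_weight1 u : `|u| <= (N%:R - 1) * delta ->
  \sum_(j < (2 * N)%N) weight j u = 1.
Proof.
move=> uN; rewrite sum_weight.
have : `|delta^-1 * u| <= N%:R - 1.
  by rewrite normrM gtr0_norm ?invr_gt0// mulrC ler_pdivrMr.
rewrite ler_norml => /andP[u1 u2].
by rewrite smooth_step_ge1 ?smooth_step_le0 ?subr0//; lra.
Qed.

Lemma smooth3_weight i j : smooth3 (fun x : V => weight j (x i 0)).
Proof.
have -> : (fun x : V => weight j (x i 0)) = fun x => smooth_step (delta^-1 * x i 0 + (N%:R - j%:R)) +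
    -1 * smooth_step (delta^-1 * x i 0 + (N%:R - j.+1%:R)).
  by apply/funext => x; rewrite /weight mulN1r.
apply: smooth3D; first exact: smooth3_step_coord.
by apply: smooth3Z; exact: smooth3_step_coord.
Qed.

(** A cutoff function; expanded by distributivity it is the total weight of all grid points. *)
Definition plateau (x : V) : R := \prod_i \sum_(j < (2 * N)%N) weight j (x i 0).

Lemma smooth3_plateau : smooth3 plateau.
Proof.
by apply: smooth3_prod => i; apply: smooth3_sum => j; exact: smooth3_weight.
Qed.

Lemma plateau_itv x : 0 <= plateau x <= 1.
Proof.
rewrite prodr_ge0 => [|i _]; last by have /andP[] := sum_weight_itv (x i 0).
by apply: prodr_ile1 => i _; exact: sum_weight_itv.
Qed.

Lemma plateau1 (x : V) : (forall i, `|x i 0| <= (N%:R - 1) * delta) -> plateau x = 1.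
Proof. by move=> xN; rewrite /plateau big1// => i _; rewrite sum_weight1. Qed.

Let gridpt (k : {ffun 'I_p -> 'I_(2 * N)%N}) : V := \col_i node (k i).

Definition interpolant (f : V -> R) (x : V) : R :=
  \sum_(k : {ffun 'I_p -> 'I_(2 * N)%N}) f (gridpt k) * \prod_i weight (k i) (x i 0).

Lemma smooth3_interpolant f : smooth3 (interpolant f).
Proof.
rewrite /interpolant; apply: smooth3_sum => k.
by apply: smooth3Z; apply: smooth3_prod => i; exact: smooth3_weight.
Qed.

(** Both terms are sums with the same weights, and these charge only grid points whose coordinates
    are within 2 delta of those of [x]. *)
Lemma interpolant_dist (f : V -> R) eps (x : V) : 0 <= eps ->
  (forall x' : V, (forall i, `|x i 0| <= (N%:R + 2) * delta) ->
     (forall i, `|x i 0 - x' i 0| <= 2 * delta) -> `|f x - f x'| <= eps) ->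
  `|f x * plateau x - interpolant f x| <= eps.
Proof.
move=> eps0 fx.
have plE : plateau x = \sum_(k : {ffun 'I_p -> 'I_(2 * N)%N}) \prod_i weight (k i) (x i 0).
  by rewrite /plateau bigA_distr_bigA.
rewrite plE mulr_sumr /interpolant -sumrB.
under eq_bigr do rewrite -mulrBl.
apply: le_trans (ler_norm_sum _ _ _) _.
apply: (@le_trans _ _ (\sum_(k : {ffun 'I_p -> 'I_(2 * N)%N}) eps * \prod_i weight (k i) (x i 0))).
  apply: ler_sum => k _; rewrite normrM.
  have w0 : 0 <= \prod_i weight (k i) (x i 0) by apply: prodr_ge0 => i _; exact: weight_ge0.
  rewrite (ger0_norm w0).
  have [->|wn0] := eqVneq (\prod_i weight (k i) (x i 0)) 0; first by rewrite !mulr0.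
  apply: ler_wpM2r => //.
  have sup i : `|x i 0 - node (k i)| <= 2 * delta.
    apply: weight_support; move: wn0; rewrite prodf_seq_neq0 => /allP/(_ i).
    by rewrite mem_index_enum => /(_ isT).
  apply: fx => i; last by rewrite mxE.
  have : `|node (k i)| <= N%:R * delta.
    rewrite /node normrM (gtr0_norm delta0) ler_pM2r// ler_norml.
    have := ltn_ord (k i); rewrite -(ltr_nat R) natrM => ?.
    have : 0 <= (k i)%:R :> R by []. 
    by lra.
  have := sup i; rewrite -{2}(subrK (node (k i)) (x i 0)) => s1 s2.
  by apply: le_trans (ler_normD _ _) _; apply: le_trans (lerD s1 s2) _; lra.
rewrite -mulr_sumr -plE; have /andP[_ pl1] := @plateau_itv x.
by rewrite ler_piMr.
Qed.

End smooth_partition.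

(** * From smooth test functions to bounded continuous ones *)

Section weak_convergence.
Context (R : realType) (p : nat).
Local Notation V := 'cV[R]_p.

Lemma uniform_continuity_box (f : V -> R) (L eps : R) : continuous f -> 0 < eps ->
  exists2 delta, 0 < delta & forall x x' : V, (forall i, `|x i 0| <= L) ->
    (forall i, `|x i 0 - x' i 0| < delta) -> `|f x - f x'| <= eps.
Proof.
move=> cf eps0.
(* Compactness of boxes is taken for row vectors, hence the transpositions. The second point may
   leave the box, so it is compared with the centre [v] of a neighbourhood. *)
pose K := [set v : 'rV[R]_p | forall i, v ord0 i \in `[(- L), L]].
have cK : compact K.
  apply: (@rV_compact _  _ (fun=> `[(- L), L]%classic)).
  by move=> _; exact: segment_compact.
have [] := (compact_near_coveringP K).1 cK R (0 : R)^'+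
  (fun e v => forall x' : V, (forall i, `|v 0 i - x' i 0| < e) -> `|f v^T - f x'| <= eps).
- move=> v Kv.
  have /cvgrPdist_lt/(_ (eps / 2)) := cf v^T.
  rewrite divr_gt0// => /(_ isT) /nbhs_ballP[e /= e0 fe].
  exists (ball v (e / 2), [set e' | e' < e / 2]) => /=.
    split; first by apply: nbhsx_ballx; rewrite divr_gt0.
    by apply: nbhs_right_lt; rewrite divr_gt0.
  move=> [v' e'] /= [[_ vv'] e'e] x' v'x'.
  have H1 : `|f v^T - f v'^T| < eps / 2.
    apply: fe; split => // i j; rewrite !mxE ord1.
    by have := vv' 0 i; rewrite /ball/= => /lt_trans; apply; lra.
  have H2 : `|f v^T - f x'| < eps / 2.
    apply: fe; split => // i j; rewrite !mxE ord1.
    have := vv' 0 i; rewrite /ball/= => h1; have h2 := lt_trans (v'x' i) e'e.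
    apply: le_lt_trans (ler_distD (v' 0 i) _ _) _.
    by rewrite (splitr e) ltrD.
  rewrite distrC in H1.
  by apply: le_trans (ler_distD (f v^T) _ _) _; rewrite (splitr eps) lerD// ltW.
move=> e0 /= e00 He.
have : 0 < e0 / 2 by rewrite divr_gt0.
move=> e2; exists (e0 / 2) => // x x' xL xx'.
have := He (e0 / 2); rewrite /ball/= sub0r normrN gtr0_norm// => /(_ _ e2) H.
have := H _ x^T; rewrite trmxK; apply.
- by lra.
- by move=> i; rewrite mxE in_itv/= -ler_norml.
- by move=> i; rewrite mxE.
Qed.

(** Far from the origin the error is controlled by [1 - chi] alone. As [chi] is itself a smooth test
    function, its expectations converge too, and this replaces a separate proof of tightness. *)
Lemma smooth3_approx (f : V -> R) (M K eps : R) : continuous f ->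
  (forall x, `|f x| <= M) -> 0 < eps ->
  exists phi chi : V -> R, [/\ smooth3 phi, smooth3 chi,
    forall x, 0 <= chi x <= 1, forall x, enorm x <= K -> chi x = 1 &
    forall x, `|f x - phi x| <= M * (1 - chi x) + eps].
Proof.
move=> cf fM eps0; pose K' : R := `|K|; have K0 : 0 <= K' := normr_ge0 K.
have [d d0 Hd] := uniform_continuity_box (K' + 4) cf eps0.
(* The interpolant compares points at coordinate distance 2 delta, which must stay below [d]; delta
   <= 1 keeps the enlarged box within K' + 4. *)
pose delta := Num.min (d / 3) 1.
have delta0 : 0 < delta by rewrite lt_min ltr01 divr_gt0.
have delta1 : delta <= 1 by rewrite ge_min lexx orbT.
have deltad : 2 * delta < d.
  have : delta <= d / 3 by rewrite ge_min lexx.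
  by lra.
(* The two extra steps ensure N - 1 >= K' / delta, so the plateau extends to K'. *)
pose N := (Num.truncn (K' / delta)).+2.
have [q1 q2] : (Num.truncn (K' / delta))%:R <= K' / delta /\ K' / delta < (Num.truncn (K' / delta)).+1%:R.
  by apply/andP; apply: truncn_itv; rewrite divr_ge0// ltW.
have NE : N%:R = (Num.truncn (K' / delta))%:R + 2 :> R by rewrite /N -2!natr1 -addrA.
have N1 : K' <= (N%:R - 1) * delta.
  rewrite -ler_pdivrMr// NE; move: q2; rewrite -natr1 => /ltW; lra.
have N2 : (N%:R + 2) * delta <= K' + 4.
  by move: q1; rewrite NE ler_pdivlMr// => H; nra.
exists (interpolant N delta f), (plateau N delta); split.
- exact: smooth3_interpolant.
- exact: smooth3_plateau.
- move=> x; exact: plateau_itv.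
- move=> x xK; apply: plateau1 => // i; apply: le_trans (coord_le_enorm x i) _.
  by apply: le_trans xK _; apply: le_trans N1; exact: ler_norm.
- move=> x; have -> : f x - interpolant N delta f x =
    f x * (1 - plateau N delta x) + (f x * plateau N delta x - interpolant N delta f x) by ring.
  apply: le_trans (ler_normD _ _) _; apply: lerD.
    have /andP[pl0 pl] := @plateau_itv R p N delta x.
    by rewrite normrM (@ger0_norm _ (1 - _)) ?subr_ge0// ler_wpM2r// subr_ge0.
  apply: interpolant_dist => //; first exact: ltW.
  move=> x' xN xx'; apply: Hd => i; first exact: le_trans (xN i) N2.
  exact: le_lt_trans (xx' i) deltad.
Qed.

Lemma enorm_tail_cvg0 (Q : probability V R) (eps : R) : 0 < eps ->
  exists K : R, (Q [set x | (K < enorm x)%R] <= eps%:E)%E.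
Proof.
move=> eps0; pose B (k : nat) : set V := [set x | k%:R < enorm x].
have mB k : measurable (B k).
  rewrite (_ : B k = @enorm R p @^-1` `]k%:R, +oo[%classic).
    by rewrite -[X in measurable X]setTI; exact: measurable_enorm.
  by apply/seteqP; split => x /=; rewrite in_itv/= andbT.
have B0 : \bigcap_k B k = set0.
  apply/seteqP; split => // x /(_ (Num.truncn (enorm x)).+1 I).
  by rewrite /B/= ltNge ltW//; have /andP[] := truncn_itv (enorm_ge0 x).
have Qfin : (Q (B 0%N) < +oo)%E by rewrite (le_lt_trans (probability_le1 Q _))// ltry.
have := nonincreasing_cvg_mu Qfin mB _ _.
rewrite B0 measure0 => H.
have {}H : Q (B n) @[n --> \oo] --> 0%E.
  apply: H => //; apply/nonincreasing_seqP => n; apply/subsetPset => x; rewrite /B/=.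
  by apply: le_lt_trans; rewrite ler_nat.
have /fine_cvgP[_ /cvgrPdist_le/(_ eps eps0)[n _ /(_ n (leqnn n))]] := H.
rewrite sub0r normrN/= => Hn; exists n%:R.
have Qn : Q (B n) \is a fin_num by rewrite fin_num_measure.
rewrite -[leLHS](fineK Qn) lee_fin; apply: le_trans Hn; exact: ler_norm.
Qed.

Context d (T : measurableType d) (P : probability T R).

Lemma smooth3_cvg_in_law (X : nat -> T -> V) (Q : probability V R) :
  (forall n, measurable_fun setT (X n)) ->
  (forall phi : V -> R, smooth3 phi ->
     \int[P]_w phi (X n w) @[n --> \oo] --> \int[Q]_x phi x) ->
  cvg_in_law P X Q.
Proof.
move=> mX cvgX f cf [M0 [_ fM0]].
have [M M0' fM] : exists2 M : R, 0 < M & forall x, `|f x| <= M.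
  exists (`|M0| + 1) => [|x]; first by rewrite ltr_wpDl.
  by apply: fM0 => //; rewrite (le_lt_trans (ler_norm _))// ltrDl.
have bf : bounded_measurable f.
  by split; [exact: continuous_measurable_mx|exists M].
have bX n (g : V -> R) : bounded_measurable g -> bounded_measurable (fun w => g (X n w)).
  by move=> bg; exact: (bounded_measurable_comp (mX n) bg).
have iX n (g : V -> R) (bg : bounded_measurable g) := bounded_measurable_integrable P (bX n g bg).
have iQ (g : V -> R) (bg : bounded_measurable g) := bounded_measurable_integrable Q bg.
have -> : (fun n => 'E_P[fun w => f (X n w)]%E) = EFin \o (fun n => \int[P]_w f (X n w)).
  apply/funext => n /=; rewrite unlock (EFin_Rintegral (iX n f bf)) //.
rewrite -(EFin_Rintegral (iQ f bf)).
apply: cvg_EFin; first exact: nearW.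
apply/cvgrPdist_le => eps eps0.
(* The errors collected at the end add up to at most 3 (M + 1) eta. *)
pose eta := eps / (4 * (M + 1)).
have eta0 : 0 < eta by rewrite divr_gt0// mulr_gt0//; lra.
have [K QK] := enorm_tail_cvg0 Q eta0.
have [phi [chi [sphi schi chi01 chi1 fphi]]] := smooth3_approx K cf fM eta0.
have bphi := smooth3_bounded_measurable sphi.
have bchi := smooth3_bounded_measurable schi.
have chiQ : 1 - \int[Q]_x chi x <= eta.
  have b1 : bounded_measurable (fun _ : V => 1 : R) by exact: bounded_measurable_cst.
  have mK : measurable [set x : V | K < enorm x].
    rewrite (_ : mkset _ = @enorm R p @^-1` `]K, +oo[%classic).
      by rewrite -[X in measurable X]setTI; exact: measurable_enorm.
    by apply/seteqP; split => x /=; rewrite in_itv/= andbT.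
  rewrite -{1}(Rintegral_cst1 Q 1) -(RintegralB measurableT (iQ (fun _ => 1) b1) (iQ _ bchi)).
  have bI : bounded_measurable (\1_[set x : V | K < enorm x] : V -> R).
    split; first exact: measurable_indic.
    by exists 1 => x; rewrite indicE; case: (_ \in _); rewrite ?normr0 ?normr1.
  apply: (@le_trans _ _ (\int[Q]_x \1_[set x : V | K < enorm x] x)).
    apply: le_Rintegral => //; [exact: (iQ (fun x => 1 - chi x)) (bounded_measurableB b1 bchi)|exact: (iQ _ bI)|].
    move=> x _; rewrite indicE; have [xK|xK] := boolP (x \in _).
      by have /andP[] := chi01 x; rewrite mulr1n; lra.
    rewrite chi1 ?subrr//; move: xK; rewrite notin_setE/= => /negP.
    by rewrite -leNgt.
  by rewrite /Rintegral integral_indic// setIT -lee_fin fineK// fin_num_measure.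
have dist d' (W : measurableType d') (mu : probability W R) (Y : W -> V) :
    measurable_fun setT Y ->
    `|\int[mu]_w f (Y w) - \int[mu]_w phi (Y w)| <= M * (1 - \int[mu]_w chi (Y w)) + eta.
  move=> mY.
  have bY (g : V -> R) : bounded_measurable g -> bounded_measurable (fun w => g (Y w)).
    by move=> bg; exact: (bounded_measurable_comp mY bg).
  have iY (g : V -> R) (bg : bounded_measurable g) := bounded_measurable_integrable mu (bY g bg).
  have b1 : bounded_measurable (fun _ : W => 1 : R) by exact: bounded_measurable_cst.
  have i1 := bounded_measurable_integrable mu b1.
  have iD := integrableB measurableT (iY _ bf) (iY _ bphi).
  have iM : mu.-integrable setT (EFin \o (fun w => M * (1 - chi (Y w)))).
    exact: (integrableZl measurableT M (integrableB measurableT i1 (iY _ bchi))).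
  have iE : mu.-integrable setT (EFin \o (fun _ : W => eta)).
    exact: (bounded_measurable_integrable mu (bounded_measurable_cst _ eta)).
  rewrite -(RintegralB measurableT (iY _ bf) (iY _ bphi)).
  apply: le_trans (le_normr_Rintegral measurableT iD) _.
  have -> : M * (1 - \int[mu]_w chi (Y w)) + eta = \int[mu]_w (M * (1 - chi (Y w)) + eta).
    rewrite (RintegralD measurableT iM iE) Rintegral_cst1; congr (_ + _).
    rewrite (RintegralZl (f := fun w => 1 - chi (Y w)) M measurableT (integrableB measurableT i1 (iY _ bchi))).
    by rewrite (RintegralB measurableT i1 (iY _ bchi)) Rintegral_cst1.
  apply: (le_Rintegral (f1 := fun w => `|f (Y w) - phi (Y w)|)
    (f2 := fun w => M * (1 - chi (Y w)) + eta) measurableT (integrable_norm iD)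
    (integrableD measurableT iM iE)).
  by move=> w _; exact: fphi.
have Qd : `|\int[Q]_x f x - \int[Q]_x phi x| <= M * (1 - \int[Q]_x chi x) + eta.
  exact: (dist _ _ Q _ (@measurable_id _ _ setT)).
have /cvgrPdist_le/(_ eta eta0) Hphi := cvgX _ sphi.
have /cvgrPdist_le/(_ eta eta0) Hchi := cvgX _ schi.
near=> n.
suff : `|\int[Q]_x f x - \int[P]_w f (X n w)| <= eps by [].
have nphi : `|\int[Q]_x phi x - \int[P]_w phi (X n w)| <= eta by near: n.
have nchi : `|\int[Q]_x chi x - \int[P]_w chi (X n w)| <= eta by near: n.
have Pd := dist _ _ P _ (mX n).
have etaE : eps = 4 * M * eta + 4 * eta by rewrite /eta; field; rewrite gt_eqF//; lra.
move: nphi; rewrite ler_norml => /andP[a1 a2]; move: nchi; rewrite ler_norml => /andP[c1 c2].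
move: Pd; rewrite ler_norml => /andP[p1 p2]; move: Qd; rewrite ler_norml => /andP[q1 q2].
rewrite ler_norml.
have MQ : M * (1 - \int[Q]_x chi x) <= M * eta by rewrite ler_pM2l.
(* The expectation of [chi (X n w)] is within [eta] of its limit, which is at least 1 - eta. *)
have MP : M * (1 - \int[P]_w chi (X n w)) <= M * (2 * eta) by rewrite ler_pM2l//; lra.
have Meta := mulr_gt0 M0' eta0; clearbody eta; rewrite etaE; apply/andP; split; lra.
Unshelve. all: by end_near. Qed.

End weak_convergence.

(** * Minimizers of convex functions *)

Section convex_argmin.
Context (R : realType) (p : nat).
Local Notation V := 'cV[R]_p.

(** Jensen's inequality around a base point [v] that takes the leftover weight; with several points
    in the definition, no induction from the two-point case is required. *)
Definition jensen_convex (g : V -> R) := forall n (v : V) (l : 'I_n -> R) (x : 'I_n -> V),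
  (forall i, 0 <= l i) -> \sum_i l i <= 1 ->
  g (v + \sum_i l i *: (x i - v)) <= (1 - \sum_i l i) * g v + \sum_i l i * g (x i).

Lemma jensen_convex2 g (v x : V) (l : R) : jensen_convex g -> 0 <= l <= 1 ->
  g (v + l *: (x - v)) <= (1 - l) * g v + l * g x.
Proof.
move=> cg /andP[l0 l1]; have := cg 1%N v (fun=> l) (fun=> x) (fun=> l0).
by rewrite !big_ord1; apply.
Qed.

(** Each shifted coordinate is rounded down to a multiple of [h]. *)
Lemma enorm_net (L h : R) : 0 <= L -> 0 < h ->
  exists (J : finType) (pt : J -> V), forall u : V, (forall i, `|u i 0| <= L) ->
    exists j, forall i, `|u i 0 - pt j i 0| <= h.
Proof.
move=> L0 h0; pose M := Num.truncn (2 * L / h).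
exists {ffun 'I_p -> 'I_M.+1}, 
  (fun k : {ffun 'I_p -> 'I_M.+1} => \col_i ((k i)%:R * h - L)) => u uL.
pose m i := Num.truncn ((u i 0 + L) / h).
have ui i : 0 <= u i 0 + L by have := uL i; rewrite ler_norml; lra.
have mM i : (m i < M.+1)%N.
  rewrite ltnS; apply: le_truncn; rewrite ler_pM2r ?invr_gt0//.
  by have := uL i; rewrite ler_norml; lra.
exists [ffun i => Ordinal (mM i)] => i; rewrite !mxE ffunE/=.
have /andP[m1 m2] := truncn_itv (divr_ge0 (ui i) (ltW h0)).
move: m1 m2; rewrite ler_pdivlMr// ltr_pdivrMr// -/(m i) -natr1 mulrDl mul1r.
by move=> m1 m2; rewrite ler_norml; apply/andP; split; lra.
Qed.

Lemma quadratic_lipschitz (A : 'M[R]_p) (L : R) : 0 <= L ->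
  exists2 M : R, 0 <= M & forall x y : V, enorm x <= L -> enorm y <= L ->
    `|dotv x (A *m x) - dotv y (A *m y)| <= M * enorm (x - y).
Proof.
move=> L0; pose a := \sum_i \sum_j `|A i j|.
have a0 : 0 <= a by rewrite sumr_ge0// => i _; rewrite sumr_ge0.
have bil (x y : V) : `|dotv x (A *m y)| <= a * (enorm x * enorm y).
  rewrite dotv_mulmxE /a mulr_suml; apply: le_trans (ler_norm_sum _ _ _) _.
  apply: ler_sum => i _; rewrite mulr_suml; apply: le_trans (ler_norm_sum _ _ _) _.
  apply: ler_sum => j _; rewrite !normrM ler_wpM2l// ler_pM//; exact: coord_le_enorm.
exists (2 * a * L) => [|x y xL yL]; first by rewrite !mulr_ge0.
have -> : dotv x (A *m x) - dotv y (A *m y) = dotv (x - y) (A *m x) + dotv y (A *m (x - y)).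
  by rewrite mulmxBr dotvBl dotvBr; ring.
apply: le_trans (ler_normD _ _) _.
apply: le_trans (lerD (bil _ _) (bil _ _)) _.
have n0 := enorm_ge0 (x - y).
have h1 : a * (enorm (x - y) * enorm x) <= a * (enorm (x - y) * L).
  by rewrite ler_wpM2l// ler_wpM2l.
have h2 : a * (enorm y * enorm (x - y)) <= a * (L * enorm (x - y)).
  by rewrite ler_wpM2l// ler_wpM2r.
by lra.
Qed.

(* Convexity upgrades closeness on a finite net (and its translates along the
   axes) to uniform closeness: from above by writing a point as a convex
   combination of net points, from below by reflecting it through a net point. *)
Lemma convex_uniform_approx (A : 'M[R]_p) (L theta : R) : 0 <= L -> 0 < theta ->
  exists (J : finType) (pt : J -> V) (eta : R), 0 < eta /\
  forall g : V -> R, jensen_convex g ->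
    (forall j, `|g (pt j) - dotv (pt j) (A *m pt j)| <= eta) ->
    forall u : V, enorm u <= L -> `|g u - dotv u (A *m u)| <= theta.
Proof.
move=> L0 theta0; pose q (u : V) := dotv u (A *m u).
have [M M0 qM] := quadratic_lipschitz A (addr_ge0 L0 (ler0n R 3)).
(* The lower bound will lose three times theta / 6 and 4 M eps; this choice keeps the total within
   theta. *)
pose eps := Num.min (theta / (8 * (M + 1))) 2^-1.
have M1 : 0 < 8 * (M + 1) by lra.
have eps0 : 0 < eps by rewrite lt_min invr_gt0 ltr0n andbT divr_gt0.
have eps1 : eps <= 2^-1 by rewrite ge_min lexx orbT.
have Meps : 4 * (M * eps) <= theta / 2.
  have : eps <= theta / (8 * (M + 1)) by rewrite ge_min lexx.
  by rewrite ler_pdivlMr// => H; nra.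
(* With this mesh the absolute coordinates of [u - v] add up to at most eps, so u lies in the
   cross-polytope of the translates of v; p + 1 also covers p = 0. *)
have h0 : 0 < eps / p.+1%:R by rewrite divr_gt0.
have [J [pt net]] := enorm_net L0 h0.
pose pts (jk : J * option ('I_p * bool)) : V := pt jk.1 +
  (if jk.2 is Some ib then ((-1) ^+ ib.2 * eps) *: delta_mx ib.1 0 else 0).
exists (J * option ('I_p * bool))%type, pts, (theta / 6); split; first by rewrite divr_gt0.
move=> g cg gq u uL.
have [j ju] : exists j, forall i, `|u i 0 - pt j i 0| <= eps / p.+1%:R.
  by apply: net => i; apply: le_trans (coord_le_enorm u i) uL.
set v := pt j in ju.
have vE : v = pts (j, None) by rewrite /pts addr0.
have key (a : V) : (forall i, `|a i 0| <= eps / p.+1%:R) -> enorm (v + a) <= L + 2 ->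
    enorm a <= eps /\ g (v + a) <= q (v + a) + (theta / 6 + 2 * (M * eps)).
  move=> ha va.
  have suma : \sum_i `|a i 0| <= eps.
    apply: (@le_trans _ _ (\sum_(i < p) eps / p.+1%:R)); first by apply: ler_sum => i _.
    rewrite sumr_const card_ord -[leLHS]mulr_natr -mulrA ler_piMr//; first exact: ltW.
    by rewrite mulrC ler_pdivrMr// mul1r ler_nat.
  have na : enorm a <= eps by exact: le_trans (enorm_le_sum a) suma.
  split => //.
  (* Barycentric weights: the translate of v by eps along axis i, in the direction of the sign of
     [a i 0], receives |a_i| / eps. *)
  pose l (i : 'I_p) := `|a i 0| / eps; pose x (i : 'I_p) := pts (j, Some (i, a i 0 < 0)).
  have l0 i : 0 <= l i by rewrite divr_ge0// ltW.
  have l1 : \sum_i l i <= 1 by rewrite -mulr_suml ler_pdivrMr// mul1r.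
  have vaE : v + a = v + \sum_i l i *: (x i - v).
    congr (_ + _); apply/colP => i; rewrite summxE (bigD1 i)//= big1 => [|k ki].
      rewrite /x /pts/= -/v [v + _]addrC addrK !mxE !eqxx mulr1 addr0 /l mulrCA.
      rewrite divfK ?gt_eqF//.
      by rewrite mulrC mulrN1 || idtac; case: ltP => a0; rewrite ?expr1 ?expr0 ?mulN1r ?mul1r ?mulr1 ?mulrN1; [rewrite ltr0_norm ?opprK|rewrite ger0_norm].
    by rewrite /x /pts/= -/v [v + _]addrC addrK !mxE eq_sym (negbTE ki) !mulr0.
  have close (w : V) : enorm (w - v) <= eps -> enorm w <= L + 3 /\ `|q w - q (v + a)| <= M * (2 * eps).
    move=> wv.
    have wva : enorm (w - (v + a)) <= 2 * eps.
      rewrite opprD addrA; apply: le_trans (enormD _ _) _; rewrite enormN; lra.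
    have wL : enorm w <= L + 3.
      have -> : w = (w - v) + ((v + a) - a) by rewrite addrK subrK.
      apply: le_trans (enormD _ _) _; have := enormD (v + a) (- a); rewrite enormN; lra.
    split => //; apply: le_trans (qM _ _ wL _) _; first by lra.
    by rewrite ler_wpM2l.
  have gle (jk : J * option ('I_p * bool)) : enorm (pts jk - v) <= eps ->
      g (pts jk) <= q (v + a) + (theta / 6 + 2 * (M * eps)).
    move=> /close[_ qq]; have := gq jk; rewrite -/(q _).
    move: qq; rewrite !ler_norml => /andP[_ qq] /andP[_ gg].
    by move: qq gg; move: (q (pts jk)) (q (v + a)) (g (pts jk)) => a1 a2 a3; lra.
  rewrite {1}vaE; apply: le_trans (cg _ _ _ _ l0 l1) _.
  set c := _ + (_ + _).
  have -> : c = (1 - \sum_i l i) * c + \sum_i l i * c by rewrite -mulr_suml; ring.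
  apply: lerD.
    apply: ler_wpM2l; first by rewrite subr_ge0.
    by rewrite vE; apply: gle; rewrite -vE subrr enorm0 ltW.
  apply: ler_sum => i _; apply: ler_wpM2l => //; apply: gle.
  rewrite /pts/= -/v [v + _]addrC addrK enormZ enormE dotv_delta mxE !eqxx sqrtr1 mulr1.
  by rewrite normrM normrX normrN1 expr1n mul1r gtr0_norm.
pose a := u - v.
have ua : u = v + a by rewrite /a addrC subrK.
have ha i : `|a i 0| <= eps / p.+1%:R by rewrite /a !mxE.
have ha' i : `|(- a) i 0| <= eps / p.+1%:R by rewrite mxE normrN.
have [na gu] : enorm a <= eps /\ g (v + a) <= q (v + a) + (theta / 6 + 2 * (M * eps)).
  by apply: key => //; rewrite -ua; lra.
have vL : enorm v <= L + 1.
  have -> : v = u - a by rewrite ua addrK.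
  by apply: le_trans (enormD _ _) _; rewrite enormN; lra.
have vaL : enorm (v - a) <= L + 2 by apply: le_trans (enormD _ _) _; rewrite enormN; lra.
have [_ gu'] := key (- a) ha' vaL.
(* Since v is the midpoint of v + a and v - a, the upper bound at v - a becomes a lower bound at u =
   v + a. *)
have mid : g v <= 2^-1 * g (v + a) + 2^-1 * g (v - a).
  have := @jensen_convex2 g (v + a) (v - a) 2^-1 cg.
  have -> : v + a + 2^-1 *: (v - a - (v + a)) = v.
    by apply/colP => i; rewrite !mxE; field.
  have -> : 1 - 2^-1 = 2^-1 :> R by field.
  by apply; lra.
have gv : q v - theta / 6 <= g v.
  by have := gq (j, None); rewrite -vE -/(q v) ler_norml; lra.
have d1 : `|q v - q (v + a)| <= M * eps.
  apply: le_trans (qM v (v + a) _ _) _; [lra|by rewrite -ua; lra|].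
  by rewrite opprD addrA subrr add0r enormN ler_wpM2l.
have d2 : `|q v - q (v - a)| <= M * eps.
  apply: le_trans (qM v (v - a) _ _) _; [lra|lra|].
  by rewrite opprD addrA subrr add0r opprK ler_wpM2l.
rewrite -/(q u) ua; move: gu gu' mid gv d1 d2.
move: (g (v + a)) (g (v - a)) (g v) (q (v + a)) (q (v - a)) (q v) => g1 g2 g3 q1 q2 q3.
rewrite !ler_norml => gu gu' mid gv /andP[d1 d1'] /andP[d2 d2'].
apply/andP; split; lra.
Qed.

(** If t were farther than delta from w, convexity would give a point u of the segment at distance
    delta where the tilted [g] is no larger than at w. There the tilted quadratic form exceeds its
    value at w by lam delta^2 / 2, more than two approximation errors. Points and [eta] do not
    depend on [g], [w] or [t], so they serve a random objective outcome by outcome. *)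
Lemma convex_argmin_close (A : 'M[R]_p) (lam K delta : R) : A^T = A -> 0 < lam ->
  (forall v, lam * enorm v ^+ 2 <= dotv v (A *m v)) -> 0 <= K -> 0 < delta ->
  exists (J : finType) (pt : J -> V) (eta : R), 0 < eta /\
  forall (g : V -> R) (w t : V), jensen_convex g ->
    (forall j, `|g (pt j) - 2^-1 * dotv (pt j) (A *m pt j)| <= eta) ->
    enorm w <= K ->
    (forall u, g t - dotv (A *m w) t <= g u - dotv (A *m w) u) ->
    enorm (t - w) <= delta.
Proof.
move=> symA lam0 Apos K0 delta0.
(* Two errors of this size make up half of the quadratic gap lam delta^2 / 2. *)
have theta0 : 0 < lam * delta ^+ 2 / 8 by rewrite !mulr_gt0// exprn_gt0.
have [J [pt [eta [eta0 H]]]] := convex_uniform_approx (2^-1 *: A) (addr_ge0 K0 (ltW delta0)) theta0.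
exists J, pt, eta; split => // g w t cg gq wK tmin.
have {}H u : enorm u <= K + delta ->
    `|g u - 2^-1 * dotv u (A *m u)| <= lam * delta ^+ 2 / 8.
  move=> uL; rewrite -dotvZr scalemxAl; apply: H => // j.
  by rewrite -scalemxAl dotvZr.
rewrite leNgt; apply/negP => tw.
have n0 : 0 < enorm (t - w) by exact: lt_trans tw.
pose l := delta / enorm (t - w).
have l01 : 0 <= l <= 1.
  by rewrite divr_ge0 ?(ltW delta0) ?(ltW n0)//= ler_pdivrMr// mul1r ltW.
pose u := w + l *: (t - w).
have uw : enorm (u - w) = delta.
  rewrite /u addrC addKr enormZ ger0_norm; last by case/andP: l01.
  by rewrite divfK// gt_eqF.
have gu := jensen_convex2 w t cg l01; rewrite -/u in gu.
have lin : dotv (A *m w) u = (1 - l) * dotv (A *m w) w + l * dotv (A *m w) t.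
  by rewrite /u dotvDr dotvZr dotvBr; ring.
have tw' := tmin w.
have uK : enorm u <= K + delta.
  have -> : u = w + (u - w) by rewrite addrC subrK.
  by apply: le_trans (enormD _ _) _; rewrite uw lerD2r.
have Hu := H u uK; have Hw : `|g w - 2^-1 * dotv w (A *m w)| <= lam * delta ^+ 2 / 8.
  by apply: H; lra.
have quad := Apos (u - w); rewrite uw in quad.
have symw : dotv u (A *m w) = dotv w (A *m u) by rewrite -{1}symA -dotv_mulmx dotvC.
have exp : dotv (u - w) (A *m (u - w)) =
    dotv u (A *m u) - 2 * dotv (A *m w) u + dotv w (A *m w).
  by rewrite mulmxBr !(dotvBl, dotvBr) (dotvC (A *m w)) -symw; ring.
have le1 : g u - dotv (A *m w) u <= g w - dotv (A *m w) w.
  have : l * (g t - dotv (A *m w) t) <= l * (g w - dotv (A *m w) w).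
    by apply: ler_wpM2l => //; case/andP: l01.
  by rewrite lin; lra.
have dw : dotv (A *m w) w = dotv w (A *m w) by rewrite dotvC.
move: Hu Hw; rewrite !ler_norml => /andP[Hu1 Hu2] /andP[Hw1 Hw2].
rewrite exp in quad; rewrite dw in le1.
have D0 : 0 < lam * delta ^+ 2 by rewrite mulr_gt0// exprn_gt0.
clear -quad le1 Hu1 Hu2 Hw1 Hw2 D0.
by lra.
Qed.

End convex_argmin.

(** * Laws with bounded density *)

(** Later estimates concern boxes, for which domination by Lebesgue measure is the usable form of a
    bounded density. *)
Lemma bounded_density_le (R : realType) p d (T : measurableType d)
    (P : probability T R) (X : T -> 'cV[R]_p) (f : 'cV[R]_p -> R) :
  has_density P X f -> bounded_fun (f : _ -> R^o) ->
  exists2 M : R, 0 <= M & forall B, measurable B ->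
    (P (X @^-1` B) <= M%:E * @lebesgue_cV R p B)%E.
Proof.
move=> [mf f0 fE] [M0 [_ fM0]].
have fM x : `|f x| <= `|M0| + 1.
  by apply: fM0 => //; rewrite (le_lt_trans (ler_norm _))// ltrDl.
exists (`|M0| + 1) => [|B mB]; first by rewrite addr_ge0.
rewrite fE// -integral_cst//.
apply: ge0_le_integral => //.
- by move=> x _; rewrite lee_fin.
- by apply/measurable_EFinP; exact: measurable_funTS.
- by move=> x _; rewrite lee_fin; apply: le_trans (fM x); exact: ler_norm.
Qed.

(** In place of compactness of the sphere, write A as a sum of m m^T. Then v is the sum of the (v .
    m) A^-1 m, and each |v . m| is at most the square root of v' A v. *)
Lemma pd_coercive (R : realType) (p : nat) (A : 'M[R]_p) : A^T = A ->
  (forall v, v != 0 -> 0 < dotv v (A *m v)) ->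
  A \in unitmx /\ exists2 lam : R, 0 < lam &
    forall v, lam * enorm v ^+ 2 <= dotv v (A *m v).
Proof.
move=> symA posA.
have unitA : A \in unitmx.
  rewrite -row_free_unit -kermx_eq0; apply/negPn/negP => /rowV0Pn[r /sub_kermxP rA r0].
  have rT : r^T != 0 by rewrite -trmx0 (inj_eq trmx_inj).
  by have := posA _ rT; rewrite -dotv_tr trmxK mulmxA rA mul0mx mxE ltxx.
split => //.
have psdA t : 0 <= dotv t (A *m t).
  by have [->|/posA/ltW//] := eqVneq t 0; rewrite mulmx0 dotv0r.
have [ms AE] := psd_gram symA psdA.
pose C := \sum_(m <- ms) enorm (invmx A *m m).
have C0 : 0 <= C by apply: sumr_ge0 => m _; exact: enorm_ge0.
have C1 : 0 < C ^+ 2 + 1 by rewrite ltr_wpDl// sqr_ge0.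
(* Adding 1 keeps the constant meaningful when [C] is 0. *)
exists (C ^+ 2 + 1)^-1 => [|v]; first by rewrite invr_gt0.
set a := dotv v (A *m v).
have aE : a = \sum_(m <- ms) dotv v m ^+ 2 by rewrite /a AE -gramE.
have ma m : m \in ms -> `|dotv v m| <= Num.sqrt a.
  move=> mms; rewrite -sqrtr_sqr ler_sqrt ?psdA// aE (big_rem m)//= lerDl.
  by apply: sumr_ge0 => i _; exact: sqr_ge0.
have vE : v = \sum_(m <- ms) dotv v m *: (invmx A *m m).
  rewrite -[LHS](mulKmx unitA) {2}AE mulmx_suml mulmx_sumr; apply: eq_bigr => m _.
  by rewrite -(mulmxA m) [m^T *m v]mx11_scalar mul_mx_scalar -scalemxAr dotv_tr dotvC.
have vC : enorm v <= Num.sqrt a * C.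
  rewrite {1}vE; apply: le_trans (enorm_sum _ _ _) _.
  rewrite /C mulr_sumr big_seq [leRHS]big_seq; apply: ler_sum => m mms.
  by rewrite enormZ ler_wpM2r ?enorm_ge0// ma.
rewrite mulrC ler_pdivrMr//.
have : enorm v ^+ 2 <= (Num.sqrt a * C) ^+ 2.
  by rewrite lerXn2r ?nnegrE ?enorm_ge0 ?mulr_ge0 ?sqrtr_ge0.
rewrite exprMn (@sqr_sqrtr _ a (psdA v)) => /le_trans; apply.
by rewrite mulrDr mulr1 lerDl psdA.
Qed.

Lemma measurable_inv_enorm (R : realType) p : measurable_fun setT (fun z : 'cV[R]_p => (enorm z)^-1).
Proof.
rewrite (_ : (fun z => _) = fun z : 'cV[R]_p => enorm z `^ (-1)).
  exact: (measurableT_comp (measurable_powR (-1)) (@measurable_enorm R p)).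
by apply/funext => z; rewrite powR_inv1// enorm_ge0.
Qed.

(** The event is equality in the Cauchy-Schwarz inequality: for nonzero t, [Z w] lies on the line
    spanned by t. *)
Lemma measurable_parallel (R : realType) p d (T : measurableType d) (Z : T -> 'cV[R]_p) t :
  measurable_fun setT Z ->
  measurable [set w | dotv t t * dotv (Z w) (Z w) = dotv (Z w) t ^+ 2].
Proof.
move=> mZ; set L := mkset _.
have mh : measurable_fun setT (fun w => dotv t t * dotv (Z w) (Z w) - dotv (Z w) t ^+ 2).
  apply: measurable_funB; first by apply: measurable_funM => //; exact: measurable_fun_dotv.
  by apply: measurable_funX; exact: measurable_fun_dotv.
rewrite (_ : L = (fun w => dotv t t * dotv (Z w) (Z w) - dotv (Z w) t ^+ 2) @^-1` [set 0]).
  by rewrite -[X in measurable X]setTI; exact: mh.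
by apply/seteqP; split => w /= => [->|/eqP]; rewrite ?subrr// subr_eq0 => /eqP.
Qed.

(** * The origin, the reciprocal norm and lines under a bounded density *)

Section bounded_density.
Context (R : realType) (p : nat) (p1 : (1 < p)%N).
Context d (T : measurableType d) (P : probability T R).
Local Notation V := 'cV[R]_p.
Context (Z : T -> V) (mZ : measurable_fun setT Z) (M : R) (M0 : 0 <= M).
Context (leZ : forall B, measurable B -> (P (Z @^-1` B) <= M%:E * @lebesgue_cV R p B)%E).

Let mpre (B : set V) : measurable B -> measurable (Z @^-1` B).
Proof. by move=> mB; rewrite -[X in measurable X]setTI; exact: mZ. Qed.

Let mbox (c : V) (r : R) : measurable [set z : V | forall i, `|z i 0 - c i 0| <= r].
Proof.
have -> : [set z : V | forall i, `|z i 0 - c i 0| <= r] =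
    \bigcap_(i in [set: 'I_p]) (fun z : V => z i 0) @^-1` `[c i 0 - r, c i 0 + r]%classic.
  apply/seteqP; split => z /= H i; first by move=> _ /=; rewrite in_itv/= -ler_distl.
  by have := H i I; rewrite /= in_itv/= -ler_distl.
apply: fin_bigcap_measurable => // i _.
by rewrite -[X in measurable X]setTI; exact: measurable_coord.
Qed.

Lemma box_probability_le (c : V) (r : R) : 0 <= r ->
  (P [set w | forall i, (`|Z w i 0 - c i 0| <= r)%R] <= (M * (2 * r) ^+ p)%:E)%E.
Proof.
move=> r0; apply: le_trans (leZ (mbox c r)) _.
pose a : V := \col_i (c i 0 - r); pose b : V := \col_i (c i 0 + r).
have ab i : a i 0 <= b i 0 by rewrite !mxE; lra.
rewrite (_ : [set z : V | forall i, `|z i 0 - c i 0| <= r] =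
    [set v | forall i, a i 0 <= v i 0 <= b i 0]); last first.
  by apply/seteqP; split => z /= H i; have := H i; rewrite !mxE ler_distl.
rewrite lebesgue_cV_box// -EFinM lee_fin ler_wpM2l//.
rewrite (eq_bigr (fun=> 2 * r)); last by move=> i _; rewrite !mxE; ring.
by rewrite prodr_const card_ord.
Qed.

Lemma null_origin : P [set w | Z w = 0] = 0%E.
Proof.
have m0 : measurable [set w | Z w = 0].
  rewrite (_ : mkset _ = Z @^-1` (@enorm R p @^-1` [set 0])).
    by apply: mpre; rewrite -[X in measurable X]setTI; exact: measurable_enorm.
  by apply/seteqP; split => w /= => [->|/eqP]; [exact: enorm0|rewrite enorm_eq0 => /eqP].
apply/eqP; rewrite eq_le measure_ge0 andbT; apply/lee_addgt0Pr => e e0; rewrite add0e.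
(* With r <= 1/2 the power p of the side 2r is at most 2r itself. *)
pose r := Num.min (e / (2 * (M + 1))) 2^-1.
have M1 : 0 < 2 * (M + 1) by rewrite mulr_gt0// ltr_wpDl.
have r0 : 0 < r by rewrite lt_min invr_gt0 ltr0n andbT divr_gt0.
have r1 : r <= 2^-1 by rewrite ge_min lexx orbT.
have re : r * (2 * (M + 1)) <= e by rewrite -ler_pdivlMr// ge_min lexx.
apply: le_trans (le_trans _ (box_probability_le 0 (ltW r0))) _.
  apply: le_measure; rewrite ?inE//; first exact: mpre (mbox 0 r).
  by move=> w /= -> i; rewrite subrr normr0 ltW.
rewrite lee_fin.
have rp : (2 * r) ^+ p <= 2 * r.
  have [a0 a1] : 0 <= 2 * r /\ 2 * r <= 1 by split; lra.
  by rewrite -(prednK (ltnW p1)) exprS ler_piMr// exprn_ile1.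
apply: le_trans (ler_wpM2l M0 rp) _; move: re (ltW r0); rewrite mulrDr mulr1; lra.
Qed.

(** Raising the truncation level from 2^n to 2^(n+1) costs at most 2^n on the event |Z| <= 2^-n,
    whose probability is O(4^-n) because p >= 2. The costs form a convergent geometric series, and
    monotone convergence removes the truncation. *)
Lemma integrable_inv_enorm : P.-integrable setT (EFin \o (fun w => (enorm (Z w))^-1)).
Proof.
pose x w := (enorm (Z w))^-1.
have x0 w : 0 <= x w by rewrite invr_ge0 enorm_ge0.
have men : measurable_fun setT (fun w => enorm (Z w)).
  exact: measurableT_comp (@measurable_enorm R p) mZ.
have mx : measurable_fun setT x by exact: measurableT_comp (@measurable_inv_enorm R p) mZ.
pose g (n : nat) w := Num.min (x w) (2 ^+ n).
have mg n : measurable_fun setT (g n) by exact: measurable_minr.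
have g0 n w : 0 <= g n w by rewrite le_min x0 exprn_ge0.
have small k : (P [set w | (enorm (Z w) <= (2 ^+ k)^-1)%R] <= (M * 2 ^+ p * (2 ^+ k)^-1 ^+ 2)%:E)%E.
  have k0 : 0 <= (2 ^+ k)^-1 :> R by rewrite invr_ge0 exprn_ge0.
  apply: le_trans (le_trans _ (box_probability_le 0 k0)) _.
    apply: le_measure; rewrite ?inE//; last 2 first.
    - exact: mpre (mbox 0 _).
    - by move=> w /= H i; rewrite mxE subr0; apply: le_trans (coord_le_enorm _ _) H.
    rewrite (_ : mkset _ = (fun w => enorm (Z w)) @^-1` `]-oo, (2 ^+ k)^-1]%classic).
      by rewrite -[X in measurable X]setTI; exact: men.
    by apply/seteqP; split => w /=; rewrite in_itv.
  rewrite lee_fin exprMn mulrA ler_wpM2l ?mulr_ge0 ?exprn_ge0//.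
  rewrite ler_wiXn2l// invf_le1 ?exprn_gt0//; apply: exprn_ege1; lra.
have step n w : g n.+1 w <= g n w + 2 ^+ n * \1_[set w | (enorm (Z w) <= (2 ^+ n)^-1)%R] w.
  have n0 : 0 < 2 ^+ n :> R by rewrite exprn_gt0.
  rewrite /g; have [xn|xn] := ltP (x w) (2 ^+ n).
    apply: (@le_trans _ _ (x w)); first by rewrite ge_min lexx.
    by rewrite lerDl mulr_ge0// ltW.
  rewrite indicE mem_set/= ?mulr1; last first.
    have e0 : 0 < enorm (Z w).
      rewrite -invr_gt0; exact: lt_le_trans xn.
    by rewrite -[leLHS]invrK lef_pV2 ?posrE ?invr_gt0.
  by rewrite ge_min exprS; apply/orP; right; lra.
have mind k : measurable [set w | (enorm (Z w) <= (2 ^+ k)^-1)%R].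
  rewrite (_ : mkset _ = (fun w => enorm (Z w)) @^-1` `]-oo, (2 ^+ k)^-1]%classic).
    by rewrite -[X in measurable X]setTI; exact: men.
  by apply/seteqP; split => w /=; rewrite in_itv.
pose K := 1 + 2 * (M * 2 ^+ p).
have Mp0 : 0 <= M * 2 ^+ p by rewrite mulr_ge0// exprn_ge0.
(* Closed form of the partial geometric sums, with which the induction step is exact. *)
have bound n : (\int[P]_w (g n w)%:E <= (1 + M * 2 ^+ p * (2 - 2 * (2 ^+ n)^-1))%:E)%E.
  elim: n => [|n IH].
    rewrite expr0 invr1 mulr1 subrr mulr0 addr0.
    apply: (@le_trans _ _ (\int[P]_w 1%:E)%E); last first.
      by rewrite integral_cst// [X in (_ * X)%E]probability_setT mule1.
    apply: ge0_le_integral => //; first by move=> w _; rewrite lee_fin.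
      exact/measurable_EFinP.
    by move=> w _; rewrite lee_fin /g expr0 ge_min lexx orbT.
  pose S := [set w | (enorm (Z w) <= (2 ^+ n)^-1)%R].
  have mS : measurable_fun setT (fun w => (2 ^+ n * \1_S w)%:E : \bar R).
    by apply/measurable_EFinP; apply: measurable_funM; [exact: measurable_cst|exact: measurable_indic (mind n)].
  apply: (@le_trans _ _ (\int[P]_w ((g n w)%:E + (2 ^+ n * \1_S w)%:E)))%E.
    apply: ge0_le_integral => //.
    - by move=> w _; rewrite lee_fin.
    - exact/measurable_EFinP.
    - by apply: emeasurable_funD => //; exact/measurable_EFinP.
    - by move=> w _; rewrite -EFinD lee_fin.
  have -> : (\int[P]_w ((g n w)%:E + (2 ^+ n * \1_S w)%:E) =
      \int[P]_w (g n w)%:E + \int[P]_w (2 ^+ n * \1_S w)%:E)%E.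
    apply: ge0_integralD => //; first by move=> w _; rewrite lee_fin.
    exact/measurable_EFinP.
  have -> : (\int[P]_w (2 ^+ n * \1_S w)%:E = (2 ^+ n)%:E * P S)%E.
    rewrite -[S in P S]setIT -(integral_indic P measurableT (mind n)).
    under [LHS]eq_integral do rewrite EFinM.
    apply: ge0_integralZl => //.
    by apply/measurable_EFinP; exact: measurable_indic (mind n).
  apply: le_trans (leeD IH (lee_wpmul2l _ (small n))) _; first by rewrite lee_fin exprn_ge0.
  rewrite -EFinM -EFinD lee_fin (exprS 2 n).
  have n0 : 2 ^+ n != 0 :> R by rewrite expf_neq0.
  rewrite le_eqVlt; apply/orP; left; apply/eqP.
  by move: (2 ^+ n) n0 (M * 2 ^+ p) => a a0 b; field; rewrite a0.
apply/integrableP; split; first exact/measurable_EFinP.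
rewrite (eq_integral (fun w => (x w)%:E)); last by move=> w _ /=; rewrite (ger0_norm (x0 w)).
have lim : (\int[P]_w (g n w)%:E @[n --> \oo] --> \int[P]_w (x w)%:E)%E.
  have -> : (\int[P]_w (x w)%:E = \int[P]_w (limn (fun n => (g n w)%:E)))%E.
    apply: eq_integral => w _; apply/esym/cvg_lim => //; apply: cvg_near_cst.
    (* Since 0^-1 = 0, [x w] is a real number even at the origin, and the truncation eventually does
       nothing. *)
    have [N _ HN] : \forall n \near \oo, x w <= 2 ^+ n.
      exists (Num.truncn (x w)).+1 => // n /= Nn.
      have /andP[_ xN] := truncn_itv (x0 w).
      apply: (le_trans (ltW xN)); apply: (@le_trans _ _ n%:R); first by rewrite ler_nat.
      by rewrite -natrX ler_nat ltnW// ltn_expl.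
    by exists N => // n /= /HN xn; rewrite /g (min_idPl xn).
  apply: cvg_monotone_convergence => //.
  - by move=> n; exact/measurable_EFinP.
  - by move=> n w _; rewrite lee_fin.
  - move=> w _ m n mn; rewrite lee_fin /g le_min ge_min lexx/= ge_min.
    by apply/orP; right; rewrite ler_eXn2l// ltr1n.
apply: (@le_lt_trans _ _ K%:E); last exact: ltry.
rewrite -(cvg_lim _ lim)//; apply: lime_le; first by apply/cvg_ex; eexists; exact: lim.
apply: nearW => n; apply: le_trans (bound n) _; rewrite lee_fin /K.
have : 0 <= (2 ^+ n)^-1 :> R by rewrite invr_ge0 exprn_ge0.
by nra.
Qed.

(** Inside a ball the line is covered by O(N) boxes of side O(1/N), each of probability O(N^-2)
    because p >= 2, so this part is null; the outside of the ball has probability at most 1/2. *)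
Lemma line_probability_lt1 (t : V) : t != 0 ->
  (P [set w | (dotv t t * dotv (Z w) (Z w) = dotv (Z w) t ^+ 2)%R] < 1)%E.
Proof.
move=> t0.
have tt0 : 0 < dotv t t by rewrite -sqr_enorm exprn_gt0// enorm_gt0.
set L := mkset _.
have mL : measurable L by exact: measurable_parallel.
have [K0 tail] := enorm_tail_cvg0 (distribution P (mfun_of mZ)) (ltac:(lra) : 0 < 2^-1 :> R).
pose K := `|K0| + 1; have K1 : 0 < K by rewrite ltr_wpDl.
have men : measurable_fun setT (fun w => enorm (Z w)).
  exact: measurableT_comp (@measurable_enorm R p) mZ.
pose Bd := [set w | (enorm (Z w) <= K)%R].
have mBd : measurable Bd.
  rewrite (_ : Bd = (fun w => enorm (Z w)) @^-1` `]-oo, K]%classic).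
    by rewrite -[X in measurable X]setTI; exact: men.
  by apply/seteqP; split => w /=; rewrite in_itv.
have PBdC : (P (~` Bd) <= (2^-1)%:E)%E.
  apply: le_trans tail; rewrite /distribution /pushforward.
  apply: le_measure; rewrite ?inE; first exact: measurableC.
    rewrite (_ : _ @^-1` _ = (fun w => enorm (Z w)) @^-1` `]K0, +oo[%classic).
      by rewrite -[X in measurable X]setTI; exact: men.
    by apply/seteqP; split => w /=; rewrite in_itv/= andbT.
  move=> w /= /negP; rewrite -ltNge; apply: le_lt_trans.
  by rewrite /K (le_trans (ler_norm _))// lerDl.
have PLBd : P (L `&` Bd) = 0%E.
  apply/eqP; rewrite eq_le measure_ge0 andbT; apply/lee_addgt0Pr => e e0; rewrite add0e.
  pose et := enorm t; have et0 : 0 < et by rewrite enorm_gt0.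
  (* [N.+1] boxes of half-side [r] cover the segment. *)
  have [N N0 HN] : exists2 N : nat, (0 < N)%N & M * (4 * K) ^+ 2 * 2 <= e * N%:R /\ 4 * K <= N%:R.
    pose b := Num.max (M * (4 * K) ^+ 2 * 2 / e) (4 * K).
    have b0 : 0 <= b by rewrite le_max; apply/orP; right; lra.
    have /andP[_ bN] := truncn_itv b0.
    exists (Num.truncn b).+1 => //; split.
      by rewrite [leRHS]mulrC -ler_pdivrMr//; apply: le_trans (ltW bN); rewrite le_max lexx.
    by apply: le_trans (ltW bN); rewrite le_max lexx orbT.
  have Npos : 0 < N%:R :> R by rewrite ltr0n.
  pose r := 2 * K / N%:R; have r0 : 0 < r by rewrite divr_gt0// mulr_gt0.
  (* Equally spaced centres on the segment of the points lam t / |t| with |lam| <= K. *)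
  pose c (j : nat) : V := ((- K + 2 * K * j%:R / N%:R) / et) *: t.
  pose box j := [set w | forall i, `|Z w i 0 - c j i 0| <= r].
  have mboxj j : measurable (box j) by exact: mpre (mbox (c j) r).
  have cover : L `&` Bd `<=` \big[setU/set0]_(j < N.+1) box j.
    move=> w [Lw Bw]; set lam := dotv (Z w) t / et.
    have etE : et ^+ 2 = dotv t t by rewrite sqr_enorm.
    (* Equality in Cauchy-Schwarz means that [Z w] is its own projection on t. *)
    have zE : Z w = (lam / et) *: t.
      apply/eqP; rewrite -subr_eq0 -enorm_eq0 -sqrf_eq0 sqr_enorm.
      rewrite !(dotvBl, dotvBr, dotvZl, dotvZr) (dotvC t (Z w)).
      have -> : lam / et = dotv (Z w) t / dotv t t.
        by rewrite /lam -etE; field; rewrite gt_eqF.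
      apply/eqP; move: Lw; rewrite /L/= => Lw.
      have -> : dotv (Z w) (Z w) = dotv (Z w) t ^+ 2 / dotv t t.
        by rewrite -Lw mulrC mulKf// gt_eqF.
      by field; rewrite gt_eqF.
    have lamK : `|lam| <= K.
      apply: le_trans Bw; rewrite /lam normrM normfV (gtr0_norm et0) ler_pdivrMr//.
      exact: dotv_le_enorm.
    move: lamK; rewrite ler_norml => /andP[l1 l2].
    have q0 : 0 <= (lam + K) * N%:R / (2 * K).
      by rewrite divr_ge0 ?mulr_ge0//; lra.
    pose j := Num.truncn ((lam + K) * N%:R / (2 * K)).
    have jN : (j < N.+1)%N.
      rewrite ltnS -(ler_nat R); have /andP[+ _] := truncn_itv q0.
      move/le_trans; apply; rewrite ler_pdivrMr ?mulr_gt0// mulrC ler_pM2l//; lra.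
    rewrite -bigcup_mkord; exists j => //= i.
    have /andP[j1 j2] := truncn_itv q0; rewrite -/j in j1 j2.
    rewrite zE !mxE -mulrBl normrM.
    have ti : `|t i 0| <= et by exact: coord_le_enorm.
    have lj : `|lam / et - (- K + 2 * K * j%:R / N%:R) / et| <= r / et.
      rewrite -mulrBl normrM (@ger0_norm _ et^-1) ?invr_ge0 ?(ltW et0)// ler_pM2r ?invr_gt0//.
      move: j1 j2; rewrite ler_pdivlMr ?mulr_gt0// ltr_pdivrMr ?mulr_gt0// -natr1 => j1 j2.
      have -> : lam - (- K + 2 * K * j%:R / N%:R) = ((lam + K) * N%:R - j%:R * (2 * K)) / N%:R.
        by field; rewrite gt_eqF.
      rewrite /r normrM (@ger0_norm _ N%:R^-1)// ler_pM2r ?invr_gt0// ler_norml.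
      by apply/andP; split; lra.
    apply: le_trans (ler_pM _ _ lj ti) _ => //.
    by rewrite divfK// gt_eqF.
  have mcov : measurable (\big[setU/set0]_(j < N.+1) box j) by exact: bigsetU_measurable.
  apply: (@le_trans _ _ (P (\big[setU/set0]_(j < N.+1) box j))).
    by apply: le_measure => //; rewrite inE//; exact: measurableI.
  apply: (@le_trans _ _ (\sum_(j < N.+1) P (box j))%E); first exact: Boole_inequality.
  apply: (@le_trans _ _ (\sum_(j < N.+1) (M * (2 * r) ^+ 2)%:E)%E).
    apply: lee_sum => j _; apply: le_trans (box_probability_le (c j) (ltW r0)) _.
    rewrite lee_fin ler_wpM2l// ler_wiXn2l//; first by rewrite mulr_ge0// ltW.
    by rewrite /r mulrA ler_pdivrMr// mul1r; case: HN; lra.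
  rewrite sumEFin lee_fin sumr_const card_ord -[leLHS]mulr_natr.
  case: HN => HN _.
  have -> : M * (2 * r) ^+ 2 * N.+1%:R = M * (4 * K) ^+ 2 * (N%:R + 1) / N%:R ^+ 2.
    by rewrite /r -natr1; field; rewrite gt_eqF.
  rewrite ler_pdivrMr ?exprn_gt0//.
  have N1 : 1 <= N%:R :> R by rewrite ler1n.
  have MK : 0 <= M * (4 * K) ^+ 2 by rewrite mulr_ge0// sqr_ge0.
  move: HN MK N1 Npos; move: (M * (4 * K) ^+ 2) (N%:R : R) => a n HN MK N1 Npos.
  by nra.
apply: (@le_lt_trans _ _ (P (L `&` Bd) + P (~` Bd))%E).
  apply: le_trans (measureU2 _ _ _); [|exact: measurableI|exact: measurableC].
  apply: le_measure; rewrite ?inE//.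
    by apply: measurableU; [exact: measurableI|exact: measurableC].
  by move=> w Lw; have [Bw|Bw] := pselect (Bd w); [left|right].
rewrite PLBd add0e; apply: le_lt_trans PBdC _; rewrite lte_fin; lra.
Qed.

End bounded_density.

(** * Second-order expansion of the norm *)

Lemma cvg_inv_sqrt_natr (R : realType) :
  (Num.sqrt n%:R)^-1 @[n --> \oo] --> (0 : R).
Proof.
apply/cvgr0Pnorm_lt => e e0; have q0 : 0 <= e ^- 2 by rewrite invr_ge0 sqr_ge0.
exists (Num.truncn (e ^- 2)).+1 => // n /= Nn.
have /andP[_ eN] := truncn_itv q0.
have en : e ^- 2 < n%:R by apply: lt_le_trans eN _; rewrite ler_nat.
have n0 : 0 < n%:R :> R by exact: le_lt_trans en.
rewrite ger0_norm ?invr_ge0 ?sqrtr_ge0// -[ltRHS]invrK ltf_pV2 ?posrE ?invr_gt0 ?sqrtr_gt0//.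
by rewrite -(ger0_norm (ltW e0)) -sqrtr_sqr -sqrtrV ?sqr_ge0// ltr_sqrt.
Qed.

Section norm_taylor.
Context (R : realType) (p : nat).
Local Notation V := 'cV[R]_p.
Implicit Types z m t : V.

(* With [0^-1 = 0] this is the spatial sign, which vanishes at the origin. *)
Definition spatial_sign z : V := (enorm z)^-1 *: z.

(** Remainder of the first-order expansion of the norm at [z] for the displacement [- m]; the
    gradient is [spatial_sign z]. *)
Definition norm_rem z m : R := enorm (z - m) - enorm z + dotv (spatial_sign z) m.

(** The Hessian of the norm; with 0^-1 = 0 it is the zero matrix at the origin. *)
Definition norm_hess z : 'M[R]_p :=
  (enorm z)^-1 *: (1%:M - (enorm z) ^- 2 *: (z *m z^T)).

Lemma enorm_spatial_sign z : enorm (spatial_sign z) <= 1.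
Proof.
rewrite /spatial_sign enormZ ger0_norm ?invr_ge0 ?enorm_ge0//.
have [->|z0] := eqVneq (enorm z) 0; first by rewrite mulr0.
by rewrite mulVf.
Qed.

Lemma spatial_sign_coord z i : `|spatial_sign z i 0| <= 1.
Proof. exact: le_trans (coord_le_enorm _ _) (enorm_spatial_sign z). Qed.

Lemma dotv_spatial_sign z m : dotv (spatial_sign z) m = dotv z m / enorm z.
Proof. by rewrite /spatial_sign dotvZl mulrC. Qed.

Lemma enorm_subl z m : `|enorm (z - m) - enorm z| <= enorm m.
Proof. by apply: le_trans (enorm_dist _ _) _; rewrite addrC addKr enormN. Qed.

Lemma norm_rem_le z m : `|norm_rem z m| <= 2 * enorm m.
Proof.
apply: le_trans (ler_normD _ _) _; rewrite mulr_natl mulr2n lerD ?enorm_subl//.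
apply: le_trans (dotv_le_enorm _ _) _.
by rewrite ler_piMl ?enorm_ge0 ?enorm_spatial_sign.
Qed.

(** Rationalized form, from b^2 - a^2 = |m|^2 - 2 z . m. It divides by a and a + b only, so it holds
    even for m = z, and it serves both the quadratic bound and the limit. *)
Lemma norm_remE z m : z != 0 -> let a := enorm z in let b := enorm (z - m) in
  norm_rem z m = (a * enorm m ^+ 2 + dotv z m * (b - a)) / (a * (a + b)) /\
  b - a = (enorm m ^+ 2 - 2 * dotv z m) / (a + b).
Proof.
move=> z0 a b.
have a0 : 0 < a by rewrite enorm_gt0.
have b0 : 0 <= b by exact: enorm_ge0.
have bE : b ^+ 2 = a ^+ 2 - 2 * dotv z m + enorm m ^+ 2.
  by rewrite !sqr_enorm !(dotvBl, dotvBr) (dotvC m z); ring.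
have ab : a + b != 0 by rewrite gt_eqF// ltr_wpDr.
have dE : b - a = (enorm m ^+ 2 - 2 * dotv z m) / (a + b).
  by apply: (mulIf ab); rewrite divfK//; ring: bE.
split => //; rewrite /norm_rem dotv_spatial_sign -/a -/b.
have an0 : a != 0 by rewrite gt_eqF.
have ab0 : a * (a + b) != 0 by rewrite mulf_neq0.
apply: (mulIf ab0); rewrite divfK// mulrDl.
have -> : dotv z m / a * (a * (a + b)) = dotv z m * (a + b) by field.
ring: bE.
Qed.

(** The displacement need not be small compared with z: the only singularity of the bound is |z|^-1,
    which is integrable. *)
Lemma norm_rem_sqr_le z m : z != 0 ->
  `|norm_rem z m| <= 2 * enorm m ^+ 2 * (enorm z)^-1.
Proof.
move=> z0; have [-> _] := norm_remE m z0.
have a0 : 0 < enorm z by rewrite enorm_gt0.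
have b0 := enorm_ge0 (z - m).
have ab : 0 < enorm z + enorm (z - m) by rewrite ltr_wpDr.
rewrite normrM normfV (@ger0_norm _ (_ * (_ + _))) ?mulr_ge0 ?(ltW a0) ?(ltW ab)//.
rewrite ler_pdivrMr ?mulr_gt0//.
rewrite (mulrA _ (enorm z)) divfK ?gt_eqF//.
apply: (@le_trans _ _ (2 * enorm m ^+ 2 * enorm z)); last first.
  by rewrite ler_wpM2l ?lerDl// mulr_ge0// sqr_ge0.
apply: le_trans (ler_normD _ _) _.
rewrite ger0_norm ?mulr_ge0 ?sqr_ge0 ?enorm_ge0// normrM.
have : `|dotv z m| * `|enorm (z - m) - enorm z| <= (enorm z * enorm m) * enorm m.
  by apply: ler_pM => //; [exact: dotv_le_enorm|exact: enorm_subl].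
by lra.
Qed.

Lemma dotv_norm_hess z t :
  dotv t (norm_hess z *m t) = (enorm z)^-1 * (dotv t t - (enorm z) ^- 2 * dotv z t ^+ 2).
Proof.
rewrite -scalemxAl mulmxBl mul1mx -scalemxAl -mulmxA.
by rewrite [z^T *m t]mx11_scalar mul_mx_scalar dotv_tr !(dotvZr, dotvBr) (dotvC t z) expr2.
Qed.

Lemma norm_hess_ge0 z t : 0 <= dotv t (norm_hess z *m t).
Proof.
rewrite dotv_norm_hess mulr_ge0 ?invr_ge0 ?enorm_ge0//.
have [->|z0] := eqVneq z 0; first by rewrite dotv0l expr0n mulr0 subr0 dotvv_ge0.
rewrite subr_ge0 [leLHS]mulrC ler_pdivrMr ?exprn_gt0 ?enorm_gt0//.
rewrite -sqr_enorm -exprMn [leRHS]exprMn mulrC -exprMn -real_normK ?num_real//.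
by rewrite lerXn2r ?nnegrE ?mulr_ge0 ?enorm_ge0// dotv_le_enorm.
Qed.

Lemma norm_hess_tr z : (norm_hess z)^T = norm_hess z.
Proof. by rewrite /norm_hess linearZ/= linearB/= tr_scalar_mx linearZ/= trmx_mul trmxK. Qed.

Lemma norm_hess_entry_le z i j : `|norm_hess z i j| <= 2 * (enorm z)^-1.
Proof.
have [->|z0] := eqVneq z 0.
  by rewrite /norm_hess enorm0 invr0 scale0r mxE normr0 mulr0.
have a0 : 0 < enorm z by rewrite enorm_gt0.
rewrite !mxE normrM (@ger0_norm _ (enorm z)^-1) ?invr_ge0 ?enorm_ge0// mulrC.
rewrite ler_wpM2r ?invr_ge0 ?enorm_ge0//; apply: le_trans (ler_normB _ _) _.
rewrite [leRHS]mulr2n lerD//; first by case: eqP; rewrite ?normr1 ?normr0.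
rewrite big_ord1 mxE normrM normfV (@ger0_norm _ (_ ^+ 2)) ?sqr_ge0// [leLHS]mulrC ler_pdivrMr ?exprn_gt0//.
by rewrite mul1r expr2 normrM ler_pM ?coord_le_enorm.
Qed.

Lemma cvg_norm_rem z t : z != 0 ->
  n%:R * norm_rem z ((Num.sqrt n%:R)^-1 *: t) @[n --> \oo] -->
  2^-1 * dotv t (norm_hess z *m t).
Proof.
move=> z0; set a := enorm z; have a0 : 0 < a by rewrite enorm_gt0.
pose e (n : nat) : R := (Num.sqrt n%:R)^-1.
pose b n := enorm (z - e n *: t); pose c := dotv z t.
have e0 : e n @[n --> \oo] --> 0.
  exact: cvg_inv_sqrt_natr.
have bl : b n @[n --> \oo] --> a.
  apply: (@squeeze_cvgr _ _ _ _ (fun n => a - e n * enorm t) (fun n => a + e n * enorm t)).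
  - near=> n; rewrite -ler_distl; apply: le_trans (enorm_subl _ _) _.
    by rewrite enormZ ger0_norm// invr_ge0 sqrtr_ge0.
  - rewrite -[X in _ --> X]subr0 -(mul0r (enorm t)).
    by apply: cvgB; [exact: cvg_cst|apply: cvgM => //; exact: cvg_cst].
  - rewrite -[X in _ --> X]addr0 -(mul0r (enorm t)).
    by apply: cvgD; [exact: cvg_cst|apply: cvgM => //; exact: cvg_cst].
(* The rationalized remainder times n, with the common factor (e n)^2 = 1 / n cancelled; it depends
   continuously on [e n] and [b n]. *)
pose f n := (a * enorm t ^+ 2 + c * ((e n * enorm t ^+ 2 - 2 * c) / (a + b n))) / (a * (a + b n)).
have fl : f n @[n --> \oo] --> 2^-1 * dotv t (norm_hess z *m t).
  have -> : 2^-1 * dotv t (norm_hess z *m t) =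
     (a * enorm t ^+ 2 + c * ((0 * enorm t ^+ 2 - 2 * c) / (a + a))) / (a * (a + a)).
    rewrite dotv_norm_hess -/a -/c sqr_enorm; field.
    by rewrite gt_eqF ?addr_gt0//= gt_eqF.
  have abl : (a + b n) @[n --> \oo] --> a + a by apply: cvgD => //; exact: cvg_cst.
  rewrite /f; apply: cvgM.
    apply: cvgD; first exact: cvg_cst.
    apply: cvgM; first exact: cvg_cst.
    apply: cvgM; last by apply: cvgV => //; rewrite gt_eqF// addr_gt0.
    apply: cvgB; last exact: cvg_cst.
    by apply: cvgM => //; exact: cvg_cst.
  apply: cvgV; first by rewrite gt_eqF// mulr_gt0// addr_gt0.
  by apply: cvgM => //; exact: cvg_cst.
apply: cvg_trans fl; apply: near_eq_cvg; exists 1%N => // n /= n0.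
rewrite /f -/(e n); have [-> ->] := norm_remE (e n *: t) z0.
rewrite -/(b n) -/a dotvZr -/c enormZ exprMn real_normK ?num_real//.
have n0' : 0 < n%:R :> R by rewrite ltr0n.
have -> : n%:R = (e n) ^- 2 :> R by rewrite /e exprVn invrK sqr_sqrtr// ltW.
have en0 : e n != 0 by rewrite /e invr_eq0 gt_eqF// sqrtr_gt0.
have ab : a + b n != 0 by rewrite gt_eqF// ltr_wpDr// enorm_ge0.
have an0 : a != 0 by rewrite gt_eqF.
by field; rewrite en0 ab an0.
Unshelve. all: by end_near. Qed.

End norm_taylor.

Section measurable_norm_taylor.
Context (R : realType) (p : nat).
Local Notation V := 'cV[R]_p.

Lemma measurable_spatial_sign : measurable_fun setT (@spatial_sign R p).
Proof.
by apply: measurable_funZ_cv => //; exact: measurable_inv_enorm.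
Qed.

Lemma bounded_measurable_spatial_sign i :
  bounded_measurable (fun z : V => spatial_sign z i 0).
Proof.
split; last by exists 1 => z; exact: spatial_sign_coord.
exact: measurableT_comp (measurable_coord i) measurable_spatial_sign.
Qed.

Lemma bounded_measurable_dotv_sign t :
  bounded_measurable (fun z : V => dotv (spatial_sign z) t).
Proof.
rewrite /dotv; apply: bounded_measurable_sum => i.
by apply: bounded_measurableM; [exact: bounded_measurable_spatial_sign|exact: bounded_measurable_cst].
Qed.

Lemma bounded_measurable_norm_rem (m : V) :
  bounded_measurable (fun z : V => norm_rem z m).
Proof.
split; last by exists (2 * enorm m) => z; exact: norm_rem_le.
apply: measurable_funD; last by have [] := bounded_measurable_dotv_sign m.
apply: measurable_funB; last exact: measurable_enorm.
apply: (measurableT_comp (@measurable_enorm R p)).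
by apply: measurable_funB_cv => //; exact: measurable_cst.
Qed.

Lemma measurable_norm_hess i j : measurable_fun setT (fun z : V => norm_hess z i j).
Proof.
rewrite (_ : (fun _ => _) = fun z : V => (enorm z)^-1 *
    ((i == j)%:R - spatial_sign z i 0 * spatial_sign z j 0)); last first.
  apply/funext => z; rewrite /spatial_sign !mxE big_ord1 !mxE; congr (_ * (_ - _)).
  by rewrite mulrACA -invfM -expr2.
apply: measurable_funM; first exact: measurable_inv_enorm.
apply: measurable_funB; first exact: measurable_cst.
by apply: measurable_funM; [have [] := bounded_measurable_spatial_sign i|
  have [] := bounded_measurable_spatial_sign j].
Qed.

End measurable_norm_taylor.

(** * Expectations in the expansion of the norm *)

Section expected_norm_taylor.
Context (R : realType) (p : nat) d (T : measurableType d) (P : probability T R).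
Local Notation V := 'cV[R]_p.
Context (Z : T -> V) (mZ : measurable_fun setT Z).
Hypothesis null_Z : P [set w | Z w = 0] = 0%E.
Hypothesis int_inv : P.-integrable setT (EFin \o (fun w => (enorm (Z w))^-1)).

Let c : R := \int[P]_w (enorm (Z w))^-1.

Let c0 : 0 <= c.
Proof. by apply: Rintegral_ge0 => w _; rewrite invr_ge0 enorm_ge0. Qed.

Let ae_neq0 : {ae P, forall w, Z w != 0}.
Proof.
exists [set w | Z w = 0]; split => //; last by move=> w /negP; rewrite negbK => /eqP.
rewrite (_ : mkset _ = (fun w => enorm (Z w)) @^-1` [set 0]).
  rewrite -[X in measurable X]setTI.
  exact: (measurableT_comp (@measurable_enorm R p) mZ).
by apply/seteqP; split => w /= => [->|/eqP]; [exact: enorm0|rewrite enorm_eq0 => /eqP].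
Qed.

Let ir m : P.-integrable setT (EFin \o (fun w => norm_rem (Z w) m)).
Proof.
apply: bounded_measurable_integrable.
exact: (bounded_measurable_comp mZ (bounded_measurable_norm_rem m)).
Qed.

Let isg t : P.-integrable setT (EFin \o (fun w => dotv (spatial_sign (Z w)) t)).
Proof.
apply: bounded_measurable_integrable.
exact: (bounded_measurable_comp mZ (bounded_measurable_dotv_sign t)).
Qed.

Lemma expected_norm_rem_le m :
  \int[P]_w `|norm_rem (Z w) m| <= 2 * enorm m ^+ 2 * c.
Proof.
have mr : measurable_fun setT (fun w => norm_rem (Z w) m).
  by have [] := bounded_measurable_comp mZ (bounded_measurable_norm_rem m).
have ia : P.-integrable setT (EFin \o (fun w => `|norm_rem (Z w) m|)).
  apply: bounded_measurable_integrable; split; first exact: measurableT_comp.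
  by exists (2 * enorm m) => w; rewrite normr_id; exact: norm_rem_le.
have ib := integrableZl measurableT (2 * enorm m ^+ 2) int_inv.
rewrite -(RintegralZl (f := fun w => (enorm (Z w))^-1) (2 * enorm m ^+ 2) measurableT int_inv).
rewrite -lee_fin (EFin_Rintegral ia) (EFin_Rintegral ib).
have h1 w : setT w -> (0 <= (`|norm_rem (Z w) m|)%:E)%E by rewrite lee_fin.
have h2 w : setT w -> (0 <= (2 * enorm m ^+ 2 * (enorm (Z w))^-1)%:E)%E.
  by rewrite lee_fin !mulr_ge0 ?invr_ge0 ?enorm_ge0 ?sqr_ge0.
apply: (ae_ge0_le_integral measurableT h1 (measurable_int _ ia) h2 (measurable_int _ ib)).
apply: filterS ae_neq0 => w Zw0 _; rewrite lee_fin.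
exact: norm_rem_sqr_le.
Qed.

(** One factor is bounded by 2 |m| and only the other through |Z|^-1, because |Z|^-2 may fail to be
    integrable when p = 2. The power 3 of |m| still beats a factor n. *)
Lemma expected_norm_rem_sqr_le m :
  \int[P]_w norm_rem (Z w) m ^+ 2 <= 4 * enorm m ^+ 3 * c.
Proof.
have br := bounded_measurable_comp mZ (bounded_measurable_norm_rem m).
have ia : P.-integrable setT (EFin \o (fun w => `|norm_rem (Z w) m|)).
  apply: bounded_measurable_integrable; split; first exact: measurableT_comp br.1.
  by exists (2 * enorm m) => w; rewrite normr_id; exact: norm_rem_le.
apply: (@le_trans _ _ (2 * enorm m * \int[P]_w `|norm_rem (Z w) m|)); last first.
  apply: le_trans (ler_wpM2l _ (expected_norm_rem_le m)) _.
    by rewrite mulr_ge0 ?enorm_ge0.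
  by rewrite le_eqVlt; apply/orP; left; apply/eqP; ring.
rewrite -(RintegralZl (f := fun w => `|norm_rem (Z w) m|) (2 * enorm m) measurableT ia).
apply: le_Rintegral => //.
- exact: bounded_measurable_integrable (bounded_measurable_sqr br).
- exact: (integrableZl measurableT (2 * enorm m) ia).
move=> w _; rewrite -real_normK ?num_real// expr2 ler_wpM2r//.
exact: norm_rem_le.
Qed.

(** Minimality gives E s . m <= E [norm_rem], which is O(|m|^2). Scaling m to 0 yields E s . m <= 0,
    and -m yields the other inequality. *)
Lemma expected_spatial_sign0 t : is_spatial_median P Z 0 ->
  \int[P]_w dotv (spatial_sign (Z w)) t = 0.
Proof.
move=> med.
have obj m : \int[P]_w dotv (spatial_sign (Z w)) m <= \int[P]_w norm_rem (Z w) m.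
  rewrite -subr_ge0 -(RintegralB measurableT (ir m) (isg m)) -lee_fin.
  have ib := integrableB measurableT (ir m) (isg m).
  rewrite (EFin_Rintegral ib).
  have := med m; rewrite unlock.
  rewrite (eq_integral (fun=> 0%E)); last by move=> w _; rewrite subr0 subrr.
  rewrite integral0 => /le_trans; apply.
  rewrite le_eqVlt; apply/orP; left; apply/eqP; apply: eq_integral => w _.
  by rewrite /norm_rem/= addrK.
have sZ a m : \int[P]_w dotv (spatial_sign (Z w)) (a *: m) =
    a * \int[P]_w dotv (spatial_sign (Z w)) m.
  rewrite -(RintegralZl (f := fun w => dotv (spatial_sign (Z w)) m) a measurableT (isg m)).
  by apply: eq_Rintegral => w _; rewrite dotvZr.
have le0 m : \int[P]_w dotv (spatial_sign (Z w)) m <= 0.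
  apply/ler_addgt0Pl => e e0; rewrite addr0.
  have K0 : 0 < 2 * enorm m ^+ 2 * c + 1.
    by rewrite ltr_wpDl// mulr_ge0 ?c0// mulr_ge0 ?sqr_ge0.
  pose a := e / (2 * enorm m ^+ 2 * c + 1); have a0 : 0 < a by rewrite divr_gt0.
  rewrite -(ler_pM2l a0) -sZ; apply: le_trans (obj _) _.
  apply: (@le_trans _ _ (\int[P]_w `|norm_rem (Z w) (a *: m)|)).
    apply: le_trans (ler_norm _) _; exact: le_normr_Rintegral.
  apply: le_trans (expected_norm_rem_le _) _.
  rewrite enormZ (gtr0_norm a0) exprMn expr2.
  have -> : 2 * (a * a * enorm m ^+ 2) * c = a * (a * (2 * enorm m ^+ 2 * c)) by ring.
  rewrite ler_pM2l// /a mulrAC ler_pdivrMr// ler_pM2l// lerDl//.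
apply/eqP; rewrite eq_le le0/=.
have := le0 (- t); rewrite -scaleN1r sZ mulN1r oppr_le0; exact.
Qed.

Let A := expectation_mx P (fun w => norm_hess (Z w)).

Let iH i j : P.-integrable setT (EFin \o (fun w => norm_hess (Z w) i j)).
Proof.
apply: (le_integrable measurableT _ _ (integrableZl measurableT 2 int_inv)).
  by apply/measurable_EFinP; exact: (measurableT_comp (measurable_norm_hess i j) mZ).
move=> w _; rewrite /= lee_fin (ger0_norm (x := 2 * _)) ?norm_hess_entry_le//.
by rewrite mulr_ge0// invr_ge0 enorm_ge0.
Qed.

Lemma expected_norm_hess_tr : A^T = A.
Proof.
apply/matrixP => i j; rewrite !mxE; congr fine; rewrite unlock.
by apply: eq_integral => w _; rewrite -{1}norm_hess_tr mxE.
Qed.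

Let iHt t : P.-integrable setT (EFin \o (fun w => dotv t (norm_hess (Z w) *m t))).
Proof.
rewrite (_ : EFin \o _ = EFin \o (fun w => \sum_i \sum_j norm_hess (Z w) i j * (t i 0 * t j 0))).
  apply: integrable_Rsum => i; apply: integrable_Rsum => j.
  rewrite (_ : EFin \o _ = EFin \o (fun w => (t i 0 * t j 0) * norm_hess (Z w) i j)).
    exact: (integrableZl measurableT (t i 0 * t j 0) (iH i j)).
  by apply/funext => w /=; rewrite mulrC.
by apply/funext => w /=; rewrite dotv_mulmxE.
Qed.

Lemma dotv_expected_norm_hess t :
  dotv t (A *m t) = \int[P]_w dotv t (norm_hess (Z w) *m t).
Proof.
have ij i j : P.-integrable setT (EFin \o (fun w => norm_hess (Z w) i j * (t i 0 * t j 0))).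
  rewrite (_ : EFin \o _ = EFin \o (fun w => (t i 0 * t j 0) * norm_hess (Z w) i j)).
    exact: (integrableZl measurableT (t i 0 * t j 0) (iH i j)).
  by apply/funext => w /=; rewrite mulrC.
rewrite (eq_Rintegral _ _ (g := fun w => \sum_i \sum_j norm_hess (Z w) i j * (t i 0 * t j 0))); last first.
  by move=> w _; rewrite dotv_mulmxE.
rewrite Rintegral_sum; last by move=> i; apply: integrable_Rsum => j; exact: ij.
rewrite dotv_mulmxE; apply: eq_bigr => i _.
rewrite Rintegral_sum//; apply: eq_bigr => j _.
rewrite mxE unlock mulrC.
rewrite -(RintegralZl (f := fun w => norm_hess (Z w) i j) (t i 0 * t j 0) measurableT (iH i j)).
by apply: eq_Rintegral => w _; rewrite mulrC.
Qed.

(** If the integral vanished, so would its nonnegative integrand almost surely, and Z would lie on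
    the line of t with probability 1. *)
Lemma expected_norm_hess_gt0 t :
  (P [set w | (dotv t t * dotv (Z w) (Z w) = dotv (Z w) t ^+ 2)%R] < 1)%E ->
  0 < dotv t (A *m t).
Proof.
set L := mkset _ => PL.
rewrite dotv_expected_norm_hess lt_neqAle eq_sym andbC.
rewrite (Rintegral_ge0 _ (fun w _ => norm_hess_ge0 (Z w) t))/=.
apply/negP => /eqP H0; move: PL; apply/negP; rewrite -leNgt.
have : (\int[P]_w `|(dotv t (norm_hess (Z w) *m t))%:E| = 0)%E.
  transitivity ((\int[P]_w dotv t (norm_hess (Z w) *m t))%:E).
    rewrite (EFin_Rintegral (iHt t)); apply: eq_integral => w _.
    by rewrite /= ger0_norm ?norm_hess_ge0.
  by rewrite H0.
move/(ae_eq_integral_abs P measurableT (measurable_int _ (iHt t)))=> ae0.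
have aeL : {ae P, forall w, L w}.
  apply: filterS2 ae0 ae_neq0 => w /(_ I)/= [] h0 Zw0.
  move: h0; rewrite dotv_norm_hess => /eqP.
  rewrite mulf_eq0 invr_eq0 enorm_eq0 (negPf Zw0)/= subr_eq0 => /eqP h0.
  by rewrite /L/= h0 -sqr_enorm mulrAC mulVf ?mul1r// expf_neq0// enorm_eq0.
have mL : measurable L by exact: measurable_parallel.
have [N [mN N0 LN]] := aeL.
rewrite -(@probability_setT _ _ _ P).
apply: (@le_trans _ _ (P (L `|` N))).
  apply: le_measure; rewrite ?inE//; first exact: measurableU.
  by move=> w _; have [Lw|Lw] := pselect (L w); [left|right; exact: LN].
by apply: le_trans (measureU2 _ mL mN) _; rewrite [X in (_ + X)%E](N0 : P N = 0%E) adde0.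
Qed.

(** By [norm_rem_sqr_le] the rescaled remainders are dominated by 2 |t|^2 / |Z|, whatever n. *)
Lemma cvg_expected_norm_rem t :
  n%:R * \int[P]_w norm_rem (Z w) ((Num.sqrt n%:R)^-1 *: t) @[n --> \oo] -->
  2^-1 * dotv t (A *m t).
Proof.
pose f (n : nat) w := n%:R * norm_rem (Z w) ((Num.sqrt n%:R)^-1 *: t).
pose g w := 2 * enorm t ^+ 2 * (enorm (Z w))^-1.
pose l w := 2^-1 * dotv t (norm_hess (Z w) *m t).
have bf n : bounded_measurable (f n).
  apply: bounded_measurableM; first exact: bounded_measurable_cst.
  exact: (bounded_measurable_comp mZ (bounded_measurable_norm_rem _)).
have il := integrableZl measurableT 2^-1 (iHt t).
have [_ _] : [/\ P.-integrable setT (EFin \o l),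
    [sequence \int[P]_w `|(f n w)%:E - (l w)%:E|]_n @ \oo --> 0 &
    [sequence \int[P]_w (f n w)%:E]_n @ \oo --> \int[P]_w (l w)%:E]%E.
  apply: (@dominated_convergence _ _ _ P setT measurableT (fun n w => (f n w)%:E) (EFin \o l) (EFin \o g)).
  - by move=> n; apply/measurable_EFinP; exact: (bf n).1.
  - exact: measurable_int il.
  - apply: filterS ae_neq0 => w Zw0 _; apply: cvg_EFin; first exact: nearW.
    exact: cvg_norm_rem.
  - exact: (integrableZl measurableT (2 * enorm t ^+ 2) int_inv).
  - apply: filterS ae_neq0 => w Zw0 n _; rewrite /= lee_fin /f /g normrM ger0_norm//.
    case: n => [|n]; first by rewrite mul0r !mulr_ge0 ?invr_ge0 ?enorm_ge0 ?sqr_ge0.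
    apply: le_trans (ler_wpM2l _ (norm_rem_sqr_le _ Zw0)) _ => //.
    rewrite enormZ exprMn real_normK ?num_real// exprVn sqr_sqrtr//.
    rewrite le_eqVlt; apply/orP; left; apply/eqP.
    have n0 : n.+1%:R != 0 :> R by [].
    move: (enorm t ^+ 2) (enorm (Z w))^-1 => a b; move: (n.+1%:R : R) n0 => k k0.
    by field; rewrite k0.
rewrite /= -(EFin_Rintegral il) => h.
rewrite (_ : 2^-1 * _ = \int[P]_w l w); last first.
  rewrite dotv_expected_norm_hess.
  by rewrite -(RintegralZl (f := fun w => dotv t (norm_hess (Z w) *m t)) 2^-1 measurableT (iHt t)).
have -> : (fun n : nat => n%:R * \int[P]_w norm_rem (Z w) ((Num.sqrt n%:R)^-1 *: t)) =
    (fun n => \int[P]_w f n w).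
  apply/funext => n; rewrite -(RintegralZl (f := fun w => norm_rem (Z w) ((Num.sqrt n%:R)^-1 *: t)) n%:R measurableT (ir _)) //.
by apply: fine_cvg; exact: h.
Qed.

End expected_norm_taylor.

(** * The rescaled objective and its minimizer *)

Section pair_sums.
Context (R : realType).

(** Every index belongs to n - 1 increasing pairs. *)
Lemma sum_pairD n (a : 'I_n -> R) :
  \sum_(i < n) \sum_(j < n | (i < j)%N) (a i + a j) = (n%:R - 1) * \sum_(i < n) a i.
Proof.
under eq_bigr do rewrite big_split/=.
rewrite big_split/= [X in _ + X](exchange_big_dep predT)//= -big_split/= mulr_sumr.
apply: eq_bigr => i _; rewrite [X in X + _]big_mkcond [X in _ + X]big_mkcond -big_split/=.
rewrite (eq_bigr (fun j => if j \in predC1 i then a i else 0)); last first.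
  move=> j _; rewrite inE/= -(inj_eq val_inj)/=.
  by case: ltngtP; rewrite /= ?addr0 ?add0r.
rewrite -big_mkcond sumr_const cardC1 card_ord -[LHS]mulr_natl; case: n a i => [|n] a i; first by case: i.
by rewrite -[n.+1%:R]natr1 addrK.
Qed.

Lemma bin2_natr n : ('C(n, 2)%:R : R) = n%:R * (n%:R - 1) / 2.
Proof.
have E : ('C(n, 2) * 2 = n * n.-1)%N by have := bin_ffact n 2; rewrite ffactnS ffactn1.
apply: (mulIf (x := 2)) => //; rewrite divfK// -natrM E natrM.
by case: n {E} => [|n]; rewrite ?mul0r//= -natr1 addrK.
Qed.

Lemma sum_pair_cst n (c : R) :
  \sum_(i < n) \sum_(j < n | (i < j)%N) c = 'C(n, 2)%:R * c.
Proof.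
rewrite -[RHS]/(_ * c) bin2_natr {1}(splitr c) (sum_pairD (fun=> c / 2)).
by rewrite sumr_const card_ord -[X in _ * X]mulr_natl; field.
Qed.

(** The ratio is 2 / (n - 1), at most 4 / n from n = 2 on. *)
Lemma bin2_ratio_le n : (1 < n)%N -> (n%:R / 'C(n, 2)%:R) ^+ 2 <= 16 / n%:R ^+ 2 :> R.
Proof.
move=> n1; have n2 : 2 <= n%:R :> R by rewrite ler_nat.
rewrite bin2_natr; move: (n%:R : R) n2 => q q2.
have -> : q / (q * (q - 1) / 2) = 2 / (q - 1).
  by field; apply/andP; split; apply: lt0r_neq0; lra.
have q0 : 0 < q by lra.
have q1 : 0 < q - 1 by lra.
rewrite exprMn exprVn ler_pdivrMr ?exprn_gt0// mulrAC ler_pdivlMr ?exprn_gt0//.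
by nra.
Qed.

End pair_sums.

Section projections.
Context (R : realType) d (T : measurableType d) (P : probability T R).
Context d' (U : measurableType d') (F : probability U R).
Context (y : nat -> {RV P >-> U}).
Context (y_indep : mutually_independent P y).
Context (y_law : forall i B, measurable B -> distribution P (y i) B = F B).

(* [(n - 1) * \sum f] is the U-statistic with kernel [f v + f u]. *)
Lemma sum_variance_le (f : U -> R) : bounded_measurable f -> \int[F]_u f u = 0 ->
  exists2 C : R, 0 <= C & forall n, (1 < n)%N ->
    \int[P]_w (\sum_(i < n) f (y i w)) ^+ 2 <= C * n%:R.
Proof.
move=> bf f0.
pose k (x : U * U) := f x.1 + f x.2.
have bk : bounded_measurable k.
  apply: bounded_measurableD.
    exact: (bounded_measurable_comp measurable_fst bf).
  exact: (bounded_measurable_comp measurable_snd bf).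
pose C := \int[F]_v \int[F]_u k (v, u) ^+ 2.
have C0 : 0 <= C.
  by apply: Rintegral_ge0 => v _; apply: Rintegral_ge0 => u _; exact: sqr_ge0.
exists (16 * C) => [|n n1]; first by rewrite mulr_ge0.
have k0 : \int[F]_v \int[F]_u k (v, u) = 0.
  rewrite (eq_Rintegral _ _ (g := f)) => [//|v _].
  rewrite (RintegralD measurableT (bounded_measurable_integrable F (bounded_measurable_cst U (f v)))
    (bounded_measurable_integrable F bf)) /= f0 addr0.
  exact: Rintegral_cst1.
have := ustat_variance_le y_indep y_law bk n k0.
rewrite -/C.
rewrite (eq_Rintegral _ _ (g := fun w => (n%:R - 1) ^+ 2 * (\sum_(i < n) f (y i w)) ^+ 2)); last first.
  by move=> w _; rewrite -exprMn -(sum_pairD (fun i : 'I_n => f (y i w))).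
have bs : bounded_measurable (fun w => (\sum_(i < n) f (y i w)) ^+ 2).
  apply: bounded_measurable_sqr; apply: bounded_measurable_sum => i.
  exact: (bounded_measurable_comp (measurable_funP (y i)) bf).
rewrite (RintegralZl (f := fun w => (\sum_(i < n) f (y i w)) ^+ 2) _ measurableT
  (bounded_measurable_integrable P bs)).
have n2 : 2 <= n%:R :> R by rewrite ler_nat.
move: (\int[P]_w _) => I H.
have m0 : 0 < (n%:R - 1) ^+ 2 :> R by rewrite exprn_gt0//; lra.
rewrite -(ler_pM2l m0); apply: le_trans H _.
have -> : (n%:R - 1) ^+ 2 * (16 * C * n%:R) = 4 * (4 * (n%:R - 1) ^+ 2) * n%:R * C by ring.
have -> : 4 * n%:R ^+ 3 * C = 4 * (n%:R ^+ 2) * n%:R * C :> R by ring.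
rewrite ler_wpM2r// ler_wpM2r// ler_pM2l//.
have -> : 4 * (n%:R - 1) ^+ 2 = (2 * (n%:R - 1)) ^+ 2 :> R by ring.
by rewrite lerXn2r ?nnegrE//; lra.
Qed.

End projections.

Section variance.
Context d (T : measurableType d) (R : realType) (P : probability T R).
Context (f : T -> R) (bf : bounded_measurable f).

Lemma Rintegral_centered : \int[P]_w (f w - \int[P]_w f w) = 0.
Proof.
rewrite (RintegralB measurableT (bounded_measurable_integrable P bf)
  (bounded_measurable_integrable P (bounded_measurable_cst T _))) Rintegral_cst1.
exact: subrr.
Qed.

Lemma Rvariance_le : \int[P]_w (f w - \int[P]_w f w) ^+ 2 <= \int[P]_w f w ^+ 2.
Proof.
have [e eE] : exists e : R, \int[P]_w f w = e by eexists.
rewrite eE.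
have bq := bounded_measurable_sqr bf.
have bl := bounded_measurableM (bounded_measurable_cst T (2 * e)) bf.
have bc := bounded_measurable_cst T (e ^+ 2).
rewrite (eq_Rintegral _ _ (g := fun w => f w ^+ 2 - (2 * e) * f w + e ^+ 2)); last first.
  by move=> w _; ring.
have bi g : bounded_measurable g -> _ := @bounded_measurable_integrable _ _ _ P g.
rewrite (RintegralD measurableT (bi _ (bounded_measurableB bq bl)) (bi _ bc)).
rewrite [X in _ + X]Rintegral_cst1.
rewrite (RintegralB measurableT (bi _ bq) (bi _ bl)).
rewrite (RintegralZl (f := f) (2 * e) measurableT (bi _ bf)) eE.
have := sqr_ge0 e; lra.
Qed.

Lemma Rintegral_affine2 (g : T -> R) (a b c : R) : bounded_measurable g ->
  \int[P]_w (c + a * f w + b * g w) = c + a * \int[P]_w f w + b * \int[P]_w g w.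
Proof.
move=> bg.
have bi h : bounded_measurable h -> _ := @bounded_measurable_integrable _ _ _ P h.
have bc k := bounded_measurable_cst T (k : R).
have baf := bounded_measurableM (bc a) bf; have bbg := bounded_measurableM (bc b) bg.
rewrite (RintegralD measurableT (bi _ (bounded_measurableD (bc c) baf)) (bi _ bbg)).
rewrite (RintegralD measurableT (bi _ (bc c)) (bi _ baf)) Rintegral_cst1.
by rewrite (RintegralZl (f := f) a measurableT (bi _ bf)) (RintegralZl (f := g) b measurableT (bi _ bg)).
Qed.

Lemma Rintegral_sqr_le3 (g : T -> R) (a c : R) : bounded_measurable g ->
  \int[P]_w (a * (f w - g w) + c) ^+ 2 <=
  3 * a ^+ 2 * (\int[P]_w f w ^+ 2 + \int[P]_w g w ^+ 2) + 3 * c ^+ 2.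
Proof.
move=> bg.
have bi h : bounded_measurable h -> _ := @bounded_measurable_integrable _ _ _ P h.
have bc k := bounded_measurable_cst T (k : R).
have bf2 := bounded_measurable_sqr bf; have bg2 := bounded_measurable_sqr bg.
have bs := bounded_measurableD bf2 bg2.
have bM := bounded_measurableM (bc (3 * a ^+ 2)) bs.
apply: (@le_trans _ _ (\int[P]_w (3 * a ^+ 2 * (f w ^+ 2 + g w ^+ 2) + 3 * c ^+ 2))).
  apply: le_Rintegral => //.
  - apply: bi; apply: bounded_measurable_sqr; apply: bounded_measurableD => //.
    by apply: bounded_measurableM => //; exact: bounded_measurableB.
  - by apply: bi; exact: bounded_measurableD.
  move=> w _; move: (f w) (g w) => x z; rewrite -subr_ge0.
  have -> : 3 * a ^+ 2 * (x ^+ 2 + z ^+ 2) + 3 * c ^+ 2 - (a * (x - z) + c) ^+ 2 =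
    (a * x + a * z) ^+ 2 + (a * x - c) ^+ 2 + (a * z + c) ^+ 2 by ring.
  by rewrite !addr_ge0 ?sqr_ge0.
rewrite (RintegralD measurableT (bi _ bM) (bi _ (bc _))) Rintegral_cst1.
rewrite (RintegralZl (f := fun w => f w ^+ 2 + g w ^+ 2) _ measurableT (bi _ bs)).
by rewrite (RintegralD measurableT (bi _ bf2) (bi _ bg2)).
Qed.

End variance.

(** * Projection of the objective and its remainder *)

Section hajek_projection.
Context (R : realType) (p : nat).
Local Notation V := 'cV[R]_p.
Context d (T : measurableType d) (P : probability T R) (F : probability V R).
Context (y : nat -> {RV P >-> V}).
Context (y_indep : mutually_independent P y).
Context (y_law : forall i B, measurable B -> distribution P (y i) B = F B).

(** Conditional expectation of the sign of a Walsh average given one of its two observations. *)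
Definition hajek_sign (v : V) : V :=
  \col_i \int[F]_u spatial_sign (2^-1 *: (v + u)) i 0.

Let bmean (f : V -> R) : bounded_measurable f ->
  bounded_measurable (fun x : V * V => f (2^-1 *: (x.1 + x.2))).
Proof.
move=> bf; apply: (bounded_measurable_comp (g := fun x : V * V => 2^-1 *: (x.1 + x.2))) bf.
apply: measurable_funZ_cv; first exact: measurable_cst.
by apply: measurable_funD_cv; [exact: measurable_fst|exact: measurable_snd].
Qed.

Let by2 i j (f : V * V -> R) : bounded_measurable f ->
  bounded_measurable (fun w => f (y i w, y j w)).
Proof. by move=> bf; exact: bounded_kernel bf i j. Qed.

Lemma bounded_measurable_hajek_sign i : bounded_measurable (fun v => hajek_sign v i 0).
Proof.
have := bounded_measurable_fubini_F F F (bmean (bounded_measurable_spatial_sign R i)).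
by rewrite (_ : (fun v => hajek_sign v i 0) = fun v => \int[F]_u spatial_sign (2^-1 *: (v + u)) i 0)//;
  apply/funext => v; rewrite mxE.
Qed.

Lemma bounded_measurable_dotv_hajek t : bounded_measurable (fun v => dotv (hajek_sign v) t).
Proof.
rewrite /dotv; apply: bounded_measurable_sum => i.
apply: bounded_measurableM; first exact: bounded_measurable_hajek_sign.
exact: bounded_measurable_cst.
Qed.

Lemma Rintegral_dotv_sign v t :
  \int[F]_u dotv (spatial_sign (2^-1 *: (v + u))) t = dotv (hajek_sign v) t.
Proof.
have b i := bounded_measurable_snd (bmean (bounded_measurable_spatial_sign R i)) v.
rewrite /dotv Rintegral_sum; last first.
  move=> i; apply: bounded_measurable_integrable.
  by apply: bounded_measurableM; [exact: b|exact: bounded_measurable_cst].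
apply: eq_bigr => i _; rewrite mxE mulrC.
rewrite -(RintegralZl (f := fun u => spatial_sign (2^-1 *: (v + u)) i 0) (t i 0) measurableT
  (bounded_measurable_integrable F (b i))).
by apply: eq_Rintegral => u _; rewrite mulrC.
Qed.

Hypothesis mean_sign0 : forall t,
  \int[P]_w dotv (spatial_sign (2^-1 *: (y 0%N w + y 1%N w))) t = 0.

Lemma mean_dotv_hajek t : \int[F]_v dotv (hajek_sign v) t = 0.
Proof.
rewrite -(mean_sign0 t).
rewrite (Rintegral_law2 y_indep y_law (i := 0%N) (j := 1%N)
  (g := fun x : V * V => dotv (spatial_sign (2^-1 *: (x.1 + x.2))) t))//; last first.
  exact: bmean (bounded_measurable_dotv_sign t).
by apply: eq_Rintegral => v _; rewrite Rintegral_dotv_sign.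
Qed.

(** Given the shared observation [y 1], the two signs are independent; integrating out [y 2] and
    then [y 0] turns each of them into [hajek_sign]. *)
Lemma hajek_sign_moment i j :
  \int[F]_v (hajek_sign v i 0 * hajek_sign v j 0) =
  \int[P]_w (spatial_sign (2^-1 *: (y 0%N w + y 1%N w)) i 0 *
             spatial_sign (2^-1 *: (y 1%N w + y 2%N w)) j 0).
Proof.
have bs k := bmean (bounded_measurable_spatial_sign R k).
have bh k := bounded_measurable_hajek_sign k.
pose g1 (x : (V * V) * V) := spatial_sign (2^-1 *: (x.1.1 + x.1.2)) i 0 *
  spatial_sign (2^-1 *: (x.1.2 + x.2)) j 0.
have bg1 : bounded_measurable g1.
  apply: bounded_measurableM.
    exact: (bounded_measurable_comp measurable_fst (bs i)).
  apply: (bounded_measurable_comp (g := fun x : (V * V) * V => (x.1.2, x.2))) (bs j).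
  apply: measurable_fun_pair; last exact: measurable_snd.
  exact: measurableT_comp measurable_snd measurable_fst.
rewrite (independent_Rintegral y_indep y_law (a := 2%N)
  (Y := fun w => (y 0%N w, y 1%N w)) _ bg1); last first.
  by apply: measurable_fun_pair; apply: others_measurable_fun.
pose g2 (x : V * V) := spatial_sign (2^-1 *: (x.1 + x.2)) i 0 * hajek_sign x.1 j 0.
have bg2 : bounded_measurable g2.
  apply: bounded_measurableM; first exact: bs.
  exact: (bounded_measurable_comp measurable_fst (bh j)).
transitivity (\int[P]_w g2 (y 1%N w, y 0%N w)).
  rewrite (Rintegral_law2 y_indep y_law (i := 1%N) (j := 0%N) (g := g2))//.
  apply: eq_Rintegral => v _; rewrite /g2/= mulrC [X in _ * X = _]mxE.
  have b := bounded_measurable_snd (bs i) v.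
  rewrite -(RintegralZl (f := fun u => spatial_sign (2^-1 *: (v + u)) i 0) _ measurableT
    (bounded_measurable_integrable F b)).
  by apply: eq_Rintegral => u _; rewrite mulrC.
apply: eq_Rintegral => w _; rewrite /g2 /g1/= [X in _ * X = _]mxE.
have b := bounded_measurable_snd (bs j) (y 1%N w).
rewrite (addrC (y 1%N w) (y 0%N w)).
rewrite -(RintegralZl (f := fun u => spatial_sign (2^-1 *: (y 1%N w + u)) j 0) _ measurableT
    (bounded_measurable_integrable F b)).
by apply: eq_Rintegral.
Qed.

Let Z w : V := 2^-1 *: (y 0%N w + y 1%N w).

Definition hl_rem (A : 'M[R]_p) n t w : R :=
  n%:R * hl_objective (fun k => y k w) n ((Num.sqrt n%:R)^-1 *: t) +
  dotv ((2 / Num.sqrt n%:R) *: \sum_(i < n) hajek_sign (y i w)) t -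
  2^-1 * dotv t (A *m t).

(** This kernel is merely centred, but its variance is small; [sign_kernel] has a larger variance,
    but averages to 0 over either argument. Each gets its own variance bound. *)
Let rem_kernel m (x : V * V) : R :=
  norm_rem (2^-1 *: (x.1 + x.2)) m - \int[P]_w norm_rem (Z w) m.

Let sign_kernel t (x : V * V) : R := dotv (spatial_sign (2^-1 *: (x.1 + x.2))) t -
  (dotv (hajek_sign x.1) t + dotv (hajek_sign x.2) t).

Let bounded_rem_kernel m : bounded_measurable (rem_kernel m).
Proof.
apply: bounded_measurableB; first exact: bmean (bounded_measurable_norm_rem m).
exact: bounded_measurable_cst.
Qed.

Let bounded_sign_kernel t : bounded_measurable (sign_kernel t).
Proof.
have bh := bounded_measurable_dotv_hajek t.
apply: bounded_measurableB; first exact: bmean (bounded_measurable_dotv_sign t).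
apply: bounded_measurableD; first exact: (bounded_measurable_comp measurable_fst bh).
exact: (bounded_measurable_comp measurable_snd bh).
Qed.

(** Each summand of the objective is [norm_rem] minus a sign term. The projections subtracted in
    [sign_kernel] sum to (n - 1) h, which the factor n / C(n,2) turns into exactly the 2 h of the
    linear term. *)
Lemma hl_remE A n t w : (1 < n)%N -> let m := (Num.sqrt n%:R)^-1 *: t in
  hl_rem A n t w = n%:R / 'C(n, 2)%:R *
    (\sum_(i < n) \sum_(j < n | (i < j)%N) rem_kernel m (y i w, y j w) -
     \sum_(i < n) \sum_(j < n | (i < j)%N) sign_kernel m (y i w, y j w)) +
    (n%:R * \int[P]_w norm_rem (Z w) m - 2^-1 * dotv t (A *m t)).
Proof.
move=> n1 m; rewrite /hl_rem /hl_objective -/m.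
set S1 := (X in _ * (X - _) + _); set S2 := (X in _ * (S1 - X) + _).
pose h := \sum_(i < n) dotv (hajek_sign (y i w)) m.
have -> : \sum_(i < n) \sum_(j < n | (i < j)%N)
      (enorm (walsh (fun k => y k w) i j - m) - enorm (walsh (fun k => y k w) i j)) =
    S1 - S2 + 'C(n, 2)%:R * \int[P]_w norm_rem (Z w) m - (n%:R - 1) * h.
  rewrite -sum_pair_cst /h -(sum_pairD (fun i : 'I_n => dotv (hajek_sign (y i w)) m)).
  rewrite -!sumrB -big_split/= -sumrB; apply: eq_bigr => i _.
  rewrite -!sumrB -big_split/= -sumrB; apply: eq_bigr => j _.
  have alg (a b k e f g : R) : a - b = a - b + k - e - (k - (f + g)) + e - (f + g) by ring.
  exact: alg.
have -> : dotv ((2 / Num.sqrt n%:R) *: \sum_(i < n) hajek_sign (y i w)) t = 2 * h.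
  rewrite /h -dotv_suml /m !dotvZl dotvZr; ring.
have n2 : 2 <= n%:R :> R by rewrite ler_nat.
rewrite bin2_natr; move: S1 S2 h (\int[P]_w _) (dotv t _) (n%:R : R) n2 => S1 S2 h e k q q2.
by field; apply/andP; split; apply: lt0r_neq0; lra.
Qed.

Lemma bounded_measurable_hl_rem A n t : (1 < n)%N ->
  bounded_measurable (fun w => hl_rem A n t w).
Proof.
move=> n1; under eq_fun do rewrite (hl_remE _ _ _ n1).
apply: bounded_measurableD; last exact: bounded_measurable_cst.
apply: bounded_measurableM; first exact: bounded_measurable_cst.
apply: bounded_measurableB; apply: bounded_measurable_sum => i;
  apply: bounded_measurable_sum => j; apply: by2.
  exact: bounded_rem_kernel.
exact: bounded_sign_kernel.
Qed.

Let rem_kernel_mean m : \int[F]_v \int[F]_u rem_kernel m (v, u) = 0.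
Proof.
have bZ : bounded_measurable (fun w => norm_rem (Z w) m) :=
  by2 0 1 (bmean (bounded_measurable_norm_rem m)).
rewrite -(Rintegral_law2 y_indep y_law (i := 0%N) (j := 1%N) (g := rem_kernel m))//.
exact: Rintegral_centered bZ.
Qed.

Let rem_kernel_var m : \int[F]_v \int[F]_u rem_kernel m (v, u) ^+ 2 <=
  \int[P]_w norm_rem (Z w) m ^+ 2.
Proof.
have bZ : bounded_measurable (fun w => norm_rem (Z w) m) :=
  by2 0 1 (bmean (bounded_measurable_norm_rem m)).
rewrite -(Rintegral_law2 y_indep y_law (i := 0%N) (j := 1%N) (g := fun x => rem_kernel m x ^+ 2))//; last first.
  exact: bounded_measurable_sqr.
exact: Rvariance_le bZ.
Qed.

Let sign_kernel_degenerate1 t v : \int[F]_u sign_kernel t (v, u) = 0.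
Proof.
have bi f : bounded_measurable f -> _ := @bounded_measurable_integrable _ _ _ F f.
have bs := bounded_measurable_snd (bmean (bounded_measurable_dotv_sign t)) v.
have bh := bounded_measurable_dotv_hajek t.
have bc := bounded_measurable_cst V (dotv (hajek_sign v) t).
rewrite (RintegralB measurableT (bi _ bs) (bi _ (bounded_measurableD bc bh))).
rewrite (RintegralD measurableT (bi _ bc) (bi _ bh)).
rewrite [X in _ - (X + _)](Rintegral_cst1 F) [X in _ - (_ + X)]mean_dotv_hajek.
by rewrite [X in X - _]Rintegral_dotv_sign addr0 subrr.
Qed.

Let sign_kernel_degenerate2 t u : \int[F]_v sign_kernel t (v, u) = 0.
Proof.
rewrite -(sign_kernel_degenerate1 t u); apply: eq_Rintegral => v _.
have alg (a b c : R) : a - (b + c) = a - (c + b) by ring.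
by rewrite /sign_kernel/= (addrC v u); exact: alg.
Qed.

(** The 3 comes from squaring a sum of three terms, 16 / n^2 from [bin2_ratio_le], 4 n^3 and n^2
    from the two variance bounds: 192 = 3 * 16 * 4 and 48 = 3 * 16. The factor 1 / n of the second
    term is the square of the scale in [m]. *)
Lemma hl_rem_sqr_le A n t : (1 < n)%N ->
  \int[P]_w hl_rem A n t w ^+ 2 <=
  192 * n%:R * \int[P]_w norm_rem (Z w) ((Num.sqrt n%:R)^-1 *: t) ^+ 2 +
  48 / n%:R * \int[F]_v \int[F]_u sign_kernel t (v, u) ^+ 2 +
  3 * (n%:R * \int[P]_w norm_rem (Z w) ((Num.sqrt n%:R)^-1 *: t) -
       2^-1 * dotv t (A *m t)) ^+ 2.
Proof.
move=> n1; set m := _ *: t.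
have n2 : 2 <= n%:R :> R by rewrite ler_nat.
have n0 : 0 < n%:R :> R by lra.
under eq_Rintegral => w _ do rewrite (hl_remE A t w n1).
have bsum (k : V * V -> R) : bounded_measurable k -> bounded_measurable (fun w : T =>
    \sum_(i < n) \sum_(j < n | (i < j)%N) k (y i w, y j w)).
  move=> bk; apply: bounded_measurable_sum => i.
  by apply: bounded_measurable_sum => j; exact: (by2 i j bk).
apply: le_trans (Rintegral_sqr_le3 P (bsum _ (bounded_rem_kernel m)) _ _
  (bsum _ (bounded_sign_kernel m))) _.
rewrite -/m lerD2r.
have v1 := le_trans (ustat_variance_le y_indep y_law (bounded_rem_kernel m) n (rem_kernel_mean m))
  (ler_wpM2l (mulr_ge0 (ler0n R 4) (exprn_ge0 3 (ltW n0))) (rem_kernel_var m)).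
have v2 := ustat_degenerate_variance_le y_indep y_law (bounded_sign_kernel m) n
  (sign_kernel_degenerate1 m) (sign_kernel_degenerate2 m).
have sE : \int[F]_v \int[F]_u sign_kernel m (v, u) ^+ 2 =
    n%:R^-1 * \int[F]_v \int[F]_u sign_kernel t (v, u) ^+ 2.
  have bi h : bounded_measurable h -> _ := @bounded_measurable_integrable _ _ _ F h.
  have bk := bounded_measurable_sqr (bounded_sign_kernel t).
  rewrite -(RintegralZl (f := fun v => \int[F]_u sign_kernel t (v, u) ^+ 2) n%:R^-1 measurableT
    (bi _ (bounded_measurable_fubini_F F F bk))).
  apply: eq_Rintegral => v _.
  rewrite -(RintegralZl (f := fun u => sign_kernel t (v, u) ^+ 2) n%:R^-1 measurableT
    (bi _ (bounded_measurable_snd bk v))).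
  apply: eq_Rintegral => u _.
  have -> : sign_kernel m (v, u) = (Num.sqrt n%:R)^-1 * sign_kernel t (v, u).
    by rewrite /sign_kernel/= /m !dotvZr -mulrDr -mulrBr.
  by rewrite exprMn exprVn sqr_sqrtr// ltW.
rewrite sE in v2.
apply: le_trans (ler_wpM2l _ (lerD v1 v2)) _; first by rewrite mulr_ge0// sqr_ge0.
have V0 : 0 <= \int[P]_w norm_rem (Z w) m ^+ 2 by apply: Rintegral_ge0 => w _; exact: sqr_ge0.
have W0 : 0 <= \int[F]_v \int[F]_u sign_kernel t (v, u) ^+ 2.
  by apply: Rintegral_ge0 => v _; apply: Rintegral_ge0 => u _; exact: sqr_ge0.
have a2 : (n%:R / 'C(n, 2)%:R) ^+ 2 <= 16 / n%:R ^+ 2 :> R. by exact: bin2_ratio_le.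
move: (_ ^+ 2) a2 (\int[P]_w _) V0 (\int[F]_v _) W0 => a a2 v V0 u W0.
apply: (@le_trans _ _ (3 * (16 / n%:R ^+ 2) * (4 * n%:R ^+ 3 * v + n%:R ^+ 2 * (n%:R^-1 * u)))).
  rewrite ler_wpM2r ?ler_pM2l//.
  by rewrite addr_ge0// mulr_ge0 ?mulr_ge0 ?exprn_ge0 ?invr_ge0// ltW.
rewrite le_eqVlt; apply/orP; left; apply/eqP; field; by rewrite gt_eqF.
Qed.

Hypothesis null_Z : P [set w | Z w = 0] = 0%E.
Hypothesis int_inv : P.-integrable setT (EFin \o (fun w => (enorm (Z w))^-1)).

Let mZ : measurable_fun setT Z.
Proof.
apply: measurable_funZ_cv; first exact: measurable_cst.
by apply: measurable_funD_cv; exact: measurable_funP.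
Qed.

(** In [hl_rem_sqr_le] the first term is of order n n^(-3/2), the second of order 1 / n, and the
    third is a squared bias tending to 0. *)
Lemma cvg_hl_rem t : let A := expectation_mx P (fun w => norm_hess (Z w)) in
  \int[P]_w hl_rem A n t w ^+ 2 @[n --> \oo] --> 0.
Proof.
move=> A; pose e (n : nat) : R := (Num.sqrt n%:R)^-1.
pose r n := n%:R * \int[P]_w norm_rem (Z w) (e n *: t).
pose c := \int[P]_w (enorm (Z w))^-1.
pose W := \int[F]_v \int[F]_u sign_kernel t (v, u) ^+ 2.
pose q := 2^-1 * dotv t (A *m t).
have eE (n : nat) : (1 < n)%N -> n%:R * e n ^+ 2 = 1.
  by move=> n1; rewrite /e exprVn sqr_sqrtr// mulfV// pnatr_eq0 gtn_eqF// ltnW.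
apply: (@squeeze_cvgr _ _ _ _ (fun=> 0)
    (fun n => e n * (768 * enorm t ^+ 3 * c + e n * (48 * W)) + 3 * (r n - q) ^+ 2)).
- exists 2%N => // n /= n1; rewrite Rintegral_ge0; last by move=> w _; exact: sqr_ge0.
  apply: le_trans (hl_rem_sqr_le A t n1) _; rewrite -/(e n) -/(r n) -/q -/W lerD2r.
  rewrite mulrDr lerD//.
    apply: le_trans (ler_wpM2l _ (expected_norm_rem_sqr_le mZ null_Z int_inv _)) _.
      by rewrite mulr_ge0.
    rewrite -/c enormZ (ger0_norm (x := e n)) ?invr_ge0 ?sqrtr_ge0// exprMn.
    rewrite (_ : 192 * _ * _ = n%:R * e n ^+ 2 * (e n * (768 * enorm t ^+ 3 * c))); last by ring.
    by rewrite eE// mul1r.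
  rewrite (_ : e n * _ = e n ^+ 2 * (48 * W)); last by rewrite mulrA -expr2.
  have -> : e n ^+ 2 = n%:R^-1 by rewrite /e exprVn sqr_sqrtr.
  by rewrite mulrA [n%:R^-1 * 48]mulrC.
- exact: cvg_cst.
have e0 : e n @[n --> \oo] --> 0 by exact: cvg_inv_sqrt_natr.
have rq : r n @[n --> \oo] --> q by exact: cvg_expected_norm_rem.
rewrite [X in _ --> X](_ : 0 = 0 * (768 * enorm t ^+ 3 * c + 0 * (48 * W)) + 3 * ((q - q) * (q - q))); last first.
  by rewrite subrr !mul0r mulr0 addr0.
have rqq : (r n - q) @[n --> \oo] --> q - q by apply: cvgB => //; exact: cvg_cst.
apply: cvgD.
  apply: cvgM => //; apply: cvgD; first exact: cvg_cst.
  by apply: cvgM => //; exact: cvg_cst.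
by apply: cvgM; [exact: cvg_cst|exact: cvgM].
Qed.

End hajek_projection.

(** * Convexity of the objective *)

Section jensen_closure.
Context (R : realType) (p : nat).
Local Notation V := 'cV[R]_p.
Implicit Types g h : V -> R.

Lemma jensen_convexD g h : jensen_convex g -> jensen_convex h ->
  jensen_convex (fun t => g t + h t).
Proof.
move=> cg ch n v l x l0 l1; apply: le_trans (lerD (cg n v l x l0 l1) (ch n v l x l0 l1)) _.
rewrite addrACA -mulrDr -big_split/= lerD2l.
by under eq_bigr do rewrite -mulrDr.
Qed.

Lemma jensen_convexZ a g : 0 <= a -> jensen_convex g -> jensen_convex (fun t => a * g t).
Proof.
move=> a0 cg n v l x l0 l1; apply: le_trans (ler_wpM2l a0 (cg n v l x l0 l1)) _.
rewrite mulrDr mulrCA lerD2l mulr_sumr.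
by under eq_bigr do rewrite mulrCA.
Qed.

Lemma jensen_convex_affine (c : R) (u : V) : jensen_convex (fun t => c + dotv u t).
Proof.
move=> n v l x l0 l1; rewrite dotvDr dotv_sumr mulrBl mul1r mulr_suml addrA -[leRHS]addrA lerD2l.
rewrite -sumrN -big_split/=; apply: ler_sum => i _.
by rewrite dotvZr dotvBr; lra.
Qed.

Lemma jensen_convex_sum I (s : seq I) (Q : pred I) (g : I -> V -> R) :
  (forall i, jensen_convex (g i)) -> jensen_convex (fun t => \sum_(i <- s | Q i) g i t).
Proof.
move=> cg; elim: s => [|i s IH].
  move=> n v l x l0 l1; rewrite !big_nil mulr0 add0r; apply: sumr_ge0 => i _.
  by rewrite big_nil mulr0.
under [X in jensen_convex X]eq_fun do rewrite big_cons.
by case: (Q i) => //; exact: jensen_convexD.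
Qed.

Lemma jensen_convex_enorm (z : V) (e : R) : jensen_convex (fun t => enorm (z - e *: t)).
Proof.
move=> n v l x l0 l1.
have -> : z - e *: (v + \sum_i l i *: (x i - v)) =
    (1 - \sum_i l i) *: (z - e *: v) + \sum_i l i *: (z - e *: x i).
  rewrite scalerBl scale1r scaler_suml -addrA -sumrN -big_split/= scalerDr opprD addrA.
  congr (_ + _); rewrite scaler_sumr -sumrN; apply: eq_bigr => i _.
  rewrite [RHS]addrC -scalerBr opprB [z - _ + _]addrC addrA subrK -scalerBr -!scalerN opprB.
  by rewrite !scalerA mulrC.
apply: le_trans (enormD _ _) _; rewrite enormZ ger0_norm ?subr_ge0// lerD2l.
apply: le_trans (enorm_sum _ _ _) _; apply: ler_sum => i _.
by rewrite enormZ ger0_norm.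
Qed.

Lemma jensen_convex_hl_objective (x : nat -> V) n (a e : R) (u : V) : 0 <= a ->
  jensen_convex (fun t => a * hl_objective x n (e *: t) + dotv u t).
Proof.
move=> a0.
pose b := a * 'C(n, 2)%:R^-1.
rewrite (_ : (fun t => _) = fun t : V => b * (\sum_(i < n) \sum_(j < n | (i < j)%N)
      enorm (walsh x i j - e *: t)) +
    (- (b * \sum_(i < n) \sum_(j < n | (i < j)%N) enorm (walsh x i j)) + dotv u t)).
  apply: jensen_convexD; last exact: jensen_convex_affine.
  apply: jensen_convexZ; first by rewrite mulr_ge0 ?invr_ge0.
  apply: jensen_convex_sum => i; apply: jensen_convex_sum => j.
  exact: jensen_convex_enorm.
apply/funext => t; rewrite addrA -mulrBr -sumrB /hl_objective mulrA; congr (_ * _ + _).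
by apply: eq_bigr => i _; rewrite sumrB.
Qed.

End jensen_closure.

(** * From the remainder to the estimator *)

Section hl_limit.
Context (R : realType) (p : nat).
Local Notation V := 'cV[R]_p.
Context d (T : measurableType d) (P : probability T R) (F : probability V R).
Context (y : nat -> {RV P >-> V}).
Context (y_indep : mutually_independent P y).
Context (y_law : forall i B, measurable B -> distribution P (y i) B = F B).
Context (muHL : nat -> {RV P >-> V}).
Context (muHL_HL : forall n w, is_minimizer (hl_objective (fun k => y k w) n) (muHL n w)).
Context (A : 'M[R]_p) (lam : R) (symA : A^T = A) (unitA : A \in unitmx) (lam0 : 0 < lam).
Context (coercA : forall v, lam * enorm v ^+ 2 <= dotv v (A *m v)).

(** Scaled so that [alpha n] is A^-1 W_n. *)
Definition hajek_term (v : V) : V := 2 *: (invmx A *m hajek_sign F v).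

Context (ms : seq V) (mG : centered_moments F hajek_term (gram ms)).
Hypothesis hl_rem0 : forall t, \int[P]_w hl_rem F y A n t w ^+ 2 @[n --> \oo] --> 0.

Let alpha n w : V := (Num.sqrt n%:R)^-1 *: \sum_(i < n) hajek_term (y i w).

(** Deterministic for each outcome: sqrt n times the estimator minimizes the rescaled objective,
    whose linear part W_n . t plays the role of the tilt in [convex_argmin_close]. *)
Lemma hl_estimator_close K delta : 0 <= K -> 0 < delta ->
  exists (J : finType) (pt : J -> V) (eta : R), 0 < eta /\
  forall n w, (0 < n)%N -> (forall j, `|hl_rem F y A n (pt j) w| <= eta) ->
    enorm (alpha n w) <= K ->
    enorm (Num.sqrt n%:R *: muHL n w - alpha n w) <= delta.
Proof.
move=> K0 delta0.
have [J [pt [eta [eta0 H]]]] := convex_argmin_close symA lam0 coercA K0 delta0.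
exists J, pt, eta; split => // n w n0 remle aK.
have sn : Num.sqrt n%:R != 0 :> R by rewrite gt_eqF// sqrtr_gt0 ltr0n.
pose W : V := (2 / Num.sqrt n%:R) *: \sum_(i < n) hajek_sign F (y i w).
have WE : A *m alpha n w = W.
  rewrite /alpha /W /hajek_term -scaler_sumr -mulmx_sumr scalerA -scalemxAr mulKVmx//.
  by rewrite mulrC.
apply: (H (fun t => n%:R * hl_objective (fun k => y k w) n ((Num.sqrt n%:R)^-1 *: t) + dotv W t)) => //.
  by apply: jensen_convex_hl_objective.
move=> u; rewrite WE !addrK scalerA mulVf// scale1r.
by apply: ler_wpM2l => //; exact: muHL_HL.
Qed.

Lemma bounded_measurable_hajek_term i : bounded_measurable (fun v => hajek_term v i 0).
Proof.
rewrite (_ : (fun v => _) = fun v => 2 * \sum_j invmx A i j * hajek_sign F v j 0).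
  apply: bounded_measurableM; first exact: bounded_measurable_cst.
  apply: bounded_measurable_sum => j.
  by apply: bounded_measurableM; [exact: bounded_measurable_cst|exact: bounded_measurable_hajek_sign].
by apply/funext => v; rewrite !mxE.
Qed.

Let bsum_term n i : bounded_measurable (fun w => \sum_(k < n) hajek_term (y k w) i 0).
Proof.
apply: bounded_measurable_sum => k.
exact: (bounded_measurable_comp (measurable_funP (y k)) (bounded_measurable_hajek_term i)).
Qed.

Let sqr_alpha n w : enorm (alpha n w) ^+ 2 =
  \sum_i (n%:R^-1 * (\sum_(k < n) hajek_term (y k w) i 0) ^+ 2).
Proof.
rewrite sqr_enorm dotvvE; apply: eq_bigr => i _.
by rewrite !mxE summxE exprMn exprVn sqr_sqrtr.
Qed.

Let bsqr_alpha n : bounded_measurable (fun w => enorm (alpha n w) ^+ 2).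
Proof.
under eq_fun do rewrite sqr_alpha.
apply: bounded_measurable_sum => i; apply: bounded_measurableM.
  exact: bounded_measurable_cst.
exact: bounded_measurable_sqr (bsum_term n i).
Qed.

Let malpha n : measurable_fun setT (alpha n).
Proof.
apply: measurable_funZ_cv; first exact: measurable_cst.
apply: measurable_sum_cv => k; apply/measurable_cvP => i.
exact: (bounded_measurable_comp (measurable_funP (y k)) (bounded_measurable_hajek_term i)).1.
Qed.

Lemma hajek_sum_tight : exists2 C : R, 0 <= C &
  forall n, (1 < n)%N -> \int[P]_w enorm (alpha n w) ^+ 2 <= C.
Proof.
have /choice[C CP] i : exists C : R, 0 <= C /\ forall n, (1 < n)%N ->
    \int[P]_w (\sum_(k < n) hajek_term (y k w) i 0) ^+ 2 <= C * n%:R.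
  have [_ m1 _ _] := mG; have [_ m0] := m1 i.
  by have [C C0 HC] := sum_variance_le y_indep y_law (bounded_measurable_hajek_term i) m0; exists C.
exists (\sum_i C i) => [|n n1]; first by apply: sumr_ge0 => i _; have [] := CP i.
under eq_Rintegral do rewrite sqr_alpha.
have bi i := bounded_measurable_integrable P (bounded_measurable_sqr (bsum_term n i)).
rewrite Rintegral_sum; last by move=> i; exact: (integrableZl measurableT n%:R^-1 (bi i)).
apply: ler_sum => i _.
rewrite (RintegralZl (f := fun w => (\sum_(k < n) hajek_term (y k w) i 0) ^+ 2) n%:R^-1
  measurableT (bi i)).
have n0 : 0 < n%:R :> R by rewrite ltr0n ltnW.
by rewrite mulrC ler_pdivrMr//; exact: (CP i).2.
Qed.

(** Pointwise, a good outcome costs L delta. On the others the trivial bound 2 M is multiplied by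
    the square of |alpha| / K or of a remainder over [eta], as in Markov's inequality but without
    probabilities of events. *)
Lemma hl_estimator_smooth_le (phi : V -> R) (M L K delta : R) : measurable_fun setT phi ->
  (forall x, `|phi x| <= M) ->
  (forall x z, `|phi x - phi z| <= L * enorm (x - z)) -> 0 < K -> 0 < delta -> 0 <= L ->
  exists (c : nat -> R), c @ \oo --> 0 /\ forall n, (1 < n)%N ->
    `|\int[P]_w phi (Num.sqrt n%:R *: muHL n w) - \int[P]_w phi (alpha n w)| <=
    L * delta + 2 * M / K ^+ 2 * \int[P]_w enorm (alpha n w) ^+ 2 + c n.
Proof.
move=> mphi phiM phiL K0 delta0 L0.
have M0 : 0 <= M by exact: le_trans (phiM 0).
have [J [pt [eta [eta0 close]]]] := hl_estimator_close (ltW K0) delta0.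
exists (fun n => 2 * M / eta ^+ 2 * \sum_j \int[P]_w hl_rem F y A n (pt j) w ^+ 2); split.
  rewrite -[X in _ --> X](mulr0 (2 * M / eta ^+ 2)); apply: cvgM; first exact: cvg_cst.
  rewrite [X in _ --> X](_ : 0 = \sum_(j : J) 0); last by rewrite big1.
  by apply: cvg_big => [|j _]; [exact: add_continuous|exact: hl_rem0].
move=> n n1.
have mt : measurable_fun setT (fun w => Num.sqrt n%:R *: muHL n w).
  by apply: measurable_funZ_cv; [exact: measurable_cst|exact: measurable_funP].
have bphi : bounded_measurable phi by split => //; exists M.
have b1 := bounded_measurable_comp mt bphi.
have b2 := bounded_measurable_comp (malpha n) bphi.
have bi h : bounded_measurable h -> _ := @bounded_measurable_integrable _ _ _ P h.
have br : bounded_measurable (fun w => \sum_j hl_rem F y A n (pt j) w ^+ 2).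
  apply: bounded_measurable_sum => j; apply: bounded_measurable_sqr.
  exact: bounded_measurable_hl_rem.
rewrite -(RintegralB measurableT (bi _ b1) (bi _ b2)).
rewrite -Rintegral_sum; last first.
  move=> j; apply: bi; apply: bounded_measurable_sqr; exact: bounded_measurable_hl_rem.
rewrite -(Rintegral_affine2 P (bsqr_alpha n) (2 * M / K ^+ 2) (2 * M / eta ^+ 2) (L * delta) br).
apply: le_trans (le_normr_Rintegral _ (bi _ (bounded_measurableB b1 b2))) _ => //.
apply: le_Rintegral => //.
- apply: bi; split; first exact: measurableT_comp (bounded_measurableB b1 b2).1.
  have [_ [N HN]] := bounded_measurableB b1 b2.
  by exists N => w; rewrite normr_id; exact: HN.
- apply: bi; apply: bounded_measurableD; last first.
    by apply: bounded_measurableM => //; exact: bounded_measurable_cst.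
  apply: bounded_measurableD; first exact: bounded_measurable_cst.
  by apply: bounded_measurableM => //; exact: bounded_measurable_cst.
move=> w _ /=.
have Ld : 0 <= L * delta by rewrite mulr_ge0// ltW.
have a0 : 0 <= 2 * M / K ^+ 2 * enorm (alpha n w) ^+ 2.
  by rewrite mulr_ge0 ?sqr_ge0// divr_ge0 ?sqr_ge0// mulr_ge0.
have r0 : 0 <= 2 * M / eta ^+ 2 * \sum_j hl_rem F y A n (pt j) w ^+ 2.
  rewrite mulr_ge0 ?divr_ge0 ?sqr_ge0 ?mulr_ge0//.
  by apply: sumr_ge0 => j _; exact: sqr_ge0.
have D2 : `|phi (Num.sqrt n%:R *: muHL n w) - phi (alpha n w)| <= 2 * M.
  by apply: le_trans (ler_normB _ _) _; rewrite mulr_natl mulr2n lerD.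
have big (x c : R) : 0 < c -> c < x -> 2 * M <= 2 * M / c ^+ 2 * x ^+ 2.
  move=> c0 cx; rewrite -mulrA ler_peMr ?mulr_ge0// mulrC ler_pdivlMr ?exprn_gt0// mul1r.
  by rewrite lerXn2r ?nnegrE ?(ltW c0) ?(ltW cx)// ltW// (lt_trans c0).
have [aK|aK] := leP (enorm (alpha n w)) K; last first.
  by apply: le_trans D2 _; have := big _ _ K0 aK; lra.
have [|/existsNP[j]] := pselect (forall j, `|hl_rem F y A n (pt j) w| <= eta).
  move=> remle; apply: le_trans (phiL _ _) _.
  have := ler_wpM2l L0 (close n w (ltnW n1) remle aK); lra.
move=> /negP; rewrite -ltNge => /(big _ _ eta0); rewrite real_normK ?num_real// => Mj.
apply: le_trans D2 _; apply: le_trans Mj _.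
rewrite -[leLHS]add0r lerD ?addr_ge0// ler_wpM2l ?divr_ge0 ?sqr_ge0 ?mulr_ge0//.
by rewrite (bigD1 j)//= lerDl; apply: sumr_ge0 => i _; exact: sqr_ge0.
Qed.

Theorem hl_cvg_in_law :
  cvg_in_law P (fun n w => Num.sqrt n%:R *: muHL n w) (gauss_law ms).
Proof.
apply: smooth3_cvg_in_law => [n|phi sphi].
  by apply: measurable_funZ_cv; [exact: measurable_cst|exact: measurable_funP].
have [mphi [M phiM]] := smooth3_bounded_measurable sphi.
have [L0 phiL0] := smooth3_lipschitz sphi.
pose L := `|L0|.
have phiL x z : `|phi x - phi z| <= L * enorm (x - z).
  by apply: le_trans (phiL0 x z) _; rewrite ler_wpM2r ?enorm_ge0// ler_norm.
have M0 : 0 <= M by exact: le_trans (phiM 0).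
have [C C0 tight] := hajek_sum_tight.
have [Q Q0 clt] := clt_smooth3 sphi y_indep y_law mG.
(* One quarter of [e] each for L delta, the tail of alpha, [c n] and the central limit theorem. *)
apply/cvgrPdist_le => e e0; pose e4 := e / 4; have e40 : 0 < e4 by rewrite divr_gt0.
pose delta := e4 / (L + 1).
have L1 : 0 < L + 1 by rewrite ltr_wpDl// normr_ge0.
have delta0 : 0 < delta by rewrite divr_gt0.
have Ld : L * delta <= e4.
  by rewrite /delta mulrCA ler_piMr ?(ltW e40)// ler_pdivrMr// mul1r lerDl.
(* As K >= 1, the tail term 2 M C / K^2 is at most 2 M C / K, hence at most [e4]. *)
pose K := 1 + 2 * M * C / e4.
have MC : 0 <= 2 * M * C by rewrite mulr_ge0// mulr_ge0.
have K1 : 1 <= K by rewrite lerDl divr_ge0// (ltW e40).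
have K0 : 0 < K by exact: lt_le_trans K1.
have KC : 2 * M / K ^+ 2 * C <= e4.
  rewrite mulrAC ler_pdivrMr ?exprn_gt0//.
  apply: (@le_trans _ _ (e4 * K)).
    by rewrite /K mulrDr mulr1 mulrCA mulfV ?gt_eqF// mulr1; lra.
  by rewrite ler_pM2l// ler_eXnr.
have [c [c0 bound]] := hl_estimator_smooth_le mphi phiM phiL K0 delta0 (normr_ge0 L0).
have [N1 _ HN1] : \forall n \near \oo, `|0 - c n| <= e4 by move/cvgrPdist_le: c0; exact.
have q0 : Q / Num.sqrt n%:R @[n --> \oo] --> 0.
  rewrite -[X in _ --> X](mulr0 Q); apply: cvgM; [exact: cvg_cst|exact: cvg_inv_sqrt_natr].
have [N2 _ HN2] : \forall n \near \oo, `|0 - Q / Num.sqrt n%:R| <= e4 by move/cvgrPdist_le: q0; exact.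
exists (maxn 2 (maxn N1 N2)) => // n /=; rewrite !geq_max => /and3P[n1 nN1 nN2].
have := HN1 n nN1; have := HN2 n nN2; rewrite !sub0r !normrN => q4 c4.
have b1 := bound n n1; have b2 := clt n (ltnW n1); have t1 := tight n n1.
have K2 : 2 * M / K ^+ 2 * \int[P]_w enorm (alpha n w) ^+ 2 <= e4.
  by apply: le_trans KC; rewrite ler_wpM2l// divr_ge0 ?sqr_ge0 ?mulr_ge0.
rewrite distrC; apply: le_trans (ler_distD (\int[P]_w phi (alpha n w)) _ _) _.
have eE : e = e4 + e4 + e4 + e4 by rewrite /e4; field.
rewrite eE -addrA; apply: (@le_trans _ _ ((e4 + e4 + e4) + e4)); last by rewrite addrA.
apply: lerD.
  apply: le_trans b1 _; rewrite lerD ?lerD//.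
  exact: le_trans (ler_norm _) c4.
by apply: le_trans b2 _; exact: le_trans (ler_norm _) q4.
Qed.

End hl_limit.

(** * Limit law *)

Section moment_matrix.
Context (R : realType) (p : nat).
Local Notation V := 'cV[R]_p.
Context d (T : measurableType d) (P : probability T R).

Definition moment_mx (f : T -> V) : 'M[R]_p :=
  \matrix_(i, j) \int[P]_w (f w i 0 * f w j 0).

Context (f : T -> V) (bf : forall i, bounded_measurable (fun w => f w i 0)).

Lemma moment_mx_tr : (moment_mx f)^T = moment_mx f.
Proof. by apply/matrixP => i j; rewrite !mxE; apply: eq_Rintegral => w _; rewrite mulrC. Qed.

Let Rintegral_bilinear (c : 'I_p -> 'I_p -> R) :
  \int[P]_w (\sum_k \sum_l c k l * (f w k 0 * f w l 0)) =
  \sum_k \sum_l c k l * moment_mx f k l.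
Proof.
have bi h : bounded_measurable h -> _ := @bounded_measurable_integrable _ _ _ P h.
have bkl k l : bounded_measurable (fun w => f w k 0 * f w l 0) by exact: bounded_measurableM.
have bckl k l : bounded_measurable (fun w => c k l * (f w k 0 * f w l 0)).
  by apply: bounded_measurableM => //; exact: bounded_measurable_cst.
rewrite Rintegral_sum; last by move=> k; apply: integrable_Rsum => l; exact: bi.
apply: eq_bigr => k _; rewrite Rintegral_sum; last by move=> l; exact: bi.
apply: eq_bigr => l _; rewrite mxE.
by rewrite (RintegralZl (f := fun w => f w k 0 * f w l 0) _ measurableT (bi _ (bkl k l))).
Qed.

Lemma moment_mx_ge0 t : 0 <= dotv t (moment_mx f *m t).
Proof.
rewrite dotv_mulmxE.
under eq_bigr do under eq_bigr do rewrite mulrC.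
rewrite -(Rintegral_bilinear (fun k l => t k 0 * t l 0)); apply: Rintegral_ge0 => w _.
rewrite (_ : \sum_k _ = dotv t (f w) ^+ 2) ?sqr_ge0// /dotv expr2 mulr_suml.
apply: eq_bigr => k _; rewrite mulr_sumr; apply: eq_bigr => l _; ring.
Qed.

Lemma moment_mx_mulmx (N : 'M[R]_p) :
  moment_mx (fun w => N *m f w) = N *m moment_mx f *m N^T.
Proof.
apply/matrixP => i j; rewrite [LHS]mxE.
transitivity (\sum_k \sum_l (N i k * N j l) * moment_mx f k l).
  rewrite -Rintegral_bilinear; apply: eq_Rintegral => w _.
  rewrite !mxE mulr_suml; apply: eq_bigr => k _; rewrite mulr_sumr; apply: eq_bigr => l _; ring.
rewrite exchange_big/= [RHS]mxE; apply: eq_bigr => l _.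
rewrite [X in X * _]mxE mulr_suml [N^T _ _]mxE; apply: eq_bigr => k _; ring.
Qed.

Lemma bounded_centered_moments : (forall i, \int[P]_w f w i 0 = 0) ->
  centered_moments P f (moment_mx f).
Proof.
move=> f0.
have mf : measurable_fun setT f by apply/measurable_cvP => i; exact: (bf i).1.
split => //.
- by move=> i; split; [exact: bounded_measurable_integrable|].
- move=> i j; rewrite mxE; split => //.
  by apply: bounded_measurable_integrable; exact: bounded_measurableM.
have /choice[M HM] i : exists M : R, forall w, `|f w i 0| <= M by have [_] := bf i.
have bn : bounded_measurable (fun w => enorm (f w)).
  split; first exact: measurableT_comp (@measurable_enorm R p) mf.
  exists (\sum_i M i) => w; rewrite ger0_norm ?enorm_ge0//.
  by apply: le_trans (enorm_le_sum _) _; apply: ler_sum => i _.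
apply: bounded_measurable_integrable; apply: bounded_measurableM => //.
exact: bounded_measurableM.
Qed.

End moment_matrix.

(* The sample is indexed from 0, so y k is the (k+1)-st observation. *)
Theorem theorem6 (R : realType) (p : nat) (hp : (1 < p)%N)
  (d : measure_display) (Omega : measurableType d) (P : probability Omega R)
  (F : probability 'cV[R]_p R)
  (y : nat -> {RV P >-> 'cV[R]_p})
  (y_indep : mutually_independent P y)
  (y_law : forall i B, measurable B -> distribution P (y i) B = F B)
  (z := fun (i j : nat) (w : Omega) => walsh (fun k => y k w) i j)
  (z_density : forall i j : nat, (i < j)%N -> exists f : 'cV[R]_p -> R,
     [/\ has_density P (z i j) f, continuous f & bounded_fun (f : _ -> R^o)])
  (z_median : forall i j : nat, (i < j)%N -> forall mu : 'cV[R]_p,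
     is_spatial_median P (z i j) mu <-> mu = 0)
  (muHL : nat -> {RV P >-> 'cV[R]_p})
  (muHL_HL : forall n w, is_minimizer (hl_objective (fun k => y k w) n) (muHL n w))
  (A := expectation_mx P (fun w => (enorm (z 0%N 1%N w))^-1 *:
     (1%:M - (enorm (z 0%N 1%N w)) ^- 2 *: (z 0%N 1%N w *m (z 0%N 1%N w)^T))))
  (B := expectation_mx P (fun w =>
     ((enorm (z 0%N 1%N w))^-1 *: z 0%N 1%N w) *m ((enorm (z 1%N 2%N w))^-1 *: (z 1%N 2%N w)^T))) :
  exists Q : probability 'cV[R]_p R,
    is_mvnormal 0 (4 *: (invmx A *m B *m invmx A)) Q /\
    cvg_in_law P (fun n w => Num.sqrt n%:R *: muHL n w) Q.
Proof.
have [f [df _ bf]] := z_density 0%N 1%N isT.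
have [M M0 leM] := bounded_density_le df bf.
have mz : measurable_fun setT (z 0%N 1%N).
  apply: measurable_funZ_cv; first exact: measurable_cst.
  by apply: measurable_funD_cv; exact: measurable_funP.
have null_z := null_origin hp mz M0 leM.
have int_z := integrable_inv_enorm hp mz M0 leM.
have mean0 t := expected_spatial_sign0 mz null_z int_z t ((z_median 0%N 1%N isT 0).2 erefl).
have symA : A^T = A := expected_norm_hess_tr P (z 0%N 1%N).
have posA v : v != 0 -> 0 < dotv v (A *m v).
  move=> v0; apply: (expected_norm_hess_gt0 mz null_z int_z).
  exact: (line_probability_lt1 hp mz M0 leM v0).
have [unitA [lam lam0 coercA]] := pd_coercive symA posA.
have bh i := bounded_measurable_hajek_sign F i.
(* The two Walsh averages share one observation, so [B] is a second-moment matrix, and in particular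
   symmetric and positive semidefinite. *)
have BE : B = moment_mx F (hajek_sign F).
  apply/matrixP => i j; rewrite [RHS]mxE (hajek_sign_moment y_indep y_law) mxE unlock.
  by congr fine; apply: eq_integral => w _; rewrite mxE big_ord1 /spatial_sign !mxE.
have termE : hajek_term F A = fun v => (2 *: invmx A) *m hajek_sign F v.
  by apply/funext => v; rewrite /hajek_term scalemxAl.
have bt i := bounded_measurable_hajek_term F A i.
(* The symmetry of [A] removes the transpose from the right factor, and the two factors 2 make the
   4. *)
have SE : 4 *: (invmx A *m B *m invmx A) = moment_mx F (hajek_term F A).
  rewrite termE moment_mx_mulmx// -BE linearZ/= trmx_inv symA -scalemxAr -!scalemxAl scalerA.
  by rewrite -natrM.
(* The vectors decomposing the covariance are the directions of the Gaussian limit. *)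
have [ms msE] := psd_gram (moment_mx_tr F (hajek_term F A)) (moment_mx_ge0 F bt).
have mG : centered_moments F (hajek_term F A) (gram ms).
  rewrite /gram -msE; apply: (bounded_centered_moments bt) => i.
  (* Coordinate i of the term is [hajek_sign] tested against twice row i of [invmx A]. *)
  rewrite -[RHS](mean_dotv_hajek y_indep y_law mean0 (2 *: row i (invmx A))^T).
  apply: eq_Rintegral => v _; rewrite !mxE /dotv mulr_sumr; apply: eq_bigr => j _.
  by rewrite !mxE; ring.
exists (gauss_law ms); split.
  rewrite SE msE; exact: gauss_law_mvnormal.
apply: (hl_cvg_in_law y_indep y_law muHL_HL symA unitA lam0 coercA mG) => t.
exact: cvg_hl_rem.
Qed.
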